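(* Let $G_n$ be the random geometric graph described in the context and $\omega$ denote clique number. Then: 1. If $nr^d\le n^{-\alpha}$ for some fixed $\alpha>0$, then with probability one $\omega(G_n)\in\{k(n),k(n)+1\}$ for all but finitely many $n$, where $k(n):=\left\lfloor\frac{\ln n}{\ln(1/(nr^d))}+\frac12\right\rfloor$. 2. If $n^{-\varepsilon}\ll nr^d\ll\ln n$ for every fixed $\varepsilon>0$, then $\omega(G_n)\big/\left(\ln n/\ln\left(\frac{\ln n}{nr^d}\right)\right)\to1$ almost surely. 3. If $\frac{\sigma nr^d}{\ln n}\to t\in(0,\infty)$, then $\frac{\omega(G_n)}{\sigma nr^d}\to f_\omega(t)$ almost surely, where $f_\omega(t)$ is the unique $f\ge \mathrm{vol}(B)/2^d$ solving $H\!\left(\frac{f\,2^d}{\mathrm{vol}(B)}\right)=\frac{2^d}{t\,\mathrm{vol}(B)}$, with $H(x)=x\ln x-x+1$. The function $f_\omega$ is continuous and strictly decreasing, $f_\omega(t)\to\mathrm{vol}(B)/2^d$ as $t\to\infty$ and $f_\omega(t)\to\infty$ as $t\downarrow0$. 4. If $nr^d\gg\ln n$ (and $r\to0$), then $\frac{\omega(G_n)}{\sigma nr^d}\to\frac{\mathrm{vol}(B)}{2^d}$ almost surely.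
   Context: Standing setup: $d\ge1$ is fixed and $\|\cdot\|$ is a fixed norm on $\mathbb R^d$; $B=\{x:\|x\|<1\}$; $\mathrm{vol}$ is Lebesgue measure. $\nu$ is a probability distribution on $\mathbb R^d$ with a bounded density $f$, and $\sigma:=\sup\{s:\mathrm{vol}(\{x:f(x)>s\})>0\}$. $X_1,X_2,\dots$ are i.i.d. with law $\nu$; $r=r(n)>0$ with $r(n)\to0$. $G_n$ has vertex set $\{1,\dots,n\}$, with $i\ne j$ adjacent iff $\|X_i-X_j\|\le r(n)$. *)

(* Defs.v *)
From HB Require Import structures.
From mathcomp Require Import all_boot all_order all_algebra.
From mathcomp Require Import all_classical all_reals all_analysis.
Set Implicit Arguments. Unset Strict Implicit. Unset Printing Implicit Defensive.
Import Order.TTheory GRing.Theory Num.Theory.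
Import numFieldNormedType.Exports.
Local Open Scope classical_set_scope.
Local Open Scope ring_scope.

Section RGG.
Variable R : realType.

Definition is_norm (d : nat) (N : 'rV[R]_d -> R) : Prop :=
  [/\ forall x, N x = 0 -> x = 0,
      forall (a : R) x, N (a *: x) = `|a| * N x
    & forall x y, N (x + y) <= N x + N y].

Definition borelRd (d : nat) : set (set 'rV[R]_d) := <<s [set A | open A] >>.

Definition vcons (d : nat) (x : R) (y : 'rV[R]_d) : 'rV[R]_d.+1 :=
  \row_(i < d.+1) match unlift ord0 i with None => x | Some j => y ord0 j end.

(** Iterated (Tonelli) Lebesgue integral over R^d of a function with values
    in \bar R: int_R ... int_R g(x_1,...,x_d) dx_d ... dx_1. For nonnegative
    Borel g this is the integral of g against d-dimensional Lebesgue measure. *)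
Fixpoint iint (d : nat) : ('rV[R]_d -> \bar R) -> \bar R :=
  match d as n return ('rV[R]_n -> \bar R) -> \bar R with
  | 0 => fun g => g 0
  | d'.+1 => fun g =>
      (\int[@lebesgue_measure R]_x iint (fun y => g (vcons x y)))%E
  end.

Definition vol (d : nat) (A : set 'rV[R]_d) : \bar R :=
  iint (fun x => (\1_A x)%:E).

Definition unit_ball (d : nat) (N : 'rV[R]_d -> R) : set 'rV[R]_d :=
  [set x | N x < 1].

Definition ess_sigma (d : nat) (f : 'rV[R]_d -> R) : R :=
  sup [set s : R | (0 < vol [set x | (s < f x)%R])%E].

Definition Hfun (x : R) : R := x * ln x - x + 1.

Definition f_omega_pred (d : nat) (vB t : R) : set R :=
  [set f : R | vB / 2 ^+ d <= f /\
     Hfun (f * 2 ^+ d / vB) = 2 ^+ d / (t * vB)].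

Definition f_omega (d : nat) (vB t : R) : R := xget 0 (f_omega_pred d vB t).

End RGG.

Section Prob.
Context {R : realType} {d0 : measure_display} {Omega : measurableType d0}.
Local Open Scope ereal_scope.

Definition has_density (d : nat) (P : probability Omega R)
    (Y : Omega -> 'rV[R]_d) (f : 'rV[R]_d -> R) : Prop :=
  forall A, borelRd A ->
    P (Y @^-1` A) = iint (fun x => (\1_A x * f x)%:E).

Definition mutually_independent (d : nat) (P : probability Omega R)
    (X : nat -> Omega -> 'rV[R]_d) : Prop :=
  forall (I : seq nat) (A : nat -> set 'rV[R]_d),
    uniq I -> (forall i, i \in I -> borelRd (A i)) ->
    P (\bigcap_(i in [set i | i \in I]) (X i @^-1` A i)) =
    \prod_(i <- I) P (X i @^-1` A i).
End Prob.

Section Graph.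
Context {R : realType} {T : Type}.
(** clique number of G_n : vertices 'I_n (standing for 1..n), i ~ j iff
    i <> j and N (X_i - X_j) <= r *)
Definition is_clique (d n : nat) (N : 'rV[R]_d -> R) (X : nat -> T -> 'rV[R]_d)
    (r : R) (w : T) (S : {set 'I_n}) : bool :=
  [forall i in S, forall j in S,
     (i != j) ==> (N (X (nat_of_ord i) w - X (nat_of_ord j) w) <= r)].

Definition clique_number (d n : nat) (N : 'rV[R]_d -> R)
    (X : nat -> T -> 'rV[R]_d) (r : R) (w : T) : nat :=
  \max_(S : {set 'I_n} | is_clique N X r w S) #|S|.
End Graph.

(* Main.v *)
(** A clique has diameter at most [r], so by the isodiametric inequality (proved
    on a lattice of cells via a discrete Brunn-Minkowski inequality) it lies in a
    union of cells of volume about [vol B * (r/2)^d], hence of probability at most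
    about [mu/n], where [mu = sigma n r^d vol B / 2^d].  There are only
    boundedly many shapes of such unions up to translation, and convexity of
    [p |-> (1 + p y)^n - 1] allows the Chernoff bound to be summed over all
    translates, at the total cost of a factor [1/r^d].  Conversely, near a density
    point of [{f > s}] with [s] close to [sigma] there are about [1/r^d] disjoint
    sets of diameter at most [r] and probability about [mu/n]; their occupancies
    are compared with independent Poisson variables by extracting a coefficient
    of a generating function.  So the clique number behaves like the maximum of
    [1/r^d] Poisson([mu]) variables, and each regime is the resulting optimisation
    with rate function [mu H(k/mu)].  Almost sure statements follow from
    Borel-Cantelli along polynomial blocks of indices. *)
Require Import Defs.
From HB Require Import structures.
From mathcomp Require Import all_boot all_order all_algebra.
From mathcomp Require Import all_classical all_reals all_analysis measurable_realfun.
From mathcomp Require Import zify ring lra.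
Set Implicit Arguments. Unset Strict Implicit. Unset Printing Implicit Defensive.
Import Order.TTheory GRing.Theory Num.Theory.
Import numFieldNormedType.Exports.
Local Open Scope classical_set_scope.
Local Open Scope ring_scope.

(** * Lebesgue measure and dyadic cells *)

(** The density may have unbounded support, so a clique can sit in infinitely many places and equal
    bounds for all of them cannot be summed; each place must be charged in proportion to its own
    probability. Hence Markov's inequality is applied to [b ^ cnt - 1] and not to [b ^ cnt]. The
    mesh of the lattice is [e * r] with [e] depending only on the tolerance and the norm, so the
    number of shapes does not grow with [n]. The two halves of a regime are summable for different
    reasons. A clique that is too small has probability at most a multiple of [n^-2], and
    Borel-Cantelli applies index by index; a clique that is too large is excluded only up to [n^-a]
    with [a] possibly small, which forces the passage to blocks. Volume is an iterated integral, so
    a measure representing it is built once; dilation of balls and the existence of cubes nearly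
    filled by a set are then derived from counting lattice cells. Events about the clique number are
    not shown measurable: they are covered by measurable events of small probability. *)

Notation Rd R d := (g_sigma_algebraType [set A : set 'rV[R]_d | open A]).

Section CellIndex.
Variables (R : realType) (d : nat).

(** Half-open cells, so that the fibres of [cix e] partition the space exactly and the volume of a
    union of cells is a count. *)
Definition cix (e : R) (x : 'rV[R]_d) : 'rV[int]_d :=
  \row_i Num.floor (x ord0 i / e).

Lemma floor_eqP (x : R) (z : int) :
  (Num.floor x = z) <-> (z%:~R <= x < z%:~R + 1).
Proof.
split=> [<-|/andP[zx xz]]; first by have := floor_itv x; rewrite intrD.
by apply: floor_def; rewrite intrD zx.
Qed.

Lemma cix_eqP (e : R) (x : 'rV[R]_d) (z : 'rV[int]_d) : 0 < e ->
  (cix e x = z) <->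
  (forall i, (z ord0 i)%:~R * e <= x ord0 i < (z ord0 i)%:~R * e + e).
Proof.
move=> e0; split.
  move=> <- i; rewrite mxE; have /floor_eqP := erefl (Num.floor (x ord0 i / e)).
  by rewrite ler_pdivlMr// ltr_pdivrMr// mulrDl mul1r.
move=> H; apply/rowP => i; rewrite mxE; apply/floor_eqP.
by rewrite ler_pdivlMr// ltr_pdivrMr// mulrDl mul1r.
Qed.

Lemma cix_dist (e : R) (x y : 'rV[R]_d) i : 0 < e -> cix e x = cix e y ->
  `|x ord0 i - y ord0 i| < e.
Proof.
move=> e0 /(cix_eqP _ _ e0)/(_ i) Hx.
have /(cix_eqP _ _ e0)/(_ i) Hy := erefl (cix e y).
by rewrite ltr_norml; lra.
Qed.

Lemma rV_ballP (x y : 'rV[R]_d) (e : R) : 0 < e ->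
  (forall i, `|x ord0 i - y ord0 i| < e) -> ball x e y.
Proof. by move=> e0 H; split=> // i j; rewrite ord1; apply: H. Qed.

(** An open set is the union of the dyadic cells it contains, because cells of level [j] shrink to
    points as [j] grows. As there are countably many cells, measurability reduces to coordinates. *)
Lemma open_cixE (U : set 'rV[R]_d) : open U ->
  U = \bigcup_j [set x | [set y | cix (2 ^- j) y = cix (2 ^- j) x] `<=` U].
Proof.
move=> oU; apply/seteqP; split => [x Ux|x [j _]]; last by apply.
have /nbhs_ballP[e /= e0 eU] : nbhs x U by apply: open_nbhs_nbhs.
have [j je] : exists j : nat, 2 ^- j < e :> R.
  have [j _ /(_ j (leqnn _)) /=] := near_infty_natSinv_expn_lt (PosNum e0).
  by rewrite div1r; exists j.
exists j => // y /= yx; apply: eU.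
have pe : 0 < 2 ^- j :> R by rewrite invr_gt0 exprn_gt0.
apply: rV_ballP => // i; apply: lt_trans je; exact: cix_dist pe _.
Qed.

End CellIndex.

Section MeasurableRow.
Variables (R : realType) (d : nat).

Lemma measurable_cix d0 (T : measurableType d0) (h : T -> 'rV[R]_d) (e : R) (Z : set 'rV[int]_d) :
  0 < e -> (forall i, measurable_fun setT (fun w => h w ord0 i)) ->
  measurable [set w | Z (cix e (h w))].
Proof.
move=> e0 mh.
rewrite (_ : [set w | _] = \bigcup_(z in Z) [set w | cix e (h w) = z]); last first.
  by apply/seteqP; split => [w Zw|w [z Zz /= ->]] //; exists (cix e (h w)).
rewrite bigcup_mkcond; apply: countable_bigcupT_measurable => [|z]; first exact: countableP.
case: ifPn => // _.
rewrite (_ : [set w | _] = \bigcap_(i in [set: 'I_d])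
   (fun w => h w ord0 i) @^-1` `[(z ord0 i)%:~R * e, (z ord0 i)%:~R * e + e[%classic).
  apply: fin_bigcap_measurable => // i _.
  by rewrite -[X in measurable X]setTI; apply: mh.
apply/seteqP; split => [w /= /(cix_eqP _ _ e0) H i _ /=|w H /=]; first by rewrite in_itv /= H.
by apply/(cix_eqP _ _ e0) => i; have := H i I; rewrite /= in_itv.
Qed.

(** The sigma-algebra is generated by the open sets and is not defined as a product; the
    decomposition of open sets into cells bridges the two. *)
Lemma measurable_rV d0 (T : measurableType d0) (h : T -> 'rV[R]_d) :
  (forall i, measurable_fun setT (fun w => h w ord0 i)) ->
  measurable_fun setT (h : T -> Rd R d).
Proof.
move=> mh; apply: (@measurability _ _ T (Rd R d) setT h [set A | open A]) => //.
move=> _ [U oU <-]; rewrite setTI (open_cixE oU) preimage_bigcup.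
apply: bigcup_measurable => j _.
exact: (measurable_cix [set z | [set y | cix (2 ^- j) y = z] `<=` U]).
Qed.

Lemma measurable_coord (i : 'I_d) :
  measurable_fun setT (fun v : Rd R d => v ord0 i : R).
Proof.
apply: (measurability (@RGenOpens.G R)); first exact: RGenOpens.measurableE.
move=> _ [_ [a [b ->]] <-]; rewrite setTI; apply: sub_sigma_algebra.
apply: open_comp => [x _|]; [exact: coord_continuous|exact: interval_open].
Qed.

Lemma continuous_measurable_rV (g : 'rV[R]_d -> R) : continuous g ->
  measurable_fun setT (g : Rd R d -> R).
Proof.
move=> cg; apply: (measurability (@RGenOpens.G R)); first exact: RGenOpens.measurableE.
move=> _ [_ [a [b ->]] <-]; rewrite setTI; apply: sub_sigma_algebra.
apply: open_comp => [x _|]; [exact: cg|exact: interval_open].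
Qed.

End MeasurableRow.

(** * The iterated integral as integration against a measure *)

Section Volume.
Variable (R : realType).

Lemma measurable_vcons d :
  measurable_fun setT (fun p : R * Rd R d => vcons p.1 p.2 : Rd R d.+1).
Proof.
apply: measurable_rV => i; rewrite /vcons.
case: (unliftP ord0 i) => [j ->|->].
  rewrite (_ : (fun w => _) = (fun v : Rd R d => v ord0 j : R) \o snd).
    by apply: measurableT_comp; [exact: measurable_coord|exact: measurable_snd].
  by apply/funext => w; rewrite mxE liftK.
rewrite (_ : (fun w => _) = fst); first exact: measurable_fst.
by apply/funext => w; rewrite mxE unlift_none.
Qed.

Definition vtail d (v : 'rV[R]_d.+1) : 'rV[R]_d := \row_j v ord0 (lift ord0 j).

Lemma vcons_eta d (v : 'rV[R]_d.+1) : vcons (v ord0 ord0) (vtail v) = v.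
Proof.
by apply/rowP => i; rewrite !mxE; case: (unliftP ord0 i) => [j ->|-> //]; rewrite mxE.
Qed.

Lemma vtailK d x (v : 'rV[R]_d) : vtail (vcons x v) = v.
Proof. by apply/rowP => i; rewrite !mxE liftK. Qed.

Lemma vcons0 d x (v : 'rV[R]_d) : vcons x v ord0 ord0 = x.
Proof. by rewrite mxE unlift_none. Qed.

Lemma measurable_vuncons d :
  measurable_fun setT (fun v : Rd R d.+1 => (v ord0 ord0 : R, vtail v : Rd R d)).
Proof.
apply/measurable_fun_pairP; split; first exact: measurable_coord.
apply: measurable_rV => i.
rewrite (_ : (fun w => _) = (fun v : Rd R d.+1 => v ord0 (lift ord0 i) : R)).
  exact: measurable_coord.
by apply/funext => w; rewrite /= mxE.
Qed.

(** [iint] and [vol] are defined by recursion and are not countably additive by construction.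
    Additivity and null sets are used through a sigma-finite measure tied to [iint] by this
    predicate. *)
Definition represents_iint d (mu : {sigma_finite_measure set (Rd R d) -> \bar R}) :=
  forall g : Rd R d -> \bar R, measurable_fun setT g -> (forall x, 0 <= g x)%E ->
    iint g = (\int[mu]_x g x)%E.

(** Turns a proof of sigma-finiteness into the bundled structure that Tonelli's theorem expects. *)
Lemma sigma_finite_measureP d0 (T : measurableType d0) (mu : {measure set T -> \bar R}) :
  sigma_finite setT mu ->
  exists nu : {sigma_finite_measure set T -> \bar R}, (nu : set T -> \bar R) = mu.
Proof.
move=> smu.
case: mu smu => mu [m1 m2] smu.
pose mix1 := isSFinite.Build _ _ _ mu (sfinite_measure_sigma_finite smu).
pose mix2 := isSigmaFinite.Build _ _ _ mu smu.
pose nu : {sigma_finite_measure set T -> \bar R} := HB.pack mu m1 m2 mix1 mix2.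
by exists nu.
Qed.

(** Induction on the dimension: the new measure is the image of Lebesgue measure times [mu] under
    [vcons], a bijection measurable in both directions, and Tonelli identifies its integral with the
    iterated one. In dimension 0 the integral is evaluation at the only point, hence a Dirac
    mass. *)
Lemma iint_represented d :
  exists mu : {sigma_finite_measure set (Rd R d) -> \bar R}, represents_iint mu.
Proof.
elim: d => [|d [mu Hmu]].
  exists (dirac (0 : Rd R 0)) => g mg g0 /=.
  by rewrite integral_dirac// diracT mul1e.
pose L : {sigma_finite_measure set (measurableTypeR R) -> \bar R} := @lebesgue_measure R.
pose phi := (fun p : measurableTypeR R * Rd R d => vcons p.1 p.2 : Rd R d.+1).
have mphi : measurable_fun setT phi by exact: measurable_vcons.
pose phi' := (fun v : Rd R d.+1 => (v ord0 ord0 : measurableTypeR R, vtail v : Rd R d)).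
have mphi' : measurable_fun setT phi' by exact: measurable_vuncons.
have phiK : cancel phi phi' by move=> [x y]; rewrite /phi/phi' vcons0 vtailK.
have phi'K : cancel phi' phi by move=> v; rewrite /phi/phi' vcons_eta.
pose nu : {measure set (Rd R d.+1) -> \bar R} :=
  measure_function_pushforward__canonical__measure_function_Measure (L \x mu)%E mphi.
have snu : sigma_finite setT nu.
  have /sigma_finiteP[F [FE Fnd Foo]] := sigma_finiteT L.
  have /sigma_finiteP[G [GE Gnd Goo]] := sigma_finiteT mu.
  exists (fun n => phi' @^-1` (F n `*` G n)) => [|n].
    rewrite -preimage_bigcup; apply/seteqP; split => // v _ /=.
    have : [set: R] (v ord0 ord0) by [].
    rewrite FE => -[n _ Fn].
    have : [set: Rd R d] (vtail v) by [].
    rewrite GE => -[m _ Gm]; exists (maxn n m) => //; split => /=.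
      by have /subsetPset := Fnd _ _ (leq_maxl n m); apply.
    by have /subsetPset := Gnd _ _ (leq_maxr n m); apply.
  have [mF Fn] := Foo n; have [mG Gn] := Goo n.
  split.
    by rewrite -[X in measurable X]setTI; apply: mphi' => //; exact: measurableX.
  have -> : nu (phi' @^-1` (F n `*` G n)) = (L \x mu)%E (F n `*` G n).
    congr ((L \x mu)%E _); apply/funext => x /=.
    by case: x => x y; rewrite /preimage /= /phi vcons0 vtailK.
  by rewrite product_measure1E// lte_mul_pinfty// ge0_fin_numE.
have [pnu pnuE] := sigma_finite_measureP snu.
exists pnu => g mg g0 /=.
rewrite pnuE.
rewrite ge0_integral_pushforward//= preimage_setT.
rewrite (fubini_tonelli1 (g \o phi)); last 2 first.
- exact: measurableT_comp.
- by move=> x; exact: g0.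
apply: eq_integral => x _; rewrite /fubini_F /=.
rewrite -Hmu//.
by apply: (@measurableT_comp _ _ _ _ _ _ g) => //; apply: measurableT_comp.
Qed.

End Volume.

Section VolumeFacts.
Variable (R : realType).

Lemma iint0 d : iint (fun _ : 'rV[R]_d => 0%E) = 0%E.
Proof.
elim: d => //= d IH; rewrite (eq_integral (cst 0%E)) ?integral0// => x _.
Qed.

Lemma eq_iint d (g h : 'rV[R]_d -> \bar R) : (forall x, g x = h x) -> iint g = iint h.
Proof. by move=> gh; congr iint; apply/funext. Qed.

Lemma vol_box d (a : 'rV[R]_d) (e : R) : 0 <= e ->
  vol [set x : 'rV[R]_d | forall i, a ord0 i <= x ord0 i < a ord0 i + e] = (e ^+ d)%:E.
Proof.
move=> e0; rewrite /vol; elim: d a => [|d IH] a /=.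
  by rewrite expr0 indicE mem_set// => -[].
pose I := `[a ord0 ord0, a ord0 ord0 + e[%classic.
rewrite (eq_integral (fun x : measurableTypeR R => (\1_I x)%:E * (e ^+ d)%:E)%E); last first.
  move=> x _; rewrite indicE; case: (boolP (x \in I)) => /= xI.
    rewrite mul1e -(IH (vtail a)); apply: eq_iint => y; congr (_%:E).
    rewrite !indicE; congr (nat_of_bool _)%:R; apply/asboolP/asboolP => H i /=.
      by have := H (lift ord0 i); rewrite !mxE liftK.
    case: (unliftP ord0 i) => [j ->|->].
      by have := H j; rewrite !mxE liftK.
    by rewrite vcons0; move: xI; rewrite inE /I /= in_itv.
  rewrite mul0e -[RHS](iint0 d); apply: eq_iint => y; congr (_%:E).
  rewrite indicE memNset//= => /(_ ord0); rewrite vcons0 => H.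
  by move/negP: xI; apply; rewrite inE /I /= in_itv.
rewrite ge0_integralZr//=; last 2 first.
- apply/measurable_EFinP; apply: measurable_indic; exact: measurable_itv.
- by rewrite lee_fin exprn_ge0.
rewrite integral_indic//=; last exact: measurable_itv.
rewrite setIT /I lebesgue_measure_itv /=.
rewrite lte_fin ltrDl -EFinD addrAC subrr add0r; case: ltP => [_|e_le0].
  by rewrite -EFinM exprS.
by rewrite mul0e (_ : e = 0) ?exprS ?mul0r//; lra.
Qed.

Lemma vol_cell d (z : 'rV[int]_d) (e : R) : 0 < e ->
  vol [set x : 'rV[R]_d | cix e x = z] = (e ^+ d)%:E.
Proof.
move=> e0; rewrite -(vol_box (\row_i ((z ord0 i)%:~R * e)) (ltW e0)).
congr vol; apply/seteqP; split => x /=.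
  by move/(cix_eqP _ _ e0) => H i; rewrite mxE.
by move=> H; apply/(cix_eqP _ _ e0) => i; have := H i; rewrite mxE.
Qed.

Variable d : nat.
Variable mu : {sigma_finite_measure set (Rd R d) -> \bar R}.
Hypothesis Hmu : represents_iint mu.

Lemma vol_measure (A : set 'rV[R]_d) : borelRd A -> vol A = mu A.
Proof.
move=> mA; rewrite /vol (Hmu (g := fun x => (\1_A x)%:E)).
- by rewrite integral_indic// setIT.
- by apply/measurable_EFinP; exact: measurable_indic.
- by move=> x; rewrite lee_fin.
Qed.

Lemma measurable_cell (e : R) (Z : set 'rV[int]_d) : 0 < e ->
  measurable ([set x | Z (cix e x)] : set (Rd R d)).
Proof. by move=> e0; apply: measurable_cix => // i; exact: measurable_coord. Qed.

Lemma measure_cell (z : 'rV[int]_d) (e : R) : 0 < e ->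
  mu [set x | cix e x = z] = (e ^+ d)%:E.
Proof.
move=> e0; rewrite -(vol_cell z e0) vol_measure//.
exact: (measurable_cell [set z]).
Qed.

End VolumeFacts.

(** The values of [c] are numbered by [pickle], so that additivity over [nat] sums over the fibres;
    numbers that code no value give empty sets. *)
Lemma measure_fibers d0 (T : measurableType d0) (R : realType)
    (m : {measure set T -> \bar R}) (K : countType) (c : T -> K) (S : set T) :
  measurable S -> (forall k, measurable [set x | c x = k]) ->
  m S = (\sum_(0 <= n <oo) m (S `&` [set x | pickle (c x) = n]))%E.
Proof.
move=> mS mc.
have mF n : measurable (S `&` [set x | pickle (c x) = n]).
  apply: measurableI => //.
  case E : (@pickle_inv K n) => [k|].
    rewrite (_ : [set x | _] = [set x | c x = k])//.
    apply/seteqP; split => x /=.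
      by move=> H; move: E; rewrite -H pickleK_inv => -[].
    by move=> ->; have := @pickle_invK K n; rewrite E.
  rewrite (_ : [set x | _] = set0); first exact: measurable0.
  by rewrite -subset0 => x /= H; move: E; rewrite -H pickleK_inv.
have tF : trivIset setT (fun n => S `&` [set x | pickle (c x) = n]).
  by move=> i j _ _ [x [[_ /= <-] [_ /= <-]]].
have UF : \bigcup_n (S `&` [set x | pickle (c x) = n]) = S.
  by apply/seteqP; split => [x [n _ []]//|x Sx]; exists (pickle (c x)).
rewrite -[in LHS]UF.
by apply/esym/cvg_lim => //; apply: measure_semi_sigma_additive => //; rewrite UF.
Qed.

(** * Approximation of Borel sets by unions of dyadic cells *)

Section Levels.
Variables (R : realType) (d : nat).

(** Unions of dyadic cells of side [2 ^- j], expressed as saturation for the relation of lying in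
    the same cell. *)
Definition level (j : nat) (S : set 'rV[R]_d) :=
  forall x y, cix (2 ^- j) x = cix (2 ^- j) y -> S x -> S y.

Lemma level_measurable j S : level j S -> measurable (S : set (Rd R d)).
Proof.
move=> lS.
rewrite (_ : S = [set x | [set z | exists2 y, S y & cix (2 ^- j) y = z] (cix (2 ^- j) x)]).
  by apply: measurable_cell; rewrite invr_gt0 exprn_gt0.
apply/seteqP; split => x /=; first by exists x.
by case=> y Sy yx; exact: lS yx Sy.
Qed.

Lemma levelC j S : level j S -> level j (~` S).
Proof. by move=> lS x y xy /= nSx Sy; apply: nSx; apply: lS Sy. Qed.

Lemma levelU j S T : level j S -> level j T -> level j (S `|` T).
Proof. by move=> lS lT x y xy [?|?]; [left; apply: lS xy _|right; apply: lT xy _]. Qed.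

Lemma levelI j S T : level j S -> level j T -> level j (S `&` T).
Proof. by move=> lS lT x y xy [? ?]; split; [apply: lS xy _|apply: lT xy _]. Qed.

Lemma levelS j S : level j S -> level j.+1 S.
Proof.
move=> lS x y xy; apply: lS; apply/rowP => i; rewrite !mxE.
have {xy} : Num.floor (x ord0 i / 2 ^- j.+1) = Num.floor (y ord0 i / 2 ^- j.+1).
  by move/rowP : xy => /(_ i); rewrite !mxE.
(* The fine floor determines the coarse one; stating this through integer lower bounds lets the two
   coarse indices be compared by antisymmetry. *)
have key (t : R) (k : int) : (k <= Num.floor (t / 2 ^- j)) = (2 * k <= Num.floor (t / 2 ^- j.+1)).
  rewrite !floor_ge_int !invrK exprS intrM [X in _ = (_ <= X)](_ : _ = 2 * (t * 2 ^+ j)).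
    by rewrite ler_pM2l.
  by rewrite mulrCA.
move=> E; apply/eqP; rewrite eq_le.
by rewrite key -E -key lexx key E -key lexx.
Qed.

Lemma levelW j k S : (j <= k)%N -> level j S -> level k S.
Proof.
move=> /subnK <-; elim: (k - j)%N => // n IH lS; rewrite addSn.
by apply: levelS; exact: IH.
Qed.

Lemma level_box (M : nat) : level 0 [set x | forall i, - M%:R <= x ord0 i < M%:R].
Proof.
move=> x y xy H i; have := H i.
have {xy} : Num.floor (x ord0 i) = Num.floor (y ord0 i).
  by move/rowP : xy => /(_ i); rewrite !mxE expr0 invr1 !divr1.
have E (t : R) : (- M%:R <= t < M%:R) = (- M%:Z <= Num.floor t < M%:Z).
  by rewrite floor_ge_int floor_lt_int intrN.
by rewrite !E => ->.
Qed.

Definition approximable (m : set (Rd R d) -> \bar R) (A : set (Rd R d)) :=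
  measurable A /\ forall e : R, 0 < e -> exists j S,
    level j S /\ (m ((A `\` S) `|` (S `\` A)) < e%:E)%E.

Section Approx.
Variable m : {measure set (Rd R d) -> \bar R}.
Hypothesis mT : (m setT < +oo)%E.

Let fin A : measurable A -> m A \is a fin_num.
Proof.
move=> mA; rewrite ge0_fin_numE//; apply: le_lt_trans mT.
by apply: le_measure; rewrite ?inE.
Qed.

Lemma approximableU A B : approximable m A -> approximable m B -> approximable m (A `|` B).
Proof.
move=> [mA HA] [mB HB]; split; first exact: measurableU.
move=> e e0; have e20 : 0 < e / 2 by rewrite divr_gt0.
have [j [S [lS SA]]] := HA _ e20; have [k [T [lT TB]]] := HB _ e20.
exists (maxn j k), (S `|` T); split.
  by apply: levelU; [apply: levelW lS|apply: levelW lT]; rewrite ?leq_maxl ?leq_maxr.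
have mS := level_measurable lS; have mT' := level_measurable lT.
apply: (@le_lt_trans _ _ (m ((A `\` S `|` S `\` A) `|` (B `\` T `|` T `\` B)))).
  apply: le_measure; rewrite ?inE.
  - by apply: measurableU; apply: measurableD; apply: measurableU.
  - by apply: measurableU; apply: measurableU; apply: measurableD.
  - by move=> x /=; tauto.
apply: (le_lt_trans (measureU2 m _ _)).
- by apply: measurableU; apply: measurableD.
- by apply: measurableU; apply: measurableD.
by rewrite [e]splitr EFinD lteD.
Qed.

(** By continuity from below and finiteness of [m], a finite partial union already carries the
    measure up to [e / 2]; that union is then approximated within [e / 2]. *)
Lemma approximable_bigcup (F : nat -> set (Rd R d)) :
  (forall n, approximable m (F n)) -> approximable m (\bigcup_n F n).
Proof.
move=> HF; have mF n : measurable (F n) by have [] := HF n.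
split; first exact: bigcup_measurable.
move=> e e0; have e20 : 0 < e / 2 by rewrite divr_gt0.
pose B n := \big[setU/set0]_(i < n.+1) F i.
have aB n : approximable m (B n).
  elim: n => [|n IH]; first by rewrite /B big_ord_recr big_ord0 /= set0U.
  by rewrite /B big_ord_recr; apply: approximableU.
have mB n : measurable (B n) by have [] := aB n.
have U_B : \bigcup_n F n = \bigcup_n B n.
  apply/seteqP; split => x [n _ Fx]; first by exists n => //; rewrite /B big_ord_recr; right.
  by move: Fx; rewrite /B -bigcup_mkord => -[k _ Fk]; exists k.
have cv : (m \o B) n @[n --> \oo] --> m (\bigcup_n B n).
  apply: nondecreasing_cvg_mu => //; first exact: bigcup_measurable.
  by move=> a b ab; apply/subsetPset; apply: subset_bigsetU.
have [n Hn] : exists n, (m (\bigcup_n B n) - (e / 2)%:E < m (B n))%E.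
  have fB : m (\bigcup_n B n) \is a fin_num by apply: fin; exact: bigcup_measurable.
  have lt1 : (m (\bigcup_n B n) - (e / 2)%:E < m (\bigcup_n B n))%E.
    by rewrite lteBlDr// lteDl// lte_fin.
  apply: contrapT => /forallNP H.
  have : (limn (m \o B) <= m (\bigcup_n B n) - (e / 2)%:E)%E.
    apply: lime_le; first exact: cvgP cv.
    by apply: nearW => n; rewrite leNgt; apply/negP; exact: H.
  by rewrite (cvg_lim _ cv)// leNgt lt1.
have [_ /(_ _ e20)[j [S [lS SB]]]] := aB n.
exists j, S; split => //.
have mS := level_measurable lS.
apply: (@le_lt_trans _ _ (m ((\bigcup_n B n `\` B n) `|` (B n `\` S `|` S `\` B n)))).
  rewrite U_B; apply: le_measure; rewrite ?inE.
  - by apply: measurableU; apply: measurableD => //; exact: bigcup_measurable.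
  - by apply: measurableU; [|apply: measurableU]; apply: measurableD => //; exact: bigcup_measurable.
  - move=> x /= [[Ux nS]|[Sx nU]].
      by have [Bx|nBx] := pselect (B n x); [right; left|left].
    by right; right; split => // Bx; apply: nU; exists n.
apply: (le_lt_trans (measureU2 m _ _)).
- by apply: measurableD => //; exact: bigcup_measurable.
- by apply: measurableU; apply: measurableD.
rewrite [e]splitr EFinD lteD//.
rewrite measureD//=; last 2 first.
- exact: bigcup_measurable.
- by rewrite -ge0_fin_numE//; apply: fin; exact: bigcup_measurable.
rewrite setIidr; last by move=> x Bx; exists n.
by rewrite lteBlDr ?fin// addeC -lteBlDr.
Qed.

(** Approximable sets form a sigma-algebra, and an open set is a countable union of sets each of
    which has a level. *)
Lemma borel_approximable (A : set (Rd R d)) : measurable A -> approximable m A.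
Proof.
apply: smallest_sub => [|U oU].
  split.
  - split; first exact: measurable0.
    move=> e e0; exists 0%N, set0; split; first by [].
    by rewrite setD0 setU0 measure0 lte_fin.
  - move=> B [mB HB]; rewrite setTD; split; first exact: measurableC.
    move=> e e0; have [j [S [lS SB]]] := HB _ e0.
    exists j, (~` S); split; first exact: levelC.
    rewrite (_ : _ `|` _ = (B `\` S) `|` (S `\` B))//.
    by apply/seteqP; split => x /=; rewrite ?notK; have := pselect (S x); have := pselect (B x); tauto.
  - exact: approximable_bigcup.
rewrite (open_cixE oU); apply: approximable_bigcup => j.
have lU : level j [set x | [set y | cix (2 ^- j) y = cix (2 ^- j) x] `<=` U].
  by move=> x y xy /=; rewrite xy.
split; first exact: level_measurable lU.
move=> e e0; exists j; eexists; split; first exact: lU.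
by rewrite setDv setU0 measure0 lte_fin.
Qed.

End Approx.
End Levels.

Lemma measure_bigcup_null d0 (T : measurableType d0) (R : realType)
    (m : {measure set T -> \bar R}) (F : nat -> set T) :
  (forall n, measurable (F n)) -> (forall n, ~ (0 < m (F n))%E) ->
  m (\bigcup_n F n) = 0%E.
Proof.
move=> mF H; apply/eqP; rewrite eq_le measure_ge0 andbT.
have := @measure_sigma_subadditive _ _ _ m (\bigcup_n F n) F mF (bigcup_measurable (fun n _ => mF n)) (@subset_refl _ _).
rewrite eseries0// => n _ _; apply/eqP.
by rewrite eq_le measure_ge0 andbT leNgt; apply/negP.
Qed.

(** * Nearly full cubes and the essential supremum of the density *)

Section Density.
Variables (R : realType) (d : nat).
Variable mu : {sigma_finite_measure set (Rd R d) -> \bar R}.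
Hypothesis Hmu : represents_iint mu.

Definition ibox (M : nat) : set (Rd R d) :=
  [set x | forall i, - M%:R <= x ord0 i < M%:R].

Lemma integral_cst_indic (c : R) (A : set (Rd R d)) : measurable A -> 0 <= c ->
  (\int[mu]_x (c%:E * (\1_A x)%:E) = c%:E * mu A)%E.
Proof.
move=> mA c0; rewrite ge0_integralZl//; last first.
  by apply/measurable_EFinP; exact: measurable_indic.
by rewrite integral_indic// setIT.
Qed.

Lemma measurable_cst_indic (c : R) (A : set (Rd R d)) : measurable A ->
  measurable_fun setT (fun x : Rd R d => (c%:E * (\1_A x)%:E)%E).
Proof.
by move=> mA; apply: measurable_funeM; apply/measurable_EFinP; exact: measurable_indic.
Qed.

Lemma measure_box_lty (M : nat) :
  (mu (ibox M) < +oo)%E.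
Proof.
rewrite -(vol_measure Hmu); last exact: level_measurable (@level_box _ _ M).
have := vol_box (\row_(i < d) - M%:R) (_ : 0 <= M%:R + M%:R :> R).
rewrite (_ : [set x | _] = ibox M).
  by move=> ->; rewrite ?ltry// addr_ge0.
by apply/seteqP; split => x /= H i; have := H i; rewrite mxE addrA addNr add0r.
Qed.

(** Sums the hypothesis over the cells that make up [S], which meets a cell only by containing
    it. *)
Lemma level_density (A S : set (Rd R d)) (e : R) j : measurable A ->
  0 <= e -> level j S ->
  (forall z, (e%:E * mu [set x | cix (2 ^- j) x = z] <= mu ([set x | cix (2 ^- j) x = z] `\` A))%E) ->
  (e%:E * mu S <= mu (S `\` A))%E.
Proof.
move=> mA e0 lS H.
have pe : 0 < 2 ^- j :> R by rewrite invr_gt0 exprn_gt0.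
have mS := level_measurable lS.
have mc z : measurable ([set x | cix (2 ^- j) x = z] : set (Rd R d)).
  exact: (measurable_cell [set z]).
rewrite (measure_fibers mu mS mc) (measure_fibers mu (measurableD mS mA) mc).
rewrite -nneseriesZl; last by [].
apply: lee_nneseries => [n _ _|n _]; first by rewrite mule_ge0 ?lee_fin.
have [[x [Sx xn]]|none] := pselect (exists x, S x /\ pickle (cix (2 ^- j) x) = n).
  have E : S `&` [set y | pickle (cix (2 ^- j) y) = n] = [set y | cix (2 ^- j) y = cix (2 ^- j) x].
    apply/seteqP; split => y /=.
      by case=> _; rewrite -xn => /(pcan_inj pickleK).
    by move=> yx; split; [exact: lS (esym yx) Sx|rewrite yx].
  have E2 : (S `\` A) `&` [set y | pickle (cix (2 ^- j) y) = n] =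
      [set y | cix (2 ^- j) y = cix (2 ^- j) x] `\` A.
    by rewrite -E; apply/seteqP; split => y /=; tauto.
  by rewrite E E2; exact: H.
rewrite (_ : S `&` _ = set0) ?measure0 ?mule0//.
by rewrite -subset0 => x /= Sx; apply: none; exists x.
Qed.

(** Takes the place of the Lebesgue density theorem. If [A] missed a proportion [e] of every dyadic
    cell of a level, it would miss that proportion of every union of such cells, against the
    approximation of a bounded part of [A] by such a union. *)
Lemma dense_cube (A : set (Rd R d)) (e : R) : measurable A -> 0 < e -> (0 < mu A)%E ->
  exists j z, (mu ([set x | cix (2 ^- j) x = z] `\` A) < e%:E * mu [set x | cix (2 ^- j) x = z])%E.
Proof.
move=> mA e0 A0.
pose B := ibox.
have lB M : level 0 (B M) := @level_box _ _ M.
have mB M : measurable (B M) := level_measurable (lB M).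
have [M AM] : exists M, (0 < mu (A `&` B M))%E.
  apply: contrapT => /forallNP H.
  have : mu (\bigcup_M (A `&` B M)) = 0%E.
    by apply: measure_bigcup_null => // n; exact: measurableI.
  rewrite -setI_bigcupr (_ : \bigcup_i B i = setT) ?setIT; first by move=> A00; rewrite A00 ltxx in A0.
  apply/seteqP; split => // x _.
  pose c := (\sum_i Num.bound `|x ord0 i|)%N.
  exists c => // i.
  have : `|x ord0 i| < c%:R.
    apply: (lt_le_trans (archi_boundP (normr_ge0 _))).
    by rewrite ler_nat /c (bigD1 i)//= leq_addr.
  by rewrite ltr_norml => /andP[/ltW -> ->].
have Bf : (mu (B M) < +oo)%E := measure_box_lty M.
pose m := mrestr mu (mB M).
have mT : (m setT < +oo)%E by rewrite /m /mrestr setTI.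
have [a aE] : exists a : R, mu (A `&` B M) = a%:E.
  exists (fine (mu (A `&` B M))); rewrite fineK// ge0_fin_numE//.
  by apply: le_lt_trans Bf; apply: le_measure; rewrite ?inE//; exact: measurableI.
have a0 : 0 < a by rewrite -lte_fin -aE.
(* With [s] the measure of the approximating set inside the box, [e * s < h] and [a <= s + h] will
   both follow; this is the largest [h] for which they are incompatible. *)
pose h := e * a / (1 + e).
have h0 : 0 < h by rewrite divr_gt0 ?mulr_gt0 ?addr_gt0.
have [_ /(_ _ h0)[j [S [lS SA]]]] := borel_approximable mT mA.
exists j; apply: contrapT => /forallNP H.
have lSB : level j (S `&` B M) by apply: levelI => //; exact: levelW (leq0n j) (lB M).
have mS := level_measurable lS.
have := level_density mA (ltW e0) lSB (fun z => _).
have -> : (forall z, (e%:E * mu [set x | cix (2 ^- j) x = z] <= mu ([set x | cix (2 ^- j) x = z] `\` A))%E) = True.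
  by apply/propT => z; rewrite leNgt; apply/negP; exact: H.
move=> /(_ I) le1.
have le2 : (mu ((S `&` B M) `\` A) < h%:E)%E.
  apply: le_lt_trans SA; rewrite /m /mrestr.
  apply: le_measure; rewrite ?inE.
  - by apply: measurableD => //; exact: measurableI.
  - by apply: measurableI => //; apply: measurableU; exact: measurableD.
  - by move=> x /=; tauto.
have le3 : (mu (A `&` B M) <= mu (S `&` B M) + h%:E)%E.
  apply: (@le_trans _ _ (mu ((S `&` B M) `|` ((A `\` S) `&` B M)))).
    apply: le_measure; rewrite ?inE.
    - exact: measurableI.
    - by apply: measurableU; apply: measurableI => //; exact: measurableD.
    - by move=> x /=; have := pselect (S x); tauto.
  apply: (le_trans (measureU2 mu _ _)).
  - exact: measurableI.
  - by apply: measurableI => //; exact: measurableD.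
  rewrite leeD2l//; apply: ltW; apply: le_lt_trans SA; rewrite /m /mrestr.
  apply: le_measure; rewrite ?inE.
  - by apply: measurableI => //; exact: measurableD.
  - by apply: measurableI => //; apply: measurableU; exact: measurableD.
  - by move=> x /=; tauto.
have [s sE] : exists s : R, mu (S `&` B M) = s%:E.
  exists (fine (mu (S `&` B M))); rewrite fineK// ge0_fin_numE//.
  by apply: le_lt_trans Bf; apply: le_measure; rewrite ?inE//; exact: measurableI.
move: le1 le3; rewrite aE sE -EFinD -EFinM lee_fin => /le_lt_trans/(_ le2).
rewrite lte_fin => le1 le3.
have e1 : 0 < 1 + e by rewrite addr_gt0.
have : a * (1 + e) <= s * (1 + e) + e * a.
  by rewrite -(divfK (lt0r_neq0 e1) (e * a)) -mulrDl ler_pM2r.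
have : e * s * (1 + e) < e * a by rewrite -ltr_pdivlMr.
rewrite -mulrA ltr_pM2l//.
lra.
Qed.

Variables (f : 'rV[R]_d -> R) (M : R).
Hypothesis f_ge0 : forall x, 0 <= f x.
Hypothesis f_leM : forall x, f x <= M.
Hypothesis f_meas : forall B : set R, measurable B -> borelRd (f @^-1` B).

Let mf : measurable_fun setT (f : Rd R d -> R).
Proof. by move=> _ B mB; rewrite setTI; exact: f_meas. Qed.

Let msup s : measurable ([set x | s < f x] : set (Rd R d)).
Proof.
have := f_meas (measurable_itv `]s, +oo[); congr (borelRd _).
by apply/seteqP; split => x /=; rewrite in_itv /= andbT.
Qed.

Let mint A : measurable (A : set (Rd R d)) ->
  measurable_fun setT (fun x : Rd R d => (\1_A x * f x)%:E).
Proof.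
by move=> mA; apply/measurable_EFinP; apply: measurable_funM => //; exact: measurable_indic.
Qed.

Lemma M_ge0 : 0 <= M. Proof. exact: le_trans (f_ge0 0) (f_leM 0). Qed.

Let F s : set (Rd R d) := [set x | s < f x].

Let vol_F s : vol [set x | s < f x] = mu (F s).
Proof. by rewrite (vol_measure Hmu)//; exact: msup. Qed.

Lemma level_sup_bounded : has_ubound [set s : R | (0 < vol [set x | (s < f x)%R])%E].
Proof.
exists M => s' /=; rewrite vol_F => H.
have [x /= /ltW xs'] : F s' !=set0.
  by apply/set0P/eqP => E; move: H; rewrite E measure0 ltxx.
exact: le_trans (f_leM x).
Qed.

Lemma ess_sigma_null s : ess_sigma f < s -> mu (F s) = 0%E.
Proof.
move=> ss; apply/eqP; rewrite eq_le measure_ge0 andbT leNgt; apply/negP => Hs.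
move: ss; rewrite ltNge => /negP; apply; rewrite /ess_sigma.
apply: ub_le_sup; first exact: level_sup_bounded.
by rewrite /= vol_F.
Qed.

(** Above the essential supremum the set [F s] is null, so [f] is dominated by [s] plus [M] times
    the indicator of a null set. *)
Lemma density_le s A : 0 < s -> ess_sigma f < s -> borelRd A ->
  (iint (fun x => (\1_A x * f x)%:E) <= s%:E * mu A)%E.
Proof.
move=> s0 ss mA.
rewrite (Hmu (mint mA)); last by move=> x; rewrite lee_fin mulr_ge0.
apply: (@le_trans _ _ (\int[mu]_x (s%:E * (\1_A x)%:E + M%:E * (\1_(F s) x)%:E))%E).
  apply: ge0_le_integral.
  - exact: measurableT.
  - by move=> x _; rewrite lee_fin mulr_ge0.
  - exact: mint.
  - by apply: emeasurable_funD; apply: measurable_cst_indic => //; exact: msup.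
  move=> x _; rewrite -!EFinM -EFinD lee_fin !indicE.
  have [xA|xA] := boolP (x \in A); last by rewrite mul0r mulr0 add0r mulr_ge0 ?M_ge0.
  rewrite mul1r mulr1; case: (ltP s (f x)) => sf.
    by rewrite mem_set// mulr1 (le_trans (f_leM x))// lerDr ltW.
  by rewrite memNset ?mulr0 ?addr0//=; apply/negP; rewrite -leNgt.
rewrite ge0_integralD//; last 4 first.
- by move=> x _; rewrite -EFinM lee_fin mulr_ge0// ltW.
- exact: measurable_cst_indic.
- by move=> x _; rewrite -EFinM lee_fin mulr_ge0// M_ge0.
- by apply: measurable_cst_indic; exact: msup.
rewrite (integral_cst_indic _ (ltW s0))// (integral_cst_indic (msup s) M_ge0).
by rewrite (ess_sigma_null ss) mule0 adde0.
Qed.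

Lemma density_ge s A : 0 <= s -> borelRd A ->
  (s%:E * mu (A `&` F s) <= iint (fun x => (\1_A x * f x)%:E))%E.
Proof.
move=> s0 mA.
rewrite (Hmu (mint mA)); last by move=> x; rewrite lee_fin mulr_ge0.
have mAs : measurable (A `&` F s : set (Rd R d)) by apply: measurableI => //; exact: msup.
rewrite -integral_cst_indic//.
apply: ge0_le_integral.
- exact: measurableT.
- by move=> x _; rewrite -EFinM lee_fin mulr_ge0.
- exact: measurable_cst_indic.
- exact: mint.
move=> x _; rewrite -EFinM lee_fin !indicE in_setI.
case: (x \in A) => /=; last by rewrite mulr0 mul0r.
rewrite mul1r; case: (ltP s (f x)) => sf; first by rewrite mem_set// mulr1 ltW.
by rewrite memNset ?mulr0//=; apply/negP; rewrite -leNgt.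
Qed.

Hypothesis f_int : (0 < iint (fun x => (f x)%:E))%E.

Lemma positive_part_pos : (0 < mu (F 0%R))%E.
Proof.
rewrite lt_neqAle measure_ge0 andbT eq_sym; apply/eqP => H0.
move: f_int; rewrite (Hmu (g := fun x => (f x)%:E)); [|by apply/measurable_EFinP|by move=> x; rewrite lee_fin].
suff -> : (\int[mu]_x (f x)%:E = 0)%E by rewrite ltxx.
apply/eqP; rewrite eq_le integral_ge0 ?andbT; last by move=> x _; rewrite lee_fin.
apply: (@le_trans _ _ (\int[mu]_x (M%:E * (\1_(F 0%R) x)%:E))%E).
  apply: ge0_le_integral.
  - exact: measurableT.
  - by move=> x _; rewrite lee_fin.
  - by apply/measurable_EFinP.
  - by apply: measurable_cst_indic; exact: msup.
  move=> x _; rewrite -EFinM lee_fin indicE; case: (ltP 0 (f x)) => sf.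
    by rewrite mem_set// mulr1.
  by rewrite memNset ?mulr0//=; apply/negP; rewrite -leNgt.
by rewrite integral_cst_indic ?H0 ?mule0 ?M_ge0//; exact: msup.
Qed.

Lemma ess_sigma_pos s : s < ess_sigma f -> (0 < mu (F s))%E.
Proof.
rewrite -subr_gt0 => /(@sup_adherent _ [set s : R | (0 < vol [set x | (s < f x)%R])%E])[].
  by split; [exists 0; rewrite /= vol_F; exact: positive_part_pos|exact: level_sup_bounded].
move=> s' /=; rewrite vol_F opprB addrCA subrr addr0 => Fs' ss'.
apply: (lt_le_trans Fs'); apply: le_measure; rewrite ?inE; try exact: msup.
by move=> x /=; exact: lt_trans.
Qed.

Lemma ess_sigma_gt0 : 0 < ess_sigma f.
Proof.
have Ipos := positive_part_pos.
have [n Hn] : exists n : nat, (0 < mu (F (n.+1%:R^-1)%R))%E.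
  apply: contrapT => /forallNP H.
  have : mu (\bigcup_n (F (n.+1%:R^-1)%R)) = 0%E.
    by apply: measure_bigcup_null => // n; exact: msup.
  rewrite (_ : \bigcup_n _ = F 0) => [H0|]; first by rewrite H0 ltxx in Ipos.
  apply/seteqP; split => x /=; first by case=> n _ /=; apply: lt_trans; rewrite invr_gt0.
  move=> fx; have [n _ /(_ n (leqnn _)) /= nf] := near_infty_natSinv_lt (PosNum fx).
  by exists n.
apply: (@lt_le_trans _ _ n.+1%:R^-1); first by rewrite invr_gt0.
rewrite leNgt; apply/negP => /ess_sigma_null H.
by rewrite H ltxx in Hn.
Qed.

End Density.

(** * Discrete Brunn-Minkowski inequality *)

Section DiscreteBrunnMinkowski.
Local Open Scope nat_scope.

Lemma seq_maxP (A : seq int) : A != [::] ->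
  exists2 a, a \in A & forall x, x \in A -> (x <= a)%R.
Proof.
elim: A => // a [|b A] IH _; first by exists a; rewrite ?mem_seq1// => x; rewrite mem_seq1 => /eqP ->.
have [//|m mA Hm] := IH.
exists (Num.max a m).
  by case: leP => _; rewrite in_cons ?eqxx// mA orbT.
move=> x; rewrite in_cons => /orP[/eqP ->|/Hm xm]; rewrite le_max ?lexx// xm orbT//.
Qed.

(** [C] contains [A + min B] and [max A + B + 1]; the first lies at or below [max A + min B] and the
    second strictly above it, so they are disjoint. *)
Lemma size_sumset01 (A B C : seq int) : uniq A -> uniq B -> A != [::] -> B != [::] ->
  (forall a b, a \in A -> b \in B -> ((a + b)%R \in C) /\ ((a + b + 1)%R \in C)) ->
  size A + size B <= size C.
Proof.
move=> uA uB A0 B0 H.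
have [a aA Ha] := seq_maxP A0.
have [|b' b'B Hb'] := @seq_maxP (map -%R B); first by case: B {uB H} B0.
have [b bB b'E] := mapP b'B.
have Hb x : x \in B -> (b <= x)%R.
  by move=> xB; rewrite -lerN2 -b'E Hb'// map_f.
rewrite -(size_map (fun x => x + b)%R A) -(size_map (fun y => a + y + 1)%R B) -size_cat.
apply: uniq_leq_size.
  rewrite cat_uniq !map_inj_uniq ?uA ?uB /= ?andbT.
  - apply/hasPn => _ /mapP[y yB ->]; apply/negP => /mapP[x xA].
    by have := Ha _ xA; have := Hb _ yB; lia.
  - by move=> x y /=; lia.
  - by move=> x y /=; lia.
move=> z; rewrite mem_cat => /orP[/mapP[x xA ->]|/mapP[y yB ->]].
  by have [] := H _ _ xA bB.
by have [] := H _ _ aA yB.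
Qed.

Lemma sum_ltn (T m : nat) : \sum_(t < T) (t < m) = minn m T.
Proof. by elim: T => [|T IH]; rewrite ?big_ord0 ?minn0// big_ord_recr /= IH; lia. Qed.

(** The thresholds that are met form an initial segment, so their number is an integer square root
    of [X / K], cut off at [T]. *)
Lemma sum_threshold (K T X : nat) :
  K * (\sum_(t < T) (K * t.+1 ^ 2 <= X)) ^ 2 <= X.
Proof.
elim: T => [|T IH]; first by rewrite big_ord0 muln0.
rewrite big_ord_recr /=; case: (leqP (K * T.+1 ^ 2) X) => [H|]; last by rewrite addn0.
rewrite (eq_bigr (fun=> 1)); last first.
  move=> t _; apply/eqP; rewrite eqb1; apply: leq_trans H.
  by rewrite leq_mul2l leq_exp2r// ltnS (ltnW (ltn_ord t)) orbT.
by rewrite sum_nat_const card_ord muln1 addn1.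
Qed.

(** Summation of [sqrt K * u <= sqrt T * v], written with squares to stay in [nat]; products of two
    terms are compared after squaring once more. *)
Lemma sqr_sum_le (I : Type) (s : seq I) (K T : nat) (u v : I -> nat) :
  (forall z, K * u z ^ 2 <= T * v z ^ 2) ->
  K * (\sum_(z <- s) u z) ^ 2 <= T * (\sum_(z <- s) v z) ^ 2.
Proof.
move=> H; rewrite -!mulnn !big_distrlr /= !big_distrr /=.
apply: leq_sum => z _; rewrite !big_distrr /=; apply: leq_sum => w _.
rewrite -(@leq_exp2r _ _ 2)//.
have -> : (K * (u z * u w)) ^ 2 = (K * u z ^ 2) * (K * u w ^ 2) by rewrite !expnMn; ring.
have -> : (T * (v z * v w)) ^ 2 = (T * v z ^ 2) * (T * v w ^ 2) by rewrite !expnMn; ring.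
exact: leq_mul.
Qed.

Lemma size_filter_sum (I : Type) (s : seq I) (p : pred I) :
  size (seq.filter p s) = \sum_(x <- s) p x.
Proof. by rewrite size_filter -sum1_count big_mkcond. Qed.

Lemma sum_level (I : eqType) (s : seq I) (a : I -> nat) (T : nat) :
  (forall x, x \in s -> a x <= T) ->
  \sum_(t < T) size [seq x <- s | t < a x] = \sum_(x <- s) a x.
Proof.
move=> H; rewrite (eq_bigr (fun t : 'I_T => \sum_(x <- s) (t < a x))); last first.
  by move=> t _; exact: size_filter_sum.
rewrite exchange_big /=; apply: eq_big_seq => x xs.
by rewrite sum_ltn (minn_idPl (H _ xs)).
Qed.

Lemma bigmax_seq_attained (I : eqType) (s : seq I) (F : I -> nat) :
  0 < \max_(x <- s) F x -> exists2 x, x \in s & F x = \max_(x <- s) F x.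
Proof.
elim: s => [|y s IH]; first by rewrite big_nil.
rewrite big_cons; case: (leqP (F y) (\max_(j <- s) F j)) => [le1 /IH[x xs Fx]|lt1 _].
  by exists x; rewrite ?in_cons ?xs ?orbT.
by exists y; rewrite ?in_cons ?eqxx.
Qed.

(* Layer cake: after scaling by the maxima both level sets are nonempty for
   every threshold, so the one-dimensional sumset bound applies to each level. *)
Lemma discrete_prekopa_leindler (IA IB IC : seq int) (a b c : int -> nat) (K : nat) :
  uniq IA -> uniq IB -> (forall z, z \notin IC -> c z = 0) ->
  (forall x y, x \in IA -> y \in IB ->
     K * (a x * b y) <= c (x + y)%R ^ 2 /\ K * (a x * b y) <= c (x + y + 1)%R ^ 2) ->
  4 * K * ((\sum_(x <- IA) a x) * (\sum_(y <- IB) b y)) <= (\sum_(z <- IC) c z) ^ 2.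
Proof.
move=> uA uB c0 H.
case: (posnP K) => [->|K0]; first by rewrite muln0 mul0n.
pose Ma := \max_(x <- IA) a x; pose Mb := \max_(y <- IB) b y.
have leMa x : x \in IA -> a x <= Ma by move=> xA; exact: leq_bigmax_seq.
have leMb x : x \in IB -> b x <= Mb by move=> xA; exact: leq_bigmax_seq.
case: (posnP Ma) => [Ma0|Ma0].
  rewrite big_seq big1 ?mul0n ?muln0// => x xA.
  by apply/eqP; rewrite -leqn0 -Ma0 leMa.
case: (posnP Mb) => [Mb0|Mb0].
  rewrite (big_seq _ _ _ b) [X in _ * (_ * X)]big1 ?muln0// => x xA.
  by apply/eqP; rewrite -leqn0 -Mb0 leMb.
pose T := Ma * Mb.
have T0 : 0 < T by rewrite muln_gt0 Ma0.
(* [tau z] is the integer part of [c z * sqrt (T / K)], cut off at [T], written as a sum over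
   levels; each level serves as the set [C] of the sumset bound. *)
pose tau z := \sum_(t < T) (K * t.+1 ^ 2 <= T * c z ^ 2).
have tauP z : K * tau z ^ 2 <= T * c z ^ 2 by exact: sum_threshold.
have sumtau : (\sum_(x <- IA) a x) * Mb + (\sum_(y <- IB) b y) * Ma <= \sum_(z <- IC) tau z.
  rewrite !big_distrl /=.
  rewrite -(@sum_level _ IA (fun x => a x * Mb) T); last by move=> x xA; rewrite leq_mul2r leMa ?orbT.
  rewrite -(@sum_level _ IB (fun x => b x * Ma) T); last by move=> x xA; rewrite /T mulnC leq_mul2l leMb ?orbT.
  rewrite -big_split /= /tau exchange_big /=; apply: leq_sum => t _.
  rewrite -size_filter_sum; apply: size_sumset01; rewrite ?filter_uniq//.
  - have [x xA Hx] : exists2 x, x \in IA & a x = Ma by exact: bigmax_seq_attained.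
    apply/eqP => E; suff : x \in [::] by [].
    by rewrite -E mem_filter xA Hx (ltn_ord t).
  - have [x xA Hx] : exists2 x, x \in IB & b x = Mb by exact: bigmax_seq_attained.
    apply/eqP => E; suff : x \in [::] by [].
    by rewrite -E mem_filter xA Hx mulnC (ltn_ord t).
  move=> x y; rewrite !mem_filter => /andP[tx xA] /andP[ty yB].
  have [H0 H1] := H _ _ xA yB.
  have key z : K * (a x * b y) <= c z ^ 2 -> K * t.+1 ^ 2 <= T * c z ^ 2.
    move=> Hz; apply: (@leq_trans (T * (K * (a x * b y)))); last by rewrite leq_mul2l Hz orbT.
    have -> : T * (K * (a x * b y)) = K * ((a x * Mb) * (b y * Ma)) by rewrite /T; ring.
    by rewrite leq_mul2l -mulnn leq_mul ?orbT.
  have zC z : K * t.+1 ^ 2 <= T * c z ^ 2 -> z \in IC.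
    apply: contraLR => /c0 ->; rewrite muln0 leqn0 muln_eq0 negb_or -lt0n K0.
    by [].
  by split; rewrite ?mem_filter key//= zC// key.
rewrite -(leq_pmul2l T0).
apply: leq_trans (sqr_sum_le IC tauP).
(* The rescaling by the maxima cancels through [4 (p Mb) (q Ma) <= (p Mb + q Ma)^2]. *)
apply: (@leq_trans (K * ((\sum_(x <- IA) a x) * Mb + (\sum_(y <- IB) b y) * Ma) ^ 2)); last first.
  by rewrite leq_mul2l leq_exp2r// sumtau orbT.
set p := \sum_(x <- IA) a x; set q := \sum_(x <- IB) b x.
have -> : T * (4 * K * (p * q)) = K * (4 * ((p * Mb) * (q * Ma))) by rewrite /T; ring.
by rewrite leq_mul2l nat_AGM2 ?orbT.
Qed.

Definition hdz d (v : 'rV[int]_d.+1) : int := v ord0 ord0.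
Definition tlz d (v : 'rV[int]_d.+1) : 'rV[int]_d := \row_j v ord0 (lift ord0 j).
Definition consz d (x : int) (v : 'rV[int]_d) : 'rV[int]_d.+1 :=
  \row_i oapp (v ord0) x (unlift ord0 i).

Lemma hd_consz d x (v : 'rV[int]_d) : hdz (consz x v) = x.
Proof. by rewrite /hdz mxE unlift_none. Qed.

Lemma tl_consz d x (v : 'rV[int]_d) : tlz (consz x v) = v.
Proof. by apply/rowP => j; rewrite !mxE liftK. Qed.

Lemma consz_eta d (v : 'rV[int]_d.+1) : consz (hdz v) (tlz v) = v.
Proof. by apply/rowP => i; rewrite !mxE; case: (unliftP ord0 i) => [j ->|->] //=; rewrite mxE. Qed.

Definition slice d (A : seq 'rV[int]_d.+1) (x : int) :=
  [seq tlz v | v <- A & hdz v == x].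

Lemma slice_uniq d (A : seq 'rV[int]_d.+1) x : uniq A -> uniq (slice A x).
Proof.
move=> uA; rewrite map_inj_in_uniq ?filter_uniq// => v w.
rewrite !mem_filter => /andP[/eqP vx _] /andP[/eqP wx _] vw.
by rewrite -(consz_eta v) -(consz_eta w) vx wx vw.
Qed.

Lemma mem_slice d (A : seq 'rV[int]_d.+1) x v : (v \in slice A x) = (consz x v \in A).
Proof.
apply/mapP/idP => [[w]|vA].
  by rewrite mem_filter => /andP[/eqP <- wA] ->; rewrite consz_eta.
by exists (consz x v); rewrite ?mem_filter ?hd_consz ?eqxx ?tl_consz.
Qed.

Lemma size_slices d (A : seq 'rV[int]_d.+1) :
  \sum_(x <- undup (map (@hdz d) A)) size (slice A x) = size A.
Proof.
under eq_bigr do rewrite size_map size_filter_sum.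
rewrite exchange_big /= -[RHS]sum1_size; apply: eq_big_seq => v vA.
rewrite (bigD1_seq (hdz v)) ?undup_uniq ?mem_undup ?map_f//= eqxx big1 ?addn0// => x.
by rewrite eq_sym => /negbTE ->.
Qed.

(** The multiplicative form of Brunn-Minkowski, with [A + B + {0,1}^d] in place of the sumset of two
    unions of cells. Induction by slicing along the first coordinate: the slices at [x + y] and
    [x + y + 1] dominate those at [x] and [y], which is the hypothesis of the one-dimensional
    inequality with [K = 4 ^ d]. *)
Lemma discrete_brunn_minkowski d (A B C : seq 'rV[int]_d) : uniq A -> uniq B -> uniq C ->
  (forall a b c : 'rV[int]_d, a \in A -> b \in B ->
     (forall i, c ord0 i = a ord0 i + b ord0 i \/ c ord0 i = a ord0 i + b ord0 i + 1)%R ->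
     c \in C) ->
  4 ^ d * (size A * size B) <= size C ^ 2.
Proof.
elim: d A B C => [|d IH] A B C uA uB uC H.
  have sz1 (S : seq 'rV[int]_0) : uniq S -> size S <= 1.
    case: S => // x [|y S] //= /andP[]; rewrite in_cons (_ : x = y) ?eqxx//.
    by apply/rowP => -[].
  have := sz1 _ uA; have := sz1 _ uB; case: A uA H => [|a [|]]//; case: B uB => [|b [|]]//= _ _ H _ _.
  have : a \in C by apply: (H a b a) => //; rewrite ?mem_seq1//; case.
  by case: C {uC H}.
rewrite -(size_slices A) -(size_slices B) -(size_slices C) expnS.
apply: discrete_prekopa_leindler; rewrite ?undup_uniq//.
  move=> z; rewrite mem_undup => zC; rewrite size_map size_filter; apply/eqP.
  rewrite -leqn0 leqNgt -has_count; apply/negP => /hasP[v vC /eqP vz].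
  by move/negP: zC; apply; rewrite -vz map_f.
move=> x y _ _; split; apply: IH; rewrite ?slice_uniq// => a b c; rewrite !mem_slice => aA bB Hc;
  apply: (H _ _ _ aA bB) => i; rewrite !mxE; case: (unliftP ord0 i) => [j _|_] /=; auto.
Qed.

End DiscreteBrunnMinkowski.

(** * Occupancy probabilities of cells *)

Section WordCounting.
Variable T : finType.

Definition fcons n (t : T) (w : {ffun 'I_n -> T}) : {ffun 'I_n.+1 -> T} :=
  [ffun i => oapp w t (unlift ord0 i)].

Definition occ n (w : {ffun 'I_n -> T}) (t : T) : nat := \sum_l (w l == t).

Lemma occ_fcons n t (w : {ffun 'I_n -> T}) s : occ (fcons t w) s = ((t == s) + occ w s)%N.
Proof.
rewrite /occ big_ord_recl ffunE unlift_none /=; congr (_ + _)%N.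
by apply: eq_bigr => l _; rewrite ffunE liftK.
Qed.

Lemma big_fcons (R : Type) (idx : R) (op : Monoid.com_law idx) n (F : {ffun 'I_n.+1 -> T} -> R) :
  \big[op/idx]_w F w = \big[op/idx]_t \big[op/idx]_(w : {ffun 'I_n -> T}) F (fcons t w).
Proof.
rewrite pair_big /=.
rewrite (reindex (fun p : T * {ffun 'I_n -> T} => fcons p.1 p.2)) //=.
exists (fun w => (w ord0, [ffun j => w (lift ord0 j)])) => [[t w]|w] _ /=.
  congr (_, _); first by rewrite ffunE unlift_none.
  by apply/ffunP => j; rewrite !ffunE liftK.
by apply/ffunP => i; rewrite ffunE; case: unliftP => [j ->|->] //=; rewrite ffunE.
Qed.

Lemma sum_occ n (w : {ffun 'I_n -> T}) : (\sum_t occ w t = n)%N.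
Proof.
rewrite /occ exchange_big /= (eq_bigr (fun=> 1%N)) ?sum_nat_const ?card_ord ?muln1// => l _.
by rewrite (bigD1 (w l))//= eqxx big1 // => t /negbTE; rewrite eq_sym => ->.
Qed.

Lemma occ_le n (w : {ffun 'I_n -> T}) t : (occ w t <= n)%N.
Proof. by rewrite -{2}(sum_occ w) (bigD1 t)//= leq_addr. Qed.

(** Fixing the first letter as [t] lowers [c t] by one, and the weights [c t] add up to the length.
    An upper bound by the multinomial coefficient is enough, in a form without division. *)
Lemma multinomial_count n (c : T -> nat) : (\sum_t c t = n)%N ->
  ((\sum_(w : {ffun 'I_n -> T}) [forall t, occ w t == c t]) * \prod_t (c t)`! <= n`!)%N.
Proof.
elim: n c => [|n IH] c Hc.
  have c0 t : c t = 0%N.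
    by apply/eqP; rewrite -leqn0 -Hc (bigD1 t)//= leq_addr.
  rewrite [X in (_ * X)%N]big1 ?muln1 => [|t _]; last by rewrite c0.
  apply: (@leq_trans (\sum_(w : {ffun 'I_0 -> T}) 1)); first by apply: leq_sum => w _; exact: leq_b1.
  by rewrite sum1_card card_ffun card_ord expn0.
rewrite big_fcons big_distrl /=.
apply: (@leq_trans (\sum_t c t * n`!)); last by rewrite -big_distrl /= Hc factS.
apply: leq_sum => t _; case: (posnP (c t)) => [ct0|ct0].
  rewrite big1 ?mul0n// => w _; apply/eqP; rewrite eqb0.
  by apply/negP => /forallP/(_ t); rewrite occ_fcons eqxx ct0.
pose c' s := (c s - (t == s))%N.
rewrite (eq_bigr (fun w => [forall s, occ w s == c' s] : nat)); last first.
  move=> w _; congr nat_of_bool; apply/forallP/forallP => H s; have := H s; rewrite /c' occ_fcons.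
    by move/eqP => <-; rewrite addKn.
  by move=> /eqP ->; rewrite subnKC//; case: eqP => // <-.
have -> : (\prod_s (c s)`! = c t * \prod_s (c' s)`!)%N.
  rewrite [LHS](bigD1 t)//= [in RHS](bigD1 t)//= mulnA /c' eqxx; congr (_ * _)%N.
    by case: (c t) ct0 => // m _; rewrite subn1 factS.
  by apply: eq_bigr => s /negbTE; rewrite eq_sym => ->; rewrite subn0.
rewrite mulnCA leq_mul2l; apply/orP; right; apply: IH.
apply/eqP; rewrite -(eqn_add2r 1) (addn1 n) -Hc /c' (bigD1 t)//= [X in _ == X](bigD1 t)//= eqxx.
rewrite (eq_bigr c) => [|s /negbTE]; last by rewrite eq_sym => ->; rewrite subn0.
by rewrite addnAC subnK.
Qed.

Variable R : realType.

Lemma prod_occ n (w : {ffun 'I_n -> T}) (p : T -> R) :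
  \prod_l p (w l) = \prod_t p t ^+ occ w t.
Proof.
rewrite /occ (eq_bigr (fun l => \prod_t p t ^+ (w l == t))).
  by rewrite exchange_big /=; apply: eq_bigr => t _; rewrite -prodrXr.
move=> l _; rewrite (bigD1 (w l))//= eqxx expr1 big1 ?mulr1// => t.
by rewrite eq_sym => /negbTE ->.
Qed.

(* Extracting the coefficient of z^n from a power series with nonnegative
   coefficients costs at most the value of the series at z divided by z^n. *)
Lemma words_le_generating n (p : T -> R) (z : R) (G : T -> pred nat) :
  (forall t, 0 <= p t) -> 0 < z ->
  \sum_(w : {ffun 'I_n -> T} | [forall t, G t (occ w t)]) \prod_l p (w l) <=
  n`!%:R / z ^+ n * \prod_t \sum_(j < n.+1 | G t j) (p t * z) ^+ j / j`!%:R.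
Proof.
move=> p0 z0.
have occS (w : {ffun 'I_n -> T}) t : (occ w t < n.+1)%N by rewrite ltnS occ_le.
pose cw (w : {ffun 'I_n -> T}) : {ffun T -> 'I_n.+1} := [ffun t => Ordinal (occS w t)].
rewrite (partition_big cw (fun c => [forall t, G t (c t)] && (\sum_t c t == n)%N)) /=; last first.
  move=> w /forallP Gw; apply/andP; split.
    by apply/forallP => t; rewrite ffunE /=.
  by rewrite (eq_bigr (occ w)) ?sum_occ// => t _; rewrite ffunE.
under [X in _ <= _ * X]eq_bigr do rewrite big_mkcond /=.
rewrite bigA_distr_bigA /= mulr_sumr.
(* The product of sums has been expanded over all occupancy vectors; those of total [n] match the
   left side, the others are nonnegative and are dropped. *)
rewrite [leRHS](bigID (fun c : {ffun T -> 'I_n.+1} => [forall t, G t (c t)] && (\sum_t c t == n)%N)) /=.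
rewrite -[leLHS]addr0; apply: lerD; last first.
  apply: sumr_ge0 => c _; apply: mulr_ge0; first by rewrite divr_ge0 ?exprn_ge0 ?ltW.
  apply: prodr_ge0 => t _; case: ifP => // _.
  by rewrite divr_ge0 ?exprn_ge0 ?mulr_ge0// ltW.
apply: ler_sum => c /andP[/forallP Gc /eqP sc].
rewrite [X in _ <= _ * X](eq_bigr (fun t => (p t ^+ c t / (c t)`!%:R) * z ^+ c t)); last first.
  by move=> t _; rewrite Gc exprMn mulrAC.
rewrite big_split /= prodrXr sc mulrCA -mulrA mulVf ?mulr1 ?expf_neq0 ?gt_eqF//.
rewrite big_split /=.
rewrite (eq_bigr (fun w => \prod_t p t ^+ c t)); last first.
  move=> w /andP[_ /eqP <-]; rewrite prod_occ; apply: eq_bigr => t _.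
  by rewrite ffunE.
rewrite sumr_const -[_ *+ _]mulr_natr.
rewrite -mulrA ler_wpM2l//; first by apply: prodr_ge0 => t _; rewrite exprn_ge0.
rewrite prodfV mulrC ler_pdivlMr; last by apply: prodr_gt0 => t _; rewrite ltr0n fact_gt0.
rewrite -natr_prod -natrM ler_nat.
apply: leq_trans (multinomial_count sc); rewrite leq_mul2r; apply/orP; right.
rewrite -sum1_card big_mkcond /=; apply: leq_sum => w _.
case: ifP => // /andP[_ /eqP <-]; rewrite lt0b.
by apply/forallP => t; rewrite ffunE.
Qed.

Lemma expR_partial_le (x : R) m : 0 <= x -> \sum_(j < m) x ^+ j / j`!%:R <= expR x.
Proof.
move=> x0; rewrite -(big_mkord xpredT (fun j => x ^+ j / j`!%:R)).
have nd : nondecreasing_seq (series (exp_coeff x)).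
  by apply: nondecreasing_series => n _ _; exact: exp_coeff_ge0.
by have := nondecreasing_cvgn_le nd (is_cvg_series_exp_coeff x) m; rewrite /series /= /exp_coeff /=.
Qed.

(** For a Poisson variable [Z] of mean [x], [P(Z < k) <= 1 - P(Z = k) <= exp (- P(Z = k))],
    multiplied by the normalisation [expR x]. *)
Lemma expR_truncated_le (x : R) k m : 0 <= x ->
  \sum_(j < m | (j < k)%N) x ^+ j / j`!%:R <=
  expR (x - expR (- x) * (x ^+ k / k`!%:R)).
Proof.
move=> x0.
have H0 j : 0 <= x ^+ j / j`!%:R by rewrite divr_ge0 ?exprn_ge0.
apply: (@le_trans _ _ (\sum_(j < k) x ^+ j / j`!%:R)).
  have mono a b : (a <= b)%N -> \sum_(j < a) x ^+ j / j`!%:R <= \sum_(j < b) x ^+ j / j`!%:R.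
    by move=> /subnKC <-; rewrite big_split_ord /= lerDl; apply: sumr_ge0.
  apply: le_trans (mono _ _ (geq_minr m k)); rewrite le_eqVlt; apply/orP; left; apply/eqP.
  elim: m => [|m IH]; first by rewrite min0n !big_ord0.
  rewrite big_mkcond big_ord_recr -big_mkcond /= IH; case: ltnP => mk.
    by rewrite (minn_idPl mk) big_ord_recr.
  by rewrite (minn_idPr (leqW mk)) addr0.
have := expR_partial_le k.+1 x0; rewrite big_ord_recr /= => H.
rewrite expRD; set a := _ / _ in H *.
apply: (@le_trans _ _ (expR x - a)); first by rewrite lerBrDr.
have := expR_ge1Dx (- (expR (- x) * a)).
rewrite -(ler_pM2l (expR_gt0 x)) => /(le_trans _); apply.
by rewrite mulrDr mulr1 mulrN mulrA -expRD subrr expR0 mul1r.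
Qed.

(** Stirling's upper bound by induction. The step needs [(1 + 1/m)^(m+1) >= e], which follows from
    [1 - 1/(m+1) <= exp (- 1/(m+1))]. *)
Lemma fact_le_expR n : (0 < n)%N -> n`!%:R <= expR 1 * n%:R * (n%:R / expR 1) ^+ n :> R.
Proof.
case: n => // n _; elim: n => [|n IH].
  by rewrite expr1 mulr1 div1r mulfV ?gt_eqF ?expR_gt0.
rewrite factS natrM.
set a := n.+1%:R : R; set b := n.+2%:R : R.
have a0 : 0 < a by rewrite ltr0n.
have b0 : 0 < b by rewrite ltr0n.
have e0 := expR_gt0 (1 : R).
apply: (@le_trans _ _ (b * (expR 1 * a * (a / expR 1) ^+ n.+1))); first by rewrite ler_pM2l.
have key : expR 1 * a ^+ n.+2 <= b ^+ n.+2.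
  rewrite -ler_pdivlMr ?exprn_gt0// -expr_div_n.
  have -> : b / a = (a / b)^-1 by rewrite invf_div.
  have ab : a / b = 1 - b^-1 by rewrite /a /b; field; rewrite -?natr1; lra.
  have H : expR (b^-1) <= (a / b)^-1.
    rewrite -[leLHS]invrK -expRN lef_pV2 ?posrE ?expR_gt0 ?divr_gt0// ab; exact: expR_ge1Dx.
  apply: le_trans (_ : expR (b^-1) ^+ n.+2 <= _); last first.
    by rewrite lerXn2r// nnegrE ?expR_ge0// invr_ge0 divr_ge0// ltW.
  by rewrite -expRM_natl mulfV ?gt_eqF.
rewrite -(ler_pM2r (exprn_gt0 n.+1 e0)) !expr_div_n.
have -> : b * (expR 1 * a * (a ^+ n.+1 / expR 1 ^+ n.+1)) * expR 1 ^+ n.+1 = b * (expR 1 * a ^+ n.+2).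
  by rewrite [a ^+ n.+2]exprS; field; rewrite expf_neq0// gt_eqF.
have -> : expR 1 * b * (b ^+ n.+2 / expR 1 ^+ n.+2) * expR 1 ^+ n.+1 = b * b ^+ n.+2.
  by rewrite [expR 1 ^+ n.+2]exprS; field; rewrite expf_neq0 ?gt_eqF.
by rewrite ler_pM2l.
Qed.

End WordCounting.

(** * Tail bounds for the number of sample points in a cell *)

Section CellCounts.
Context {R : realType} {d0 : measure_display} {Omega : measurableType d0}.
Variables (P : probability Omega R) (d : nat) (X : nat -> Omega -> 'rV[R]_d).
Hypothesis X_meas : forall i A, borelRd A -> measurable (X i @^-1` A).
Hypothesis X_indep : mutually_independent P X.
Hypothesis X_ident : forall i A, borelRd A -> P (X i @^-1` A) = P (X 0%N @^-1` A).

Definition cnt n (A : set 'rV[R]_d) (w : Omega) : nat :=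
  (\sum_(l < n) (X l w \in A))%N.

Definition prob (A : set 'rV[R]_d) : R := fine (P (X 0%N @^-1` A)).

Lemma probE A i : borelRd A -> P (X i @^-1` A) = (prob A)%:E.
Proof.
by move=> mA; rewrite X_ident// /prob fineK// fin_num_measure//; exact: X_meas.
Qed.

Lemma prob_ge0 A : 0 <= prob A.
Proof. by rewrite /prob fine_ge0. Qed.

Lemma borelRdC (A : set 'rV[R]_d) : borelRd A -> borelRd (~` A).
Proof. exact: (@measurableC _ (Rd R d)). Qed.

Lemma probC A : borelRd A -> prob (~` A) = 1 - prob A.
Proof.
move=> mA; apply: EFin_inj; rewrite -(probE 0 (borelRdC mA)) preimage_setC probability_setC ?probE//.
exact: X_meas.
Qed.

Lemma cell_word_prob n (T : Type) (A : T -> set 'rV[R]_d) (w : 'I_n -> T) :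
  (forall t, borelRd (A t)) ->
  measurable (\bigcap_(l in [set: 'I_n]) X l @^-1` A (w l)) /\
  P (\bigcap_(l in [set: 'I_n]) X l @^-1` A (w l)) = (\prod_l prob (A (w l)))%:E.
Proof.
move=> mA; split.
  by apply: fin_bigcap_measurable => // l _; apply: X_meas.
(* Independence is stated for families indexed by [nat]; indices outside ['I_n] receive the whole
   space. *)
pose B i := oapp (fun l : 'I_n => A (w l)) setT (insub i).
have BE (l : 'I_n) : B l = A (w l) by rewrite /B insubT //= ?ltn_ord// => lt; congr (A (w _)); exact: val_inj.
have mB i : borelRd (B i).
  rewrite /B; case: insubP => [l _ _|_] /=; first exact: mA.
  exact: (@measurableT _ (Rd R d)).
have := X_indep (iota_uniq 0 n) (fun i _ => mB i).
rewrite (_ : \bigcap_(i in _) _ = \bigcap_(l in [set: 'I_n]) X l @^-1` A (w l)); last first.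
  apply/seteqP; split => x /= H.
    by move=> l _ /=; have := H l; rewrite /= mem_iota add0n ltn_ord BE; apply.
  move=> i /=; rewrite mem_iota add0n /= => ltn.
  by have := H (Ordinal ltn) I; rewrite -BE.
move=> ->; rewrite -[n in iota 0 n]subn0 big_mkord -prodEFin.
by apply: eq_bigr => l _; rewrite probE// BE.
Qed.

(** Introduces the form of the probability bounds that follow: an event of interest is contained in
    a measurable [E] of controlled probability, without being shown measurable itself. *)
Lemma finite_union_bound (I : finType) (Q : pred I) (F : I -> set Omega) :
  (forall i, measurable (F i)) ->
  exists2 E, measurable E & (forall i, Q i -> F i `<=` E) /\
    (P E <= \sum_(i | Q i) P (F i))%E.
Proof.
move=> mF; exists (\big[setU/set0]_(i | Q i) F i); first exact: bigsetU_measurable.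
split.
  by move=> i Qi x Fx; rewrite (bigD1 i)//=; left.
suff [] : measurable (\big[setU/set0]_(i | Q i) F i) /\ (P (\big[setU/set0]_(i | Q i) F i) <= \sum_(i | Q i) P (F i))%E by [].
elim/big_rec2: _ => [|i e S Qi [mS IH]]; first by rewrite measure0.
split; first exact: measurableU.
by apply: le_trans (measureU2 _ _ _) _ => //; rewrite leeD2l.
Qed.

Lemma word_event_bound n (T : finType) (A : T -> set 'rV[R]_d) (W : pred {ffun 'I_n -> T}) :
  (forall t, borelRd (A t)) ->
  exists2 E, measurable E &
    (forall w (wd : {ffun 'I_n -> T}), W wd -> (forall l, A (wd l) (X l w)) -> E w) /\
    (P E <= (\sum_(wd | W wd) \prod_l prob (A (wd l)))%:E)%E.
Proof.
move=> mA.
pose F (wd : {ffun 'I_n -> T}) := \bigcap_(l in [set: 'I_n]) X l @^-1` A (wd l).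
have [|E mE [EF PE]] := @finite_union_bound {ffun 'I_n -> T} W F.
  by move=> wd; have [] := cell_word_prob wd mA.
exists E => //; split.
  by move=> w wd Wwd H; apply: (EF wd Wwd) => l _; exact: H.
rewrite -sumEFin; apply: le_trans PE _; apply: lee_sum => wd _.
by have [_ ->] := cell_word_prob wd mA.
Qed.

Let bcell (A : set 'rV[R]_d) (b : bool) := if b then A else ~` A.

Let bcell_borel A : borelRd A -> forall b, borelRd (bcell A b).
Proof. by move=> mA [] //=; exact: borelRdC. Qed.

Let bword n (A : set 'rV[R]_d) w : {ffun 'I_n -> bool} := [ffun l : 'I_n => X l w \in A].

Let bwordP n A w l : bcell A (bword n A w l) (X l w).
Proof.
rewrite /bword ffunE; case: (boolP (X l w \in A)) => /=; first by rewrite inE.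
by move/negP => H; rewrite /setC /=; move=> H'; apply: H; rewrite inE.
Qed.

Let card_bword n A w : occ (bword n A w) true = cnt n A w.
Proof. by apply: eq_bigr => l _; rewrite ffunE eqb_id. Qed.

(** The binomial generating function, as a sum over words recording which points fall into the
    cell. *)
Lemma sum_bool_words n (p q b : R) :
  \sum_(wd : {ffun 'I_n -> bool}) b ^+ occ wd true * \prod_l (if wd l then p else q) =
  (p * b + q) ^+ n.
Proof.
transitivity (\prod_(l < n) \sum_(x : bool) (if x then p * b else q)).
  rewrite bigA_distr_bigA; apply: eq_bigr => wd _.
  rewrite /occ -prodrXr -big_split /=.
  by apply: eq_bigr => l _; rewrite eqb_id; case: (wd l); rewrite ?mul1r// mulrC expr1.
by rewrite prodr_const card_ord big_bool.
Qed.

(** Markov's inequality for [b ^ cnt - 1]. Subtracting 1 makes the bound vanish with [prob A], so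
    that it can be summed over infinitely many cells. *)
Lemma upper_tail n A k (b : R) : borelRd A -> 1 <= b -> 1 < b ^+ k ->
  exists2 E, measurable E & (forall w, (k <= cnt n A w)%N -> E w) /\
    (P E <= (((1 + prob A * (b - 1)) ^+ n - 1) / (b ^+ k - 1))%:E)%E.
Proof.
move=> mA b1 bk.
have [E mE [EF PE]] := @word_event_bound n bool (bcell A)
  (fun wd => (k <= occ wd true)%N) (bcell_borel mA).
exists E => //; split.
  move=> w kw; apply: (EF w (bword n A w)); last exact: bwordP.
  by rewrite card_bword.
apply: le_trans PE _; rewrite lee_fin.
have bk0 : 0 < b ^+ k - 1 by rewrite subr_gt0.
have pE (x : bool) : prob (bcell A x) = if x then prob A else 1 - prob A.
  by case: x => //=; rewrite probC.
rewrite ler_pdivlMr// mulr_suml.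
have -> : (1 + prob A * (b - 1)) ^+ n - 1 =
   \sum_(wd : {ffun 'I_n -> bool}) (b ^+ occ wd true - 1) * \prod_l (if wd l then prob A else 1 - prob A).
  under eq_bigr do rewrite mulrBl.
  rewrite big_split /= sum_bool_words sumrN.
  have := sum_bool_words n (prob A) (1 - prob A) 1.
  under eq_bigr do rewrite expr1n.
  move=> ->; have -> : prob A * 1 + (1 - prob A) = 1 by ring.
  by rewrite expr1n; congr (_ ^+ _ - 1); ring.
rewrite [leRHS](bigID (fun wd : {ffun 'I_n -> bool} => (k <= occ wd true)%N)) /=.
have p0 (wd : {ffun 'I_n -> bool}) : 0 <= \prod_l (if wd l then prob A else 1 - prob A).
  by apply: prodr_ge0 => l _; rewrite -pE prob_ge0.
rewrite -[leLHS]addr0; apply: lerD; last first.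
  by apply: sumr_ge0 => wd _; rewrite mulr_ge0// subr_ge0 exprn_ege1.
apply: ler_sum => wd kwd; rewrite mulrC (eq_bigr _ (fun l _ => pE (wd l))).
by rewrite ler_wpM2r// lerB// ler_weXn2l.
Qed.

(** Markov's inequality for [b ^ cnt] with [b <= 1], which is at least [b ^ k] when the count is
    below [k]. *)
Lemma lower_tail n A k (b : R) : borelRd A -> 0 < b <= 1 ->
  exists2 E, measurable E & (forall w, (cnt n A w < k)%N -> E w) /\
    (P E <= ((1 - prob A * (1 - b)) ^+ n / b ^+ k)%:E)%E.
Proof.
move=> mA /andP[b0 b1].
have [E mE [EF PE]] := @word_event_bound n bool (bcell A)
  (fun wd => (occ wd true < k)%N) (bcell_borel mA).
exists E => //; split.
  move=> w kw; apply: (EF w (bword n A w)); last exact: bwordP.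
  by rewrite card_bword.
apply: le_trans PE _; rewrite lee_fin.
have bk0 : 0 < b ^+ k by rewrite exprn_gt0.
have pE (x : bool) : prob (bcell A x) = if x then prob A else 1 - prob A.
  by case: x => //=; rewrite probC.
rewrite ler_pdivlMr// mulr_suml.
have -> : (1 - prob A * (1 - b)) ^+ n =
   \sum_(wd : {ffun 'I_n -> bool}) b ^+ occ wd true * \prod_l (if wd l then prob A else 1 - prob A).
  rewrite sum_bool_words; congr (_ ^+ _).
  by ring.
rewrite [leRHS](bigID (fun wd : {ffun 'I_n -> bool} => (occ wd true < k)%N)) /=.
have p0 (wd : {ffun 'I_n -> bool}) : 0 <= \prod_l (if wd l then prob A else 1 - prob A).
  by apply: prodr_ge0 => l _; rewrite -pE prob_ge0.
rewrite -[leLHS]addr0; apply: lerD; last first.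
  by apply: sumr_ge0 => wd _; rewrite mulr_ge0// exprn_ge0// ltW.
apply: ler_sum => wd kwd; rewrite mulrC (eq_bigr _ (fun l _ => pE (wd l))).
by apply: ler_wpM2r => //; apply: ler_wiXn2l; [exact: ltW|exact: b1|exact: ltnW].
Qed.

Lemma prob_finite_union (I : finType) (W : I -> set 'rV[R]_d) :
  (forall i, borelRd (W i)) -> (forall i j x, W i x -> W j x -> i = j) ->
  prob (\bigcup_(i in [set: I]) W i) = \sum_i prob (W i).
Proof.
move=> mW dW; apply: EFin_inj.
have mU : borelRd (\bigcup_i W i).
  by apply: (@countable_bigcupT_measurable _ (Rd R d)) => //; exact: countableP.
rewrite -(probE 0 mU) preimage_bigcup measure_fin_bigcup//; last 3 first.
- exact: finite_finset.
- by move=> i j _ _ [x [Wi Wj]]; exact: dW Wi Wj.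
- by move=> i _; exact: X_meas.
have -> : [set: I] = [set` index_enum I] by apply/seteqP; split => // i _ /=; exact: mem_index_enum.
rewrite -fsbig_seq ?index_enum_uniq// -sumEFin; apply: eq_bigr => i _; exact: probE.
Qed.

Lemma big_option (I : finType) (h : option I -> R) :
  \sum_t h t = h None + \sum_i h (Some i).
Proof.
rewrite (bigD1 None)//=; congr (_ + _).
rewrite (reindex_omap Some id) => [|[i|]] //=.
by apply: eq_bigl => i; rewrite eqxx.
Qed.

(** The letter [None] stands for the complement of all cells. Evaluating the generating function at
    [z = n] replaces the counts by Poisson ones of means [n * prob (W i)], truncated below [k].
    Extracting the coefficient costs [n! * exp n / n ^ n], which is at most the prefactor
    [e * n]. *)
Lemma all_cells_sparse n m k (W : 'I_m -> set 'rV[R]_d) : (0 < n)%N ->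
  (forall i, borelRd (W i)) -> (forall i j x, W i x -> W j x -> i = j) ->
  exists2 E, measurable E & (forall w, (forall i, cnt n (W i) w < k)%N -> E w) /\
    (P E <= (expR 1 * n%:R * expR (- \sum_i (expR (- (n%:R * prob (W i))) *
        ((n%:R * prob (W i)) ^+ k / k`!%:R))))%:E)%E.
Proof.
move=> n0 mW dW.
pose U := \bigcup_(i in [set: 'I_m]) W i.
have mU : borelRd U by apply: (@countable_bigcupT_measurable _ (Rd R d)) => //; exact: countableP.
pose A (t : option 'I_m) := oapp W (~` U) t.
have mA t : borelRd (A t) by case: t => [i|] /=; [exact: mW|exact: borelRdC].
pose G (t : option 'I_m) : pred nat := if t is Some _ then fun j => (j < k)%N else predT.
have [E mE [EF PE]] := @word_event_bound n _ A
  (fun wd => [forall t, G t (occ wd t)]) mA.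
exists E => //; split.
  move=> w Hw.
  pose wd : {ffun 'I_n -> option 'I_m} := [ffun l : 'I_n => [pick i | X l w \in W i]].
  apply: (EF w wd).
    apply/forallP => -[i|//] /=; apply: leq_ltn_trans (Hw i).
    rewrite /occ /cnt; apply: leq_sum => l _.
    rewrite ffunE; case: pickP => [i' Hi'|] //=.
    by case: eqP => // -[<-]; rewrite Hi'.
  move=> l; rewrite ffunE; case: pickP => [i|H] /=; first by rewrite inE.
  by move=> [i _ /mem_set Wi]; rewrite H in Wi.
apply: le_trans PE _; rewrite lee_fin.
have nR : 0 < n%:R :> R by rewrite ltr0n.
apply: le_trans (@words_le_generating _ _ n (fun t => prob (A t)) n%:R G (fun t => prob_ge0 _) nR) _.
have prodle : \prod_t (\sum_(j < n.+1 | G t j) (prob (A t) * n%:R) ^+ j / j`!%:R) <=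
   expR (n%:R - \sum_i (expR (- (n%:R * prob (W i))) * ((n%:R * prob (W i)) ^+ k / k`!%:R))).
  pose h (t : option 'I_m) : R := n%:R * prob (A t) -
    (if t is Some i then expR (- (n%:R * prob (W i))) * ((n%:R * prob (W i)) ^+ k / k`!%:R) else 0).
  have -> : n%:R - \sum_i (expR (- (n%:R * prob (W i))) * ((n%:R * prob (W i)) ^+ k / k`!%:R)) = \sum_t h t.
    rewrite big_option /h /= sumrB subr0 -mulr_sumr addrA; congr (_ - _).
    rewrite -mulrDr probC// prob_finite_union// subrK mulr1//.
  rewrite expR_sum; apply: ler_prod => t _; apply/andP; split.
    by apply: sumr_ge0 => j _; rewrite divr_ge0// exprn_ge0// mulr_ge0 ?prob_ge0.
  rewrite mulrC; have x0 : 0 <= n%:R * prob (A t) by rewrite mulr_ge0 ?prob_ge0.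
  case: t x0 => [i|] x0 /=; first exact: expR_truncated_le.
  by rewrite /h subr0; exact: expR_partial_le.
apply: le_trans (ler_wpM2l _ prodle) _; first by rewrite divr_ge0 ?exprn_ge0.
rewrite expRD mulrA ler_wpM2r ?expR_ge0//.
rewrite mulrAC ler_pdivrMr ?exprn_gt0//.
apply: le_trans (ler_wpM2r (expR_ge0 _) (fact_le_expR R n0)) _.
rewrite (_ : expR n%:R = expR 1 ^+ n); last by rewrite -expRM_natl mulr1.
by rewrite expr_div_n -!mulrA mulVf ?mulr1 ?lexx// expf_neq0// gt_eqF// expR_gt0.
Qed.

End CellCounts.

(** * Volumes of norm balls and the isodiametric inequality *)

Section NormGeometry.
Variables (R : realType) (d : nat) (N : 'rV[R]_d -> R).
Hypothesis HN : is_norm N.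

Lemma norm_zero : N 0 = 0.
Proof. by case: HN => _ HZ _; rewrite -(scale0r 0) HZ normr0 mul0r. Qed.

Lemma norm_opp x : N (- x) = N x.
Proof. by case: HN => _ HZ _; rewrite -scaleN1r HZ normrN1 mul1r. Qed.

Lemma norm_sym x y : N (x - y) = N (y - x).
Proof. by rewrite -norm_opp opprB. Qed.

Lemma norm_ge0 x : 0 <= N x.
Proof.
case: HN => _ _ HT; have := HT x (- x).
by rewrite subrr norm_zero norm_opp -mulr2n pmulrn_lge0.
Qed.

Lemma norm_triangle x y : N (x + y) <= N x + N y.
Proof. by case: HN => _ _; exact. Qed.

Lemma norm_scale a x : N (a *: x) = `|a| * N x.
Proof. by case: HN => _ HZ _; rewrite HZ. Qed.

(** Bounds [N] on vectors with coordinates in [[-1, 1]]; the added 1 makes it positive in every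
    dimension and the resulting estimates strict. *)
Definition normK : R := \sum_(i < d) N (delta_mx ord0 i) + 1.

Lemma normK_gt0 : 0 < normK.
Proof. by rewrite ltr_wpDl// sumr_ge0// => i _; exact: norm_ge0. Qed.

Lemma norm_sum (I : Type) (s : seq I) (F : I -> 'rV[R]_d) :
  N (\sum_(i <- s) F i) <= \sum_(i <- s) N (F i).
Proof.
elim/big_rec2: _ => [|i y x _ IH]; first by rewrite norm_zero.
by apply: le_trans (norm_triangle _ _) _; rewrite lerD2l.
Qed.

Lemma norm_le_coord (x : 'rV[R]_d) e : 0 < e -> (forall i, `|x ord0 i| <= e) -> N x < e * normK.
Proof.
move=> e0 H; rewrite [x]row_sum_delta.
apply: le_lt_trans (norm_sum _ _) _.
rewrite /normK mulrDr mulr1 ltr_pwDr// mulr_sumr; apply: ler_sum => i _.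
by rewrite norm_scale ler_wpM2r// norm_ge0.
Qed.

Lemma norm_continuous : continuous N.
Proof.
move=> /= x A /= /(nbhs_ballP (N x))[e /= e0 eA].
have K0 := normK_gt0.
apply/nbhs_ballP; exists (e / normK) => [|y [_ xy]] /=; first exact: divr_gt0.
apply: eA; rewrite /ball /=.
have : forall i, `|(x - y) ord0 i| <= e / normK.
  by move=> i; rewrite !mxE; apply: ltW; exact: xy.
move=> /(norm_le_coord (divr_gt0 e0 K0)); rewrite divfK ?gt_eqF// => H.
have H1 := norm_triangle (y - x) x; have H2 := norm_triangle (x - y) y.
rewrite !subrK norm_sym in H1 H2; rewrite ltr_norml; move: H1 H2.
lra.
Qed.

(** Equivalence of norms. On the compact face [x_i = 1] of the unit cube [N] attains a positive
    minimum, and a vector whose largest coordinate is the [i]-th one scales into that face. *)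
Lemma coord_le_norm : exists2 k : R, 0 < k & forall (x : 'rV[R]_d) i, `|x ord0 i| <= k * N x.
Proof.
have key (i : 'I_d) : exists k : R, 0 < k /\
    forall x : 'rV[R]_d, (forall j, `|x ord0 j| <= `|x ord0 i|) -> `|x ord0 i| <= k * N x.
  pose A (j : 'I_d) : set R := if j == i then [set 1] else `[-1, 1]%classic.
  have cA : compact [set v : 'rV[R]_d | forall j, A j (v ord0 j)].
    apply: rV_compact => j; rewrite /A; case: ifP => _; first exact: compact_set1.
    exact: segment_compact.
  have A0 : [set v : 'rV[R]_d | forall j, A j (v ord0 j)] !=set0.
    exists (delta_mx ord0 i) => j; rewrite mxE eqxx /= /A; case: ifP => //= _.
    by rewrite in_itv /= oppr_le0 !ler01.
  have [|c cA' Hc] := EVT_min_rV A0 cA (f := N).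
    by apply: continuous_subspaceT; exact: norm_continuous.
  have Nc : 0 < N c.
    rewrite lt_neqAle norm_ge0 andbT eq_sym; apply/eqP => Nc0.
    have [H0 _ _] := HN; move: cA'; rewrite (H0 _ Nc0) inE => /(_ i).
    by rewrite /A eqxx mxE /= => /esym/eqP; rewrite oner_eq0.
  exists (N c)^-1; split; first by rewrite invr_gt0.
  move=> x Hx; have [x0|x0] := eqVneq (x ord0 i) 0.
    by rewrite x0 normr0 mulr_ge0 ?norm_ge0// invr_ge0 ltW.
  have : N c <= N ((x ord0 i)^-1 *: x).
    apply: Hc; rewrite inE => j; rewrite /A mxE.
    case: eqP => [->|_] /=; first by rewrite mulVf.
    rewrite in_itv /= -ler_norml normrM normfV mulrC ler_pdivrMr ?normr_gt0// mul1r.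
    exact: Hx.
  rewrite norm_scale normfV mulrC ler_pdivlMr ?normr_gt0// => H.
  by rewrite mulrC ler_pdivlMr// mulrC.
have [k Hk] := choice key.
exists (\sum_i k i + 1); first by rewrite ltr_wpDl// sumr_ge0// => i _; apply: ltW; case: (Hk i).
move=> x i.
have [j _ Hj] : exists2 j, true & forall l, `|x ord0 l| <= `|x ord0 j|.
  exists [arg max_(j > i) `|x ord0 j|]%O => // l.
  by case: arg_maxP => // j _; apply.
have [kj0 /(_ x Hj) Hkj] := Hk j.
apply: le_trans (Hj i) _; apply: le_trans Hkj _.
rewrite ler_wpM2r ?norm_ge0// (bigD1 j)//= -addrA lerDl addr_ge0// sumr_ge0// => l _.
by apply: ltW; case: (Hk l).
Qed.

Definition nball (rho : R) : set 'rV[R]_d := [set x | N x < rho].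

Lemma nball_borel rho : borelRd (nball rho).
Proof.
have := continuous_measurable_rV norm_continuous measurableT (measurable_itv `]-oo, rho[).
rewrite setTI; congr (borelRd _); apply/seteqP; split => x /=; by rewrite in_itv.
Qed.

Lemma same_cell_norm e x y : 0 < e -> cix e x = cix e y -> N (x - y) < e * normK.
Proof.
move=> e0 xy; apply: norm_le_coord => // i; rewrite !mxE ltW//; exact: cix_dist xy.
Qed.

Definition zrow (z : 'rV[int]_d) : 'rV[R]_d := map_mx intr z.

Lemma cell_corner_norm e x : 0 < e -> N (x - e *: zrow (cix e x)) < e * normK.
Proof.
move=> e0; apply: norm_le_coord => // i; rewrite !mxE.
have := floor_itv (x ord0 i / e); rewrite intrD => /andP[].
rewrite ler_pdivlMr// ltr_pdivrMr// mulrDl mul1r => H1 H2.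
by rewrite [e * _]mulrC ler_norml; lra.
Qed.

(** Finite sets of lattice points are kept as duplicate-free sequences, whose length is the number
    of cells. *)
Lemma bounded_zrows (Z : set 'rV[int]_d) (M : nat) :
  (forall z, Z z -> forall i, (`|z ord0 i| <= M)%N) ->
  exists2 s : seq 'rV[int]_d, uniq s & forall z, z \in s <-> Z z.
Proof.
move=> H.
pose emb (u : {ffun 'I_d -> 'I_(M + M).+1}) : 'rV[int]_d := \row_i ((u i)%:Z - M%:Z).
have emb_inj : injective emb.
  move=> u v /rowP E; apply/ffunP => i; have := E i; rewrite !mxE => /addIr [].
  exact: val_inj.
exists [seq z <- map emb (enum {ffun 'I_d -> 'I_(M + M).+1}) | `[< Z z >]].
  by rewrite filter_uniq// map_inj_uniq ?enum_uniq.
move=> z; rewrite mem_filter; split=> [/andP[/asboolP]//|Zz].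
apply/andP; split; first exact/asboolP.
apply/mapP; exists [ffun i => inord `|(z ord0 i + M%:Z)%R|%N]; first by rewrite mem_enum.
have key (a : int) : (`|a|%N <= M)%N ->
    a = Posz `|(a + M%:Z)%R|%N - M%:Z /\ (`|(a + M%:Z)%R|%N < (M + M).+1)%N.
  move=> aM; have a0 : 0 <= a + M%:Z by lia.
  split; last by lia.
  by rewrite gez0_abs// addrK.
have {}key i := key _ (H _ Zz i).
by apply/rowP => i; rewrite mxE ffunE inordK; case: (key i).
Qed.

Lemma norm_bounded_zrows (e rho : R) : 0 < e ->
  exists2 s : seq 'rV[int]_d, uniq s & forall z, z \in s <-> N (e *: zrow z) <= rho.
Proof.
move=> e0; have [k k0 Hk] := coord_le_norm.
apply: (@bounded_zrows _ (Num.bound (k * rho / e))) => z Hz i.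
have := Hk (e *: zrow z) i; rewrite !mxE normrM (gtr0_norm e0).
move=> /le_trans/(_ (ler_wpM2l (ltW k0) Hz)); rewrite mulrC -ler_pdivlMr// => H.
have H0 : 0 <= k * rho / e by apply: le_trans H; rewrite normr_ge0.
have := le_lt_trans H (archi_boundP H0).
by rewrite -intr_norm -abszE -[X in _ < X]mulr_natr mul1r ltr_nat => /ltnW.
Qed.

Variable mu : {sigma_finite_measure set (Rd R d) -> \bar R}.
Hypothesis Hmu : represents_iint mu.

Lemma measure_cells (e : R) (s : seq 'rV[int]_d) : 0 < e -> uniq s ->
  measurable ([set x | cix e x \in s] : set (Rd R d)) /\
  mu [set x | cix e x \in s] = ((size s)%:R * e ^+ d)%:E.
Proof.
move=> e0; split; first exact: (measurable_cell [set z | z \in s]).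
elim: s H => [|z s IH] /= => [_|/andP[zs us]].
  have -> : [set x : 'rV[R]_d | cix e x \in [::]] = set0 by rewrite -subset0 => x.
  by rewrite measure0 mul0r.
have -> : [set x : 'rV[R]_d | cix e x \in z :: s] = [set x | cix e x = z] `|` [set x | cix e x \in s].
  apply/seteqP; split => x /=; rewrite in_cons; first by move=> /orP[/eqP|]; [left|right].
  by move=> [->|->]; rewrite ?eqxx ?orbT.
rewrite measureU; last 3 first.
- exact: (measurable_cell [set z]).
- exact: (measurable_cell [set z | z \in s]).
- by rewrite -subset0 => x /= [xz xs]; move: zs; rewrite -xz xs.
transitivity ((e ^+ d)%:E + ((size s)%:R * e ^+ d)%:E)%E.
  by congr (_ + _)%E; [exact: (measure_cell Hmu)|exact: IH].
by rewrite -EFinD -natr1 mulrDl mul1r addrC.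
Qed.

Lemma nball_lty rho : (mu (nball rho) < +oo)%E.
Proof.
have [k k0 Hk] := coord_le_norm.
have [s us Hs] := @norm_bounded_zrows 1 (rho + normK) ltr01.
have [ms E] := measure_cells (@ltr01 R) us.
apply: le_lt_trans (_ : (mu [set x | cix 1 x \in s] < +oo)%E); last by rewrite E ltry.
apply: le_measure; rewrite ?inE//; first exact: nball_borel.
move=> x /= Nx; apply/Hs.
have := cell_corner_norm x (@ltr01 R); rewrite mul1r norm_sym => H.
have := norm_triangle (1 *: zrow (cix 1 x) - x) x; rewrite subrK => /le_trans; apply.
by rewrite addrC lerD// ltW.
Qed.

Definition vB : R := fine (vol (unit_ball N)).

Lemma nball1E : mu (nball 1) = vB%:E.
Proof.
rewrite /vB (vol_measure Hmu); last exact: (nball_borel 1).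
by rewrite fineK// ge0_fin_numE// (nball_lty 1).
Qed.

(** The cell of side [normK^-1] at the origin lies in the ball. *)
Lemma vB_gt0 : 0 < vB.
Proof.
have K0 := normK_gt0.
rewrite -lte_fin -nball1E.
apply: lt_le_trans (_ : (mu [set x | cix (normK^-1) x = 0%R] <= _)%E).
  by rewrite (measure_cell Hmu) ?invr_gt0// lte_fin exprn_gt0// invr_gt0.
apply: le_measure; rewrite ?inE; last 2 first.
- exact: nball_borel.
- move=> x /= x0; have := @same_cell_norm (normK^-1) x 0.
  rewrite invr_gt0 subr0 mulVf ?gt_eqF//; apply => //.
  by rewrite x0; apply/rowP => i; rewrite !mxE mul0r floor0.
by apply: (measurable_cell [set 0]); rewrite invr_gt0.
Qed.

Definition inner_cells e (z : 'rV[int]_d) := forall x, cix e x = z -> N x < 1.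

Lemma inner_cells_finite e : 0 < e ->
  exists2 s : seq 'rV[int]_d, uniq s & forall z, z \in s <-> inner_cells e z.
Proof.
move=> e0.
have [s us Hs] := norm_bounded_zrows 1 e0.
exists [seq z <- s | `[< inner_cells e z >]]; first exact: filter_uniq.
move=> z; rewrite mem_filter; split=> [/andP[/asboolP]//|Hz].
apply/andP; split; first exact/asboolP.
apply/Hs/ltW/Hz/rowP => i; rewrite !mxE mulrC mulKf ?gt_eqF//.
exact: intrKfloor.
Qed.

Lemma cix_scale (c e : R) (x : 'rV[R]_d) : c != 0 -> cix (c * e) (c *: x) = cix e x.
Proof. by move=> c0; apply/rowP => i; rewrite !mxE invfM mulrACA divff// mul1r. Qed.

(* The cells counted at scale [e] inside the unit ball, dilated by [c], cover
   the ball of radius [c * (1 - e * normK)]. *)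
Lemma inner_cells_measure (e c : R) s : 0 < e -> 0 < c -> uniq s ->
  (forall z, z \in s <-> inner_cells e z) ->
  (size s)%:R * e ^+ d <= vB /\
  (mu (nball (c * (1 - e * normK))) <= ((size s)%:R * e ^+ d * c ^+ d)%:E)%E.
Proof.
move=> e0 c0 us Hs; split.
  rewrite -lee_fin -nball1E -(measure_cells e0 us).2; apply: le_measure; rewrite ?inE.
  - exact: (measure_cells e0 us).1.
  - exact: nball_borel.
  - by move=> x /= /Hs; apply.
have ce0 : 0 < c * e by rewrite mulr_gt0.
rewrite -mulrA -exprMn [e * c]mulrC -(measure_cells ce0 us).2; apply: le_measure; rewrite ?inE.
- exact: nball_borel.
- exact: (measure_cells ce0 us).1.
move=> x /= Nx; rewrite -[x in cix _ x]scale1r -(mulfV (lt0r_neq0 c0)) -scalerA cix_scale ?gt_eqF//.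
apply/Hs => y xy.
have := same_cell_norm e0 xy => H.
have := norm_triangle (y - c^-1 *: x) (c^-1 *: x); rewrite subrK => /le_lt_trans; apply.
apply: lt_le_trans (_ : e * normK + (1 - e * normK) <= 1); last by rewrite addrCA subrr addr0.
by rewrite ltrD// norm_scale gtr0_norm ?invr_gt0// mulrC ltr_pdivrMr// mulrC.
Qed.

End NormGeometry.

(** * The isodiametric inequality for unions of cells *)

Section IsodiametricInequality.
Variables (R : realType) (d : nat) (N : 'rV[R]_d -> R).
Hypothesis d_gt0 : (0 < d)%N.
Hypothesis HN : is_norm N.
Variable mu : {sigma_finite_measure set (Rd R d) -> \bar R}.
Hypothesis Hmu : represents_iint mu.

Lemma exists_root (a : R) : 0 < a -> exists2 c : R, 0 < c & c ^+ d = a.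
Proof.
move=> a0; exists (expR (ln a / d%:R)); first exact: expR_gt0.
by rewrite -expRM_natl mulrC divfK ?lnK ?posrE// pnatr_eq0 -lt0n.
Qed.

Lemma root_gt1 (a c : R) : 0 < c -> c ^+ d = a -> 1 < a -> 1 < c.
Proof.
move=> c0 ca a1; rewrite ltNge; apply/negP => c1.
by move: a1; rewrite -ca ltNge => /negP; apply; rewrite exprn_ile1// ltW.
Qed.

Lemma inner_approx (eps : R) : 0 < eps < 1 ->
  exists (e : R) (s : seq 'rV[int]_d), [/\ 0 < e, uniq s,
    forall z, z \in s -> inner_cells N e z,
    (1 - eps) * vB N <= (size s)%:R * e ^+ d & (size s)%:R * e ^+ d <= vB N].
Proof.
move=> /andP[eps0 eps1]; have K0 := normK_gt0 HN.
have a1 : 1 < (1 - eps)^-1 by rewrite invf_gt1; lra.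
have [c c0 cE] := exists_root (lt_trans ltr01 a1).
have c1 := root_gt1 c0 cE a1.
(* Chosen so that [c * (1 - e * normK N) = 1]: the inner cells dilated by [c] cover the unit
   ball. *)
pose e := (1 - c^-1) / normK N.
have e0 : 0 < e by rewrite divr_gt0// subr_gt0 invf_lt1.
have [s us Hs] := inner_cells_finite HN e0.
have [H1 H2] := inner_cells_measure HN Hmu e0 c0 us Hs.
exists e, s; split => //; first by move=> z /Hs.
move: H2; rewrite /e divfK ?gt_eqF// opprB addrC subrK mulfV ?gt_eqF// (nball1E HN Hmu) lee_fin cE.
by rewrite ler_pdivlMr ?subr_gt0// mulrC.
Qed.

(** Continuity of the volume of balls at radius 1: the inner cells dilated by [c] cover a ball
    larger than the unit ball, and their volume is at most [c ^+ d] times that of the unit ball. *)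
Lemma outer_approx (eps : R) : 0 < eps ->
  exists2 eta : R, 0 < eta & (mu (nball N (1 + eta)) <= ((1 + eps) * vB N)%:E)%E.
Proof.
move=> eps0; have K0 := normK_gt0 HN.
have a1 : 1 < 1 + eps by rewrite ltrDl.
have [c c0 cE] := exists_root (lt_trans ltr01 a1).
have c1 := root_gt1 c0 cE a1.
exists ((c - 1) / 2); first by rewrite divr_gt0// subr_gt0.
(* Chosen so that [c * (1 - e * normK N)] is the midpoint of 1 and [c]. *)
pose e := (c - 1) / (2 * c) / normK N.
have e0 : 0 < e by rewrite divr_gt0// divr_gt0 ?subr_gt0// mulr_gt0.
have [s us Hs] := inner_cells_finite HN e0.
have [H1 H2] := inner_cells_measure HN Hmu e0 c0 us Hs.
have -> : 1 + (c - 1) / 2 = c * (1 - e * normK N).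
  by rewrite /e divfK ?gt_eqF//; field; rewrite gt_eqF.
apply: le_trans H2 _; rewrite lee_fin cE mulrC ler_wpM2l// addr_ge0// ltW//.
Qed.

(* Isodiametric inequality on the lattice: discrete Brunn-Minkowski for [S] and [-S]. *)
Lemma isodiametric_cells (e : R) (S : seq 'rV[int]_d) : 0 < e -> uniq S ->
  (forall z z', z \in S -> z' \in S -> N (e *: zrow R (z - z')) <= 1 + e * normK N) ->
  (((size S)%:R * (2 * e) ^+ d)%:E <= mu (nball N (1 + 3 * (e * normK N))))%E.
Proof.
move=> e0 uS HS; have K0 := normK_gt0 HN.
(* [T] contains [S - S + {0,1}^d], at the price of one more [e * normK N]; passing from corners to
   whole cells costs a third one. *)
have [T uT HT] := norm_bounded_zrows HN (1 + 2 * (e * normK N)) e0.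
have bm := @discrete_brunn_minkowski d S (map -%R S) T uS.
have {bm} : (4 ^ d * (size S * size (map -%R S)) <= size T ^ 2)%N.
  apply: bm => //; first by rewrite map_inj_uniq//; exact: oppr_inj.
  move=> a _ c aS /mapP[b bS ->] Hc; apply/HT.
  have -> : e *: zrow R c = e *: zrow R (a - b) + e *: zrow R (c - (a - b)).
    by rewrite -scalerDr; congr (_ *: _); rewrite /zrow -map_mxD addrC subrK.
  apply: le_trans (norm_triangle HN _ _) _.
  rewrite [2 * _]mulrDl mul1r addrA; apply: lerD; first exact: HS.
  apply/ltW/(norm_le_coord HN e0) => i; rewrite !mxE normrM gtr0_norm//; apply: ler_piMr; first exact: ltW.
  have := Hc i; rewrite !mxE => -[->|->]; first by rewrite subrr normr0.
  by rewrite addrC addrA addNr add0r normr1.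
have -> : (4 ^ d = (2 ^ d) ^ 2)%N by rewrite -expnM mulnC expnM.
rewrite size_map mulnn -expnMn leq_exp2r// => H.
apply: le_trans (_ : mu [set x | cix e x \in T] <= _)%E.
  rewrite (measure_cells Hmu e0 uT).2 lee_fin exprMn mulrA.
  apply: ler_wpM2r; first exact/exprn_ge0/ltW.
  rewrite (_ : (size S)%:R * 2 ^+ d = (2 ^ d * size S)%N%:R); first by rewrite ler_nat.
  by rewrite natrM natrX mulrC.
apply: le_measure; rewrite ?inE.
- exact: (measure_cells Hmu e0 uT).1.
- exact: nball_borel.
move=> x /= /HT Hx; have := cell_corner_norm HN x e0 => H1.
have := norm_triangle HN (x - e *: zrow R (cix e x)) (e *: zrow R (cix e x)).
rewrite subrK => /le_lt_trans; apply.
by apply: lt_le_trans (ltr_leD H1 Hx) _; lra.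
Qed.

(** The mesh [e] depends on [eps] and the norm only. Used with cells of side [e * r] it serves all
    radii at once, which keeps the number of shapes fixed. *)
Lemma isodiametric_small (eps : R) : 0 < eps ->
  exists2 e : R, 0 < e & forall S : seq 'rV[int]_d, uniq S ->
  (forall z z', z \in S -> z' \in S -> N (e *: zrow R (z - z')) <= 1 + e * normK N) ->
  (size S)%:R * (2 * e) ^+ d <= (1 + eps) * vB N.
Proof.
move=> eps0; have K0 := normK_gt0 HN; have [eta eta0 H] := outer_approx eps0.
have e0 : 0 < eta / (3 * normK N) by rewrite divr_gt0// mulr_gt0.
exists (eta / (3 * normK N)) => // S uS HS.
rewrite -lee_fin; apply: le_trans (isodiametric_cells e0 uS HS) _.
rewrite (_ : 3 * _ = eta)//; field; exact: lt0r_neq0.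
Qed.

(** The offsets of both points from their corners lie in [[0, e)] in each coordinate, so their
    difference costs [e * normK N] once and not twice. *)
Lemma close_points_cells (e rho : R) (x y : 'rV[R]_d) : 0 < e -> N (x - y) <= rho ->
  N (e *: zrow R (cix e x - cix e y)) <= rho + e * normK N.
Proof.
move=> e0 xy.
have -> : e *: zrow R (cix e x - cix e y) =
    (x - y) + ((y - e *: zrow R (cix e y)) - (x - e *: zrow R (cix e x))).
  by apply/rowP => i; rewrite !mxE intrB; ring.
apply: le_trans (norm_triangle HN _ _) _; apply: lerD => //.
apply/ltW/(norm_le_coord HN e0) => i; rewrite !mxE.
have := floor_itv (x ord0 i / e); have := floor_itv (y ord0 i / e).
rewrite !intrD !ler_pdivlMr// !ltr_pdivrMr// !mulrDl !mul1r => /andP[H1 H2] /andP[H3 H4].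
by rewrite ![e * _]mulrC ler_norml; lra.
Qed.

End IsodiametricInequality.

Section Cliques.
Context {R : realType} {T : Type}.
Variables (d : nat) (N : 'rV[R]_d -> R).
Hypothesis HN : is_norm N.
Variable (X : nat -> T -> 'rV[R]_d).

Lemma clique_numberP n (r : R) w : exists S : {set 'I_n},
  #|S| = clique_number n N X r w /\
  forall i j, i \in S -> j \in S -> i != j -> N (X i w - X j w) <= r.
Proof.
pose P (S : {set 'I_n}) := is_clique N X r w S.
have P0 : P finset.set0 by apply/forall_inP => i; rewrite finset.inE.
exists [arg max_(S > finset.set0 | P S) #|S|]%N.
case: arg_maxnP => // S PS HS; split.
  apply/eqP; rewrite eqn_leq /clique_number leq_bigmax_cond//=.
  by apply/bigmax_leqP => S' PS'; exact: HS.
move=> i j iS jS ij; move/forall_inP : PS => /(_ i iS)/forall_inP/(_ j jS)/implyP; exact.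
Qed.

Lemma clique_number_ge n (r : R) w (S : {set 'I_n}) :
  (forall i j, i \in S -> j \in S -> i != j -> N (X i w - X j w) <= r) ->
  (#|S| <= clique_number n N X r w)%N.
Proof.
move=> H; rewrite /clique_number.
apply: (@leq_bigmax_cond _ (fun S : {set 'I_n} => is_clique N X r w S) (fun S => #|S|)).
apply/forall_inP => i iS; apply/forall_inP => j jS; apply/implyP; exact: H.
Qed.

(** Monotonicity in both arguments is what allows a whole block of indices to be dominated through
    its largest radius. *)
Lemma clique_number_mono n m (r s : R) w : (n <= m)%N -> r <= s ->
  (clique_number n N X r w <= clique_number m N X s w)%N.
Proof.
move=> nm rs; have [S [<- HS]] := clique_numberP n r w.
have inj : injective (widen_ord nm) by move=> i j /(congr1 val) /= /val_inj.
rewrite -(card_imset (mem S) inj).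
apply: clique_number_ge => _ _ /imsetP[i iS ->] /imsetP[j jS ->] ij.
apply: le_trans rs; apply: HS => //; apply: contraNneq ij => ->; exact: eqxx.
Qed.

End Cliques.

(** * Probability bounds for the clique number *)

Section GeometricGraph.
Context {R : realType} {d0 : measure_display} {Omega : measurableType d0}.
Variables (P : probability Omega R) (d : nat) (X : nat -> Omega -> 'rV[R]_d).
Variables (N : 'rV[R]_d -> R) (f : 'rV[R]_d -> R) (M : R).
Hypothesis d_gt0 : (0 < d)%N.
Hypothesis HN : is_norm N.
Hypothesis f_ge0 : forall x, 0 <= f x.
Hypothesis f_leM : forall x, f x <= M.
Hypothesis f_meas : forall B : set R, measurable B -> borelRd (f @^-1` B).
Hypothesis X_meas : forall i A, borelRd A -> measurable (X i @^-1` A).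
Hypothesis X_law : forall i, has_density P (X i) f.
Hypothesis X_indep : mutually_independent P X.

Let X_ident i A : borelRd A -> P (X i @^-1` A) = P (X 0%N @^-1` A).
Proof. by move=> mA; rewrite !(X_law _ mA). Qed.

Lemma density_integral_pos : (0 < iint (fun x => (f x)%:E))%E.
Proof.
have mT : borelRd [set: 'rV[R]_d] := @measurableT _ (Rd R d).
have := X_law 0%N mT; rewrite preimage_setT probability_setT.
rewrite (@eq_iint _ _ (fun x => (\1_setT x * f x)%:E) (fun x => (f x)%:E)) => [<-//|x].
by rewrite indicT mul1r.
Qed.

Lemma sigma_gt0 : 0 < ess_sigma f.
Proof.
have [mu Hmu] := iint_represented R d.
exact: (ess_sigma_gt0 Hmu f_ge0 f_leM f_meas density_integral_pos).
Qed.

Let probE' A : borelRd A -> (prob P X A)%:E = iint (fun x => (\1_A x * f x)%:E).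
Proof. by move=> mA; rewrite -(probE X_meas X_ident 0 mA) (X_law _ mA). Qed.

(** The factor [a > 1] puts the level strictly above the essential supremum, as [density_le]
    requires. *)
Lemma prob_le (mu : {sigma_finite_measure set (Rd R d) -> \bar R}) (Hmu : represents_iint mu)
    (a v : R) A : 1 < a -> borelRd A -> (mu A <= v%:E)%E ->
  prob P X A <= a * ess_sigma f * v.
Proof.
move=> a1 mA Av; have s0 := sigma_gt0.
have a0 : 0 < a * ess_sigma f by rewrite mulr_gt0// (lt_trans ltr01).
rewrite -lee_fin probE'//.
apply: le_trans (density_le Hmu f_ge0 f_leM f_meas a0 _ mA) _.
  by rewrite ltr_pMl.
by rewrite [leRHS]EFinM; apply: lee_wpmul2l => //; rewrite lee_fin ltW.
Qed.

Definition region (e : R) (c : 'rV[int]_d) (S : seq 'rV[int]_d) : set 'rV[R]_d :=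
  [set x | cix e x - c \in S].

Lemma region_map e c S x : (region e c S x) <-> (cix e x \in map (fun z => z + c) S).
Proof.
rewrite /region /=; split; first by move=> H; apply/mapP; exists (cix e x - c); rewrite ?subrK.
by move=> /mapP[z zS ->]; rewrite addrK.
Qed.

Lemma region_borel e c S : 0 < e -> borelRd (region e c S).
Proof. by move=> e0; exact: (measurable_cell [set z | z - c \in S]). Qed.

Lemma region_measure (mu : {sigma_finite_measure set (Rd R d) -> \bar R}) (Hmu : represents_iint mu)
  e c S : 0 < e -> uniq S -> mu (region e c S) = ((size S)%:R * e ^+ d)%:E.
Proof.
move=> e0 uS.
have -> : region e c S = [set x | cix e x \in map (fun z => z + c) S].
  by apply/seteqP; split => x /region_map.
rewrite (measure_cells Hmu e0 _).2 ?size_map// map_inj_uniq//; exact: addIr.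
Qed.

Definition shifted_cell (e : R) (c s : 'rV[int]_d) : set Omega :=
  [set w | cix e (X 0%N w) - s = c].

(** For fixed [s] the events [shifted_cell e c s] partition the space as [c] varies, so the right
    side summed over all [c] is the number of cells of [S]. *)
Lemma region_prob_le e c S : 0 < e ->
  (P (X 0%N @^-1` region e c S) <= \sum_(s <- S) P (shifted_cell e c s))%E.
Proof.
move=> e0; elim: S => [|s S IH].
  by rewrite big_nil (_ : _ @^-1` _ = set0) ?measure0// -subset0 => w.
have m1 : measurable (shifted_cell e c s).
  by apply: (X_meas 0 (A := [set x | cix e x - s = c])); exact: (measurable_cell [set z | z - s = c]).
have m2 : measurable (X 0%N @^-1` region e c S) by apply: X_meas; exact: region_borel.
rewrite big_cons; apply: le_trans (leeD2l _ IH).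
apply: le_trans (measureU2 P m1 m2); apply: le_measure; rewrite ?inE.
- by apply: X_meas; exact: region_borel.
- exact: measurableU.
move=> w; rewrite /= /region /= in_cons => /orP[/eqP H|]; [left|by right].
by rewrite /shifted_cell /= -H opprB addrC subrK.
Qed.

Lemma measure_bigsetU_le (I : finType) (F : I -> set Omega) :
  (forall i, measurable (F i)) -> (P (\big[setU/set0]_i F i) <= \sum_i P (F i))%E.
Proof.
move=> mF.
suff [] : measurable (\big[setU/set0]_i F i) /\ (P (\big[setU/set0]_i F i) <= \sum_i P (F i))%E by [].
elim/big_rec2: _ => [|i e S _ [mS IH]]; first by rewrite measure0.
split; first exact: measurableU.
by apply: le_trans (measureU2 _ _ _) _ => //; rewrite leeD2l.
Qed.

(** The quotient of [(1 + p * y) ^+ n - 1] by [p] is a geometric sum, increasing in [p]. The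
    resulting bound is linear in [p], hence summable over infinitely many translates. *)
Lemma power_convex (p pm y : R) n : 0 <= p -> p <= pm -> 0 < pm -> 0 <= y ->
  (1 + p * y) ^+ n - 1 <= p / pm * expR (n%:R * (pm * y)).
Proof.
move=> p0 ppm pm0 y0.
have e1 : (1 + pm * y) ^+ n - 1 <= expR (n%:R * (pm * y)).
  rewrite expRM_natl lerBlDr; apply: (@le_trans _ _ (expR (pm * y) ^+ n)); last by rewrite lerDl.
  by rewrite lerXn2r ?nnegrE ?expR_ge0 ?expR_ge1Dx// addr_ge0// mulr_ge0// ltW.
apply: le_trans (ler_wpM2l _ e1); last by rewrite divr_ge0// ltW.
have E q : (1 + q * y) ^+ n - 1 = q * (y * \sum_(i < n) (1 + q * y) ^+ i).
  by rewrite subrX1 addrAC subrr add0r mulrA.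
rewrite !E [leRHS]mulrA divfK ?gt_eqF//; do 2 apply: ler_wpM2l => //.
apply: ler_sum => i _; apply: lerXn2r; rewrite ?nnegrE ?addr_ge0 ?mulr_ge0//; first exact: ltW.
by rewrite lerD2l ler_wpM2r.
Qed.

(** Each translate of a shape costs a multiple of its own probability, and for one shape these
    probabilities sum to at most its number of cells. This gives the prefactor [C / pm], where [C]
    counts shapes and cells and does not depend on [r], [n], [k] or [b]. *)
Lemma clique_upper_bound (eps : R) : 0 < eps ->
  exists2 C : R, 0 < C & forall (r : R) n k (b : R), 0 < r -> (0 < k)%N -> 1 <= b -> 1 < b ^+ k ->
  let pm := (1 + eps) * ess_sigma f * vB N * (r / 2) ^+ d in
  exists2 E, measurable E & (forall w, (k <= clique_number n N X r w)%N -> E w) /\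
    (P E <= (C / pm * expR (n%:R * (pm * (b - 1))) / (b ^+ k - 1))%:E)%E.
Proof.
move=> eps0.
have [mu Hmu] := iint_represented R d.
have K0 := normK_gt0 HN; have s0 := sigma_gt0; have v0 := vB_gt0 HN Hmu.
(* The slack [1 + eps = a * a] is shared: one factor for the isodiametric inequality, one for the
   level of the density. *)
pose a := Num.sqrt (1 + eps).
have aE : a * a = 1 + eps by rewrite -expr2 sqr_sqrtr// addr_ge0// ltW.
have a1 : 1 < a by rewrite -[1]sqrtr1 ltr_sqrt ?ltrDl ?addr_gt0.
have a10 : 0 < a - 1 by rewrite subr_gt0.
have [e e0 He] := isodiametric_small d_gt0 HN Hmu a10.
have {He} He S uS HS := He S uS HS.
have [D uD HD] := norm_bounded_zrows HN (1 + e * normK N) e0.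
pose sz := size D.
pose adm (m : sz.-tuple bool) := `[< forall z z', z \in mask m D -> z' \in mask m D -> N (e *: zrow R (z - z')) <= 1 + e * normK N >].
exists ((2 ^ sz * sz)%N%:R + 1); first by rewrite ltr_wpDl.
move=> r n k b r0 k0 b1 bk pm.
have pm0 : 0 < pm by rewrite !mulr_gt0 ?exprn_gt0 ?divr_gt0// addr_gt0.
have er0 : 0 < e * r by rewrite mulr_gt0.
pose Reg c (m : sz.-tuple bool) := region (e * r) c (mask m D).
have mReg c m : borelRd (Reg c m) by exact: region_borel.
have uM (m : sz.-tuple bool) : uniq (mask m D) by exact: mask_uniq.
have pReg c m : adm m -> prob P X (Reg c m) <= pm.
  move=> /asboolP Hm.
  have H1 := He _ (uM m) Hm.
  apply: le_trans (_ : a * ess_sigma f * (a * vB N * (r / 2) ^+ d) <= _); last first.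
    by rewrite /pm -aE le_eqVlt; apply/orP; left; apply/eqP; ring.
  apply: (prob_le Hmu a1 (mReg c m)); rewrite /Reg (region_measure Hmu _ er0 (uM m)) lee_fin.
  rewrite addrCA subrr addr0 in H1.
  have -> : (e * r) ^+ d = (2 * e) ^+ d * (r / 2) ^+ d by rewrite -exprMn; congr (_ ^+ _); field.
  by rewrite mulrA ler_wpM2r// exprn_ge0// divr_ge0// ltW.
pose Q := expR (n%:R * (pm * (b - 1))) / (b ^+ k - 1) / pm.
have Q0 : 0 <= Q by rewrite !divr_ge0 ?expR_ge0 ?subr_ge0 ?(ltW bk)// ltW.
(* Relative to the cell of one of its points, a clique occupies one of finitely
   many shapes of cells (the masks of [D]), whatever [n] and [r] are. *)
have /choice[Ev HEv] : forall cm : 'rV[int]_d * sz.-tuple bool, exists E,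
    [/\ measurable E, (adm cm.2 -> forall w, (k <= cnt X n (Reg cm.1 cm.2) w)%N -> E w) &
       (P E <= Q%:E * \sum_(s <- mask cm.2 D) P (shifted_cell (e * r) cm.1 s))%E].
  move=> [c m] /=.
  have [am|nam] := boolP (adm m); last first.
    exists set0; split; [exact: measurable0|by []|].
    by rewrite measure0 mule_ge0// sume_ge0.
  have [E mE [EF PE]] := upper_tail X_meas X_indep X_ident n (mReg c m) b1 bk.
  exists E; split => //; apply: le_trans PE _.
  apply: le_trans (_ : (Q * prob P X (Reg c m))%:E <= _)%E.
    rewrite lee_fin.
    have := power_convex n (prob_ge0 P X _) (pReg c m am) pm0 (_ : 0 <= b - 1).
    rewrite subr_ge0 => /(_ b1) H.
    rewrite ler_pdivrMr ?subr_gt0//; apply: le_trans H _; rewrite /Q le_eqVlt; apply/orP; left; apply/eqP.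
    by field; rewrite !gt_eqF ?subr_gt0.
  rewrite EFinM lee_wpmul2l ?lee_fin// -(probE X_meas X_ident 0 (mReg c m)).
  exact: region_prob_le.
pose F i : set Omega := if @pickle_inv 'rV[int]_d i is Some c then \big[setU/set0]_(m : sz.-tuple bool) Ev (c, m) else set0.
have mEv cm : measurable (Ev cm) by case: (HEv cm).
have mF i : measurable (F i).
  by rewrite /F; case: pickle_inv => // c; apply: bigsetU_measurable.
exists (\bigcup_i F i); first exact: bigcup_measurable.
split.
  move=> w kw.
  have [S [cardS HS]] := clique_numberP N X n r w.
  have [l0 l0S] : exists l0, l0 \in S.
    by apply/finset.set0Pn; rewrite -finset.card_gt0 cardS; exact: leq_trans kw.
  pose c := cix (e * r) (X l0 w).
  exists (pickle c) => //; rewrite /F pickleK_inv.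
  pose p z := [exists l in S, cix (e * r) (X l w) - c == z].
  pose m : sz.-tuple bool := map_tuple p (in_tuple D).
  have maskE : mask m D = [seq z <- D | p z] by rewrite filter_mask.
  have key l l' : l \in S -> l' \in S ->
      N (e *: zrow R (cix (e * r) (X l w) - cix (e * r) (X l' w))) <= 1 + e * normK N.
    move=> lS l'S; rewrite -(ler_pM2l r0).
    have Nll : N (X l w - X l' w) <= r.
      have [->|ll'] := eqVneq l l'; last exact: HS.
      by rewrite subrr norm_zero// ltW.
    have := close_points_cells HN er0 Nll.
    rewrite [e * r]mulrC -scalerA norm_scale// gtr0_norm//.
    by rewrite [r * (1 + _)]mulrDr mulr1 mulrA.
  have adm_m : adm m.
    apply/asboolP => z z'; rewrite maskE !mem_filter => /andP[/exists_inP[l lS /eqP <-] _] /andP[/exists_inP[l' l'S /eqP <-] _].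
    by rewrite opprB addrA subrK; exact: key.
  rewrite (bigD1 m)//=; left.
  have [_ EF _] := HEv (c, m); apply: (EF adm_m) => /=.
  apply: leq_trans kw _; rewrite -cardS -sum1_card /cnt [leqLHS]big_mkcond /=.
  apply: leq_sum => l _; case: ifP => // lS; rewrite lt0b inE /Reg /region /=.
  rewrite maskE mem_filter; apply/andP; split; first by apply/exists_inP; exists l.
  by apply/HD; exact: key.
apply: le_trans (_ : (\sum_(0 <= i <oo) P (F i) <= _)%E).
  by apply: measure_sigma_subadditive => //; exact: bigcup_measurable.
pose B (s : 'rV[int]_d) i : set Omega := [set: Omega] `&` [set w | pickle (cix (e * r) (X 0%N w) - s) = i].
apply: le_trans (_ : (\sum_(0 <= i <oo) (\sum_(m : sz.-tuple bool) \sum_(s <- mask m D) Q%:E * P (B s i)) <= _)%E).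
  apply: lee_nneseries => [i _ _|i _]; first exact: measure_ge0.
  rewrite /F; case E : (@pickle_inv 'rV[int]_d i) => [c|]; last first.
    by rewrite measure0; apply: sume_ge0 => m _; apply: sume_ge0 => s _; rewrite mule_ge0.
  apply: le_trans (_ : (\sum_m P (Ev (c, m)) <= _)%E).
    exact: measure_bigsetU_le.
  apply: lee_sum => m _; have [_ _] := HEv (c, m) => /= /le_trans; apply.
  rewrite ge0_sume_distrr//; apply: lee_sum => s _.
  rewrite lee_wpmul2l ?lee_fin// /B setTI.
  rewrite (_ : shifted_cell (e * r) c s = [set w | pickle (cix (e * r) (X 0%N w) - s) = i])//.
  apply/seteqP; split => w /=; have := @pickle_invK 'rV[int]_d i; rewrite E /= => <-; first by move=> ->.
  by move/(pcan_inj pickleK).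
(* For each shift [s] these events partition the space, so the sum over all translates of a shape is
   its number of cells times [Q]. *)
have B1 s : (\sum_(0 <= i <oo) P (B s i) = 1)%E.
  transitivity (P [set: Omega]); last exact: probability_setT.
  apply/esym/(measure_fibers P (c := fun w => cix (e * r) (X 0%N w) - s) measurableT) => c.
  by apply: (X_meas 0 (A := [set x | cix (e * r) x - s = c])); exact: (measurable_cell [set z | z - s = c]).
rewrite nneseries_sum; last by move=> m i _; apply: sume_ge0 => s _; rewrite mule_ge0.
apply: le_trans (_ : (\sum_(m : sz.-tuple bool) (Q * sz%:R)%:E <= _)%E).
  apply: lee_sum => m _.
  rewrite nneseries_sum; last by move=> s i _; rewrite mule_ge0.
  rewrite (eq_bigr (fun=> Q%:E)); last first.
    by move=> s _; rewrite nneseriesZl// B1 mule1.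
  rewrite sumEFin lee_fin big_const_seq count_predT iter_addr_0 -[Q *+ _]mulr_natr ler_wpM2l//.
  by rewrite ler_nat size_subseq// mask_subseq.
rewrite sumEFin lee_fin sumr_const card_tuple card_bool -[(Q * sz%:R) *+ _]mulr_natr.
have -> : ((2 ^ sz * sz)%N%:R + 1) / pm * expR (n%:R * (pm * (b - 1))) / (b ^+ k - 1) = Q * ((2 ^ sz * sz)%N%:R + 1).
  by rewrite /Q; field; rewrite !gt_eqF ?subr_gt0.
by rewrite -mulrA -natrM [(sz * _)%N]mulnC ler_wpM2l// lerDl.
Qed.



Lemma measure_finite_union (m : {measure set (Rd R d) -> \bar R}) (I : finType) (W : I -> set (Rd R d)) :
  (forall i, measurable (W i)) -> (forall i j x, W i x -> W j x -> i = j) ->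
  m (\bigcup_(i in [set: I]) W i) = (\sum_i m (W i))%E.
Proof.
move=> mW dW.
rewrite measure_fin_bigcup//; last 2 first.
- exact: finite_finset.
- by move=> i j _ _ [x [Wi Wj]]; exact: dW Wi Wj.
have -> : [set: I] = [set` index_enum I] by apply/seteqP; split => // i _ /=; exact: mem_index_enum.
by rewrite -fsbig_seq ?index_enum_uniq.
Qed.

(** After division by [rho] and translation by the corner, the region consists of inner cells and so
    lies in the unit ball. *)
Lemma inner_region_diam (e rho : R) (t : 'rV[int]_d) (s : seq 'rV[int]_d) x y :
  0 < e -> 0 < rho -> (forall z, z \in s -> inner_cells N e z) ->
  region (e * rho) t s x -> region (e * rho) t s y -> N (x - y) <= 2 * rho.
Proof.
move=> e0 rho0 Hs.
have key u : region (e * rho) t s u -> N (rho^-1 *: u - e *: zrow R t) < 1.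
  move=> /Hs; apply; apply/rowP => i; rewrite !mxE.
  have -> : (rho^-1 * u ord0 i - e * (t ord0 i)%:~R) / e = u ord0 i / (e * rho) + (- t ord0 i)%:~R.
    by rewrite intrN; field; rewrite !gt_eqF.
  by rewrite floorDrz ?intr_int// intrKfloor.
move=> /key xs /key ys.
have : N (rho^-1 *: (x - y)) < 2.
  have -> : rho^-1 *: (x - y) = (rho^-1 *: x - e *: zrow R t) - (rho^-1 *: y - e *: zrow R t).
    by apply/rowP => i; rewrite !mxE; ring.
  apply: le_lt_trans (norm_triangle HN _ _) _; rewrite norm_opp//.
  exact: ltrD.
by rewrite norm_scale// gtr0_norm ?invr_gt0// mulrC ltr_pdivrMr// => /ltW.
Qed.

(** A shape with coordinates of modulus at most [K] fits into a cube of [2K + 1] cells per side, and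
    the shift by [K] centres it there. Copies in different cubes are therefore disjoint. *)
Lemma region_in_block (eta : R) (t : 'rV[int]_d) (s : seq 'rV[int]_d) (K : nat) x :
  0 < eta -> (forall z, z \in s -> forall i, (`|z ord0 i| <= K)%N) ->
  region eta (\row_i (t ord0 i * (K + K).+1%:Z + K%:Z)) s x ->
  cix (eta * (K + K).+1%:R) x = t.
Proof.
move=> eta0 Hs xs.
have m0 : 0 < (K + K).+1%:R :> R by rewrite ltr0n.
apply/(cix_eqP _ _ (mulr_gt0 eta0 m0)) => i.
have /(cix_eqP _ _ eta0)/(_ i) := erefl (cix eta x).
have := Hs _ xs i; rewrite !mxE.
set z := Num.floor _; set ti := t ord0 i => Hz.
have Hz' : ti * (K + K).+1%:Z <= z /\ z + 1 <= (ti + 1) * (K + K).+1%:Z by lia.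
have H1 : ti%:~R * (K + K).+1%:R <= z%:~R :> R.
  by have := Hz'.1; rewrite -(ler_int R) intrM.
have H2 : z%:~R + 1 <= (ti%:~R + 1) * (K + K).+1%:R :> R.
  by have := Hz'.2; rewrite -(ler_int R) intrM !intrD.
move=> /andP[H3 H4].
apply/andP; split.
  apply: le_trans H3; rewrite mulrCA mulrC; by apply: ler_wpM2r; first exact: ltW.
apply: (lt_le_trans H4).
have := ler_wpM2r (ltW eta0) H2; rewrite !mulrDl !mul1r.
rewrite [X in _ -> _ <= X](_ : _ = ti%:~R * (K + K).+1%:R * eta + (K + K).+1%:R * eta); last by ring.
by [].
Qed.

(** Rounding the corner of the cube up to the grid of blocks loses less than one block per
    coordinate; hence room for [T + 1] is required. *)
Lemma block_in_cube (q H : R) (z t : 'rV[int]_d) (T : nat) (u : 'I_d -> 'I_T) x :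
  0 < q -> 0 < H -> (T%:R + 1) * H <= q ->
  (forall i, t ord0 i = Num.ceil ((z ord0 i)%:~R * q / H) + (u i)%:Z) ->
  cix H x = t -> cix q x = z.
Proof.
move=> q0 H0 TH Ht /(cix_eqP _ _ H0) Hx; apply/(cix_eqP _ _ q0) => i.
have := Hx i; rewrite Ht intrD.
set a := (z ord0 i)%:~R * q.
have /andP[c1 c2] := ceil_itv (a / H).
have aE : a = a / H * H by rewrite divfK ?gt_eqF.
set c := Num.ceil (a / H) in c1 c2 *.
have cc1 : a <= c%:~R * H by rewrite -ler_pdivrMr.
have cc2 : c%:~R * H < a + H.
  by rewrite -ltr_pdivlMr// mulrDl divff ?gt_eqF// -ltrBlDr -(intrB R c 1).
have u0 : 0 <= (u i)%:~R * H by rewrite mulr_ge0// ltW.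
have u1 : ((u i)%:~R + 1) * H <= T%:R * H.
  by apply: ler_wpM2r; [exact: ltW|rewrite -[(u i)%:~R]/((u i)%:R) natr1 ler_nat].
move: TH u1; rewrite !mulrDl !mul1r => TH u1 /andP[H1 H2]; apply/andP; split; lra.
Qed.

Lemma half_power_count (x T : R) : 0 <= x -> x / 2 <= T -> x ^+ d / 2 ^+ d <= T ^+ d.
Proof.
by move=> x0 xT; rewrite -expr_div_n lerXn2r ?nnegrE ?divr_ge0// (le_trans _ xT)// divr_ge0.
Qed.

(** A dyadic cube almost filled by [{f > s'}] is cut into blocks, each holding a shape that
    approximates the ball of radius [r / 2] from inside. By averaging, a positive proportion of the
    blocks is almost filled too, and there the shape has nearly the maximal probability. The cube is
    fixed before [r], so the blocks number about [1 / r ^+ d]. *)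
Lemma clique_cells (eps : R) : 0 < eps < 1 -> exists c r0 : R, [/\ 0 < c, 0 < r0 &
  forall r, 0 < r -> r < r0 -> exists m (W : 'I_m -> set 'rV[R]_d),
  [/\ c / r ^+ d <= m%:R, forall i, borelRd (W i), forall i j x, W i x -> W j x -> i = j,
      forall i x y, W i x -> W i y -> N (x - y) <= r &
      forall i, (1 - eps) * (ess_sigma f * vB N * (r / 2) ^+ d) <= prob P X (W i)
                 <= (1 + eps) * (ess_sigma f * vB N * (r / 2) ^+ d)]].
Proof.
move=> /andP[eps0 eps1].
have [mu Hmu] := iint_represented R d.
have K0 := normK_gt0 HN; have s0 := sigma_gt0; have v0 := vB_gt0 HN Hmu.
(* Three factors [1 - eps'] are lost: in the level [s'], in the part of a shape outside [A], and in
   the inner approximation of the ball. *)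
pose eps' := eps / 3.
have e'01 : 0 < eps' < 1 by apply/andP; split; rewrite /eps'; lra.
have /andP[e'0 e'1] := e'01.
have [e [s [e0 us Hs lo hi]]] := inner_approx d_gt0 HN Hmu e'01.
have ssz : 0 < (size s)%:R :> R.
  have : 0 < (size s)%:R * e ^+ d by apply: lt_le_trans lo; rewrite mulr_gt0// subr_gt0.
  by rewrite pmulr_lgt0// exprn_gt0.
pose K := (\max_(z <- s) \max_i `|z ord0 i|)%N.
have HK z : z \in s -> forall i, (`|z ord0 i| <= K)%N.
  move=> zs i; apply: leq_trans (@leq_bigmax_seq _ _ xpredT (fun z : 'rV[int]_d => \max_i `|z ord0 i|)%N z zs isT).
  exact: (leq_bigmax (F := fun i => `|z ord0 i|%N)).
pose m0 : R := (K + K).+1%:R.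
have m00 : 0 < m0 by rewrite ltr0n.
(* [eps3 * H ^+ d] will be the share [eps'] of the measure of one shape, which is what a good block
   may have outside [A]. Dividing by [2 ^+ d.+1] then makes the bad blocks at most half of the
   guaranteed [(q / H / 2) ^+ d]. *)
pose eps3 := eps' * (size s)%:R / m0 ^+ d.
have e30 : 0 < eps3 by rewrite divr_gt0 ?mulr_gt0// exprn_gt0.
pose eps2 := eps3 / 2 ^+ d.+1.
have e20 : 0 < eps2 by rewrite divr_gt0// exprn_gt0.
pose s' := (1 - eps') * ess_sigma f.
have s'0 : 0 < s' by rewrite mulr_gt0// subr_gt0.
have s'1 : s' < ess_sigma f by rewrite gtr_pMl// ltrBlDr ltrDl.
pose A : set (Rd R d) := [set x | s' < f x].
have mA : measurable A.
  have := f_meas (measurable_itv `]s', +oo[); congr (borelRd _).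
  by apply/seteqP; split => x /=; rewrite in_itv /= andbT.
have A0 := ess_sigma_pos Hmu f_ge0 f_leM f_meas density_integral_pos s'1.
have [j [z0 Hj]] := dense_cube Hmu mA e20 A0.
set q : R := 2 ^- j in Hj.
have q0 : 0 < q by rewrite invr_gt0 exprn_gt0.
rewrite (measure_cell Hmu _ q0) -EFinM in Hj.
exists ((2 * q / (e * m0)) ^+ d / 2 ^+ d.+1), (q / (2 * e * m0)); split.
- by rewrite divr_gt0 ?exprn_gt0// divr_gt0 ?mulr_gt0.
- by rewrite divr_gt0 ?mulr_gt0.
move=> r r0 rr0.
have rho0 : 0 < r / 2 by rewrite divr_gt0.
pose eta := e * (r / 2).
have eta0 : 0 < eta by rewrite mulr_gt0.
pose H := eta * m0.
have H0 : 0 < H by rewrite mulr_gt0.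
(* This makes [T], which is one less than the integer part of [q / H], at least half of [q / H]. *)
have qH4 : 4 <= q / H.
  move: rr0; rewrite ltr_pdivlMr ?mulr_gt0// => rr0.
  by rewrite ler_pdivlMr// /H /eta; apply: ltW; apply: le_lt_trans rr0; rewrite le_eqVlt; apply/orP; left; apply/eqP; field.
pose T := (Num.trunc (q / H)).-1.
have [T1 T2] : (T%:R + 1) * H <= q /\ q / H / 2 <= T%:R.
  have qH0 : 0 <= q / H by apply: le_trans qH4.
  have /andP[t1 t2] := truncn_itv qH0.
  have tr0 : (0 < Num.trunc (q / H))%N by rewrite truncn_gt0; apply: le_trans qH4; rewrite ler1n.
  have TE : T%:R + 1 = (Num.trunc (q / H))%:R :> R by rewrite natr1 /T prednK.
  split; first by rewrite TE -ler_pdivlMr.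
  by move: t2; rewrite -natr1 -TE; lra.
pose U := {ffun 'I_d -> 'I_T}.
pose t (u : U) : 'rV[int]_d := \row_i (Num.ceil ((z0 ord0 i)%:~R * q / H) + (u i)%:Z).
pose block (u : U) : set (Rd R d) := [set x | cix H x = t u].
pose W (u : U) : set (Rd R d) := region eta (\row_i (t u ord0 i * (K + K).+1%:Z + K%:Z)) s.
have mblock u : measurable (block u) by exact: (measurable_cell [set t u]).
have mW u : measurable (W u) by exact: region_borel.
have t_inj : injective t.
  move=> u v /rowP E; apply/ffunP => i; have := E i; rewrite !mxE => /addrI [].
  exact: val_inj.
have Wblock u : W u `<=` block u by move=> x /(region_in_block eta0 HK).
have blockQ u : block u `<=` [set x | cix q x = z0].
  by move=> x; apply: (block_in_cube q0 H0 T1) => i; rewrite mxE.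
have block_disj u v x : block u x -> block v x -> u = v.
  by rewrite /block /= => Hu Hv; apply: t_inj; rewrite -Hu -Hv.
pose G := [set u : U | (mu (block u `\` A) <= (eps3 * H ^+ d)%:E)%E].
pose Gs : {set U} := finset.finset (fun u => `[< G u >]).
have count : (2 * q / (e * m0)) ^+ d / 2 ^+ d.+1 / r ^+ d <= #|Gs|%:R.
  have sumbad : (\sum_(u : U) mu (block u `\` A) <= (eps2 * q ^+ d)%:E)%E.
    rewrite -measure_finite_union; last 2 first.
    - by move=> u; exact: measurableD.
    - by move=> u v x [ux _] [vx _]; exact: block_disj ux vx.
    apply: ltW; apply: le_lt_trans Hj; apply: le_measure; rewrite ?inE.
    - by apply: countable_bigcupT_measurable => [|u]; [exact: countableP|exact: measurableD].
    - by apply: measurableD => //; exact: (measurable_cell [set z0]).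
    - by move=> x [u _ [xu nA]]; split => //; exact: blockQ xu.
  have bad : #|finset.setC Gs|%:R * (eps3 * H ^+ d) <= eps2 * q ^+ d.
    rewrite -lee_fin; apply: le_trans sumbad.
    rewrite (bigID (fun u => u \in Gs)) /=.
    apply: le_trans (_ : (\sum_(u | u \notin Gs) (eps3 * H ^+ d)%:E <= _)%E).
      rewrite sumEFin lee_fin sumr_const -[(eps3 * H ^+ d) *+ _]mulr_natl ler_wpM2r//.
        by rewrite mulr_ge0 ?exprn_ge0// ltW.
      by rewrite ler_nat eq_leq//; apply: eq_card => u; rewrite finset.inE.
    rewrite -[leLHS]add0e; apply: leeD; first by apply: sume_ge0.
    apply: lee_sum => u; rewrite finset.inE => /asboolPn; rewrite /G /= => /negP.
    by rewrite -ltNge => /ltW.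
  have tot : #|Gs|%:R + #|finset.setC Gs|%:R = T%:R ^+ d :> R.
    by rewrite -natrD finset.cardsC card_ffun !card_ord natrX.
  have x0 : 0 <= q / H by apply: le_trans qH4.
  have := half_power_count x0 T2.
  have Hd : 0 < H ^+ d by rewrite exprn_gt0.
  have bad' : #|finset.setC Gs|%:R <= (q / H) ^+ d / 2 ^+ d.+1.
    have e3H : 0 < eps3 * H ^+ d by exact: mulr_gt0.
    rewrite expr_div_n; move: bad; rewrite -(ler_pdivlMr _ _ e3H) => /le_trans; apply.
    rewrite le_eqVlt; apply/orP; left; apply/eqP; rewrite /eps2.
    by field; rewrite !gt_eqF// exprn_gt0.
  have -> : (2 * q / (e * m0)) ^+ d / 2 ^+ d.+1 / r ^+ d = (q / H) ^+ d / 2 ^+ d.+1.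
    rewrite mulrAC -expr_div_n; congr (_ ^+ _ / _); rewrite /H /eta.
    by field; rewrite !gt_eqF.
  have two : (q / H) ^+ d / 2 ^+ d = (q / H) ^+ d / 2 ^+ d.+1 + (q / H) ^+ d / 2 ^+ d.+1.
    by rewrite [2 ^+ d.+1]exprS; field; rewrite expf_neq0.
  by rewrite two -tot; lra.
exists #|Gs|, (fun i => W (enum_val i)); split => //.
- by move=> i; exact: mW.
- by move=> i k x /Wblock xi /Wblock xk; apply: enum_val_inj; exact: block_disj xi xk.
- move=> i x y Wx Wy.
  have := inner_region_diam e0 rho0 Hs Wx Wy.
  by rewrite mulrCA divff ?mulr1.
move=> i; set u := enum_val i.
have /asboolP Gu : `[< G u >] by have := enum_valP i; rewrite finset.inE.
have muW : mu (W u) = ((size s)%:R * eta ^+ d)%:E by exact: region_measure.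
have sized : (size s)%:R * eta ^+ d = (size s)%:R * e ^+ d * (r / 2) ^+ d by rewrite exprMn mulrA.
have rd0 : 0 < (r / 2) ^+ d by rewrite exprn_gt0.
apply/andP; split; last first.
  apply: le_trans (_ : (1 + eps) * ess_sigma f * (vB N * (r / 2) ^+ d) <= _); last first.
    by rewrite le_eqVlt; apply/orP; left; apply/eqP; ring.
  apply: (prob_le Hmu _ (mW u)); first by rewrite ltrDl.
  by rewrite muW lee_fin sized; apply: ler_wpM2r; first exact: ltW.
have eps3H : eps3 * H ^+ d = eps' * ((size s)%:R * eta ^+ d).
  by rewrite /eps3 /H exprMn; field; rewrite expf_neq0// gt_eqF.
have muWA : (((1 - eps') * ((size s)%:R * eta ^+ d))%:E <= mu (W u `&` A))%E.
  have E : mu (W u) = (mu (W u `\` A) + mu (W u `&` A))%E by rewrite -measureDI.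
  have le1 : (mu (W u `\` A) <= (eps' * ((size s)%:R * eta ^+ d))%:E)%E.
    rewrite -eps3H; apply: le_trans Gu; apply: le_measure; rewrite ?inE.
    - exact: measurableD.
    - exact: measurableD.
    - by move=> x [/Wblock].
  have : ((size s)%:R * eta ^+ d)%:E = (((1 - eps') * ((size s)%:R * eta ^+ d))%:E + (eps' * ((size s)%:R * eta ^+ d))%:E)%E.
    by rewrite -EFinD; congr (_%:E); ring.
  rewrite -muW E addeC => E2.
  have fin1 : (eps' * ((size s)%:R * eta ^+ d))%:E \is a fin_num by [].
  rewrite -(leeD2rE _ _ fin1) -E2; exact: leeD2l.
rewrite -lee_fin probE'; last exact: mW.
apply: le_trans (density_ge Hmu f_ge0 f_meas (ltW s'0) (mW u)).
apply: le_trans (_ : s'%:E * ((1 - eps') * ((size s)%:R * eta ^+ d))%:E <= _)%E; last first.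
  by apply: lee_wpmul2l => //; rewrite lee_fin ltW.
rewrite -EFinM lee_fin sized /s'.
apply: le_trans (_ : (1 - eps') * ess_sigma f * ((1 - eps') * ((1 - eps') * vB N * (r / 2) ^+ d)) <= _).
  rewrite (_ : (1 - eps') * ess_sigma f * ((1 - eps') * ((1 - eps') * vB N * (r / 2) ^+ d)) =
     (1 - eps') ^+ 3 * (ess_sigma f * vB N * (r / 2) ^+ d)); last by ring.
  apply: ler_wpM2r; first by rewrite !mulr_ge0// ltW.
  have -> : 1 - eps = 1 - 3 * eps' by rewrite /eps'; field.
  by rewrite !exprS expr0; nra.
apply: ler_wpM2l; first by rewrite mulr_ge0// ?subr_ge0 ltW.
apply: ler_wpM2l; first by rewrite subr_ge0 ltW.
by apply: ler_wpM2r; first exact: ltW.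
Qed.

End GeometricGraph.

(** * Borel-Cantelli along blocks *)

Section BorelCantelli.
Context {R : realType} {d0 : measure_display} {Omega : measurableType d0}.
Variable P : probability Omega R.

Lemma sum_inv_sqr (n : nat) : \sum_(0 <= i < n) (i.+1%:R ^- 2) <= 2 :> R.
Proof.
case: n => [|n]; first by rewrite big_geq.
suff : \sum_(0 <= i < n.+1) (i.+1%:R ^- 2) <= 2 - n.+1%:R^-1 :> R.
  by move=> /le_trans; apply; rewrite gerBl invr_ge0.
elim: n => [|n IH]; first by rewrite big_nat1 expr1n invr1; lra.
rewrite big_nat_recr//=; apply: le_trans (lerD IH (lexx _)) _.
set a := n.+1%:R : R; have a0 : 0 < a by rewrite ltr0n.
have -> : n.+2%:R = a + 1 :> R by rewrite /a natr1.
rewrite -subr_ge0.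
have -> : 2 - (a + 1)^-1 - (2 - a^-1 + (a + 1) ^- 2) = a^-1 * (a + 1) ^- 2.
  by field; rewrite !gt_eqF// addr_gt0.
by rewrite mulr_ge0// invr_ge0 ?exprn_ge0 ?addr_ge0// ltW.
Qed.

(** The events need not be measurable, and covers are given only eventually: the sequence is shifted
    by [N0], which can only improve the summable bound. *)
Lemma borel_cantelli_cover (S : nat -> set Omega) (C : R) :
  (\forall n \near \oo, exists2 E, measurable E &
     S n `<=` E /\ (P E <= (C * n.+1%:R ^- 2)%:E)%E) ->
  {ae P, forall w, \forall n \near \oo, ~ S n w}.
Proof.
move=> [N0 _ H].
have /choice[E HE] : forall n, exists E, [/\ measurable E, S (n + N0)%N `<=` E & (P E <= (`|C| * n.+1%:R ^- 2)%:E)%E].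
  move=> n; have [E mE [SE PE]] := H (n + N0)%N (leq_addl _ _).
  exists E; split => //; apply: le_trans PE _; rewrite lee_fin.
  apply: le_trans (ler_wpM2r _ (ler_norm C)) _; first by rewrite invr_ge0 exprn_ge0.
  apply: ler_wpM2l => //; rewrite lef_pV2 ?posrE ?exprn_gt0 ?ltr0n//.
  by rewrite lerXn2r ?nnegrE// ler_nat ltnS leq_addr.
have mE n : measurable (E n) by case: (HE n).
have sumE : (\sum_(n <oo) P (E n) < +oo)%E.
  apply: le_lt_trans (_ : ((2 * `|C|)%:E < +oo)%E); last exact: ltry.
  apply: lime_le; first by apply: is_cvg_nneseries.
  apply: nearW => n.
  apply: le_trans (_ : (\sum_(0 <= i < n) (`|C| * i.+1%:R ^- 2)%:E <= _)%E).
    by apply: lee_sum => i _; case: (HE i).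
  by rewrite sumEFin lee_fin -mulr_sumr mulrC ler_wpM2r// sum_inv_sqr.
have := lim_sup_set_cvg0 mE sumE => E0.
exists (lim_sup_set E); split => //.
  apply: bigcapT_measurable => n; exact: bigcup_measurable.
move=> w /= nw; apply: contrapT => nE; apply: nw.
have : exists n, ~ (\bigcup_(k >= n) E k) w.
  by apply: contrapT => /forallNP H2; apply: nE => n _; apply: contrapT; exact: H2.
move=> [n Hn]; exists (n + N0)%N => // m /= nm Sm.
have N0m : (N0 <= m)%N by apply: leq_trans nm; exact: leq_addl.
apply: Hn; exists (m - N0)%N => /=; first by rewrite leq_subRL// addnC.
by have [_ SE _] := HE (m - N0)%N; apply: SE; rewrite subnK.
Qed.

Lemma powR_natX (a : R) (n p : nat) : ((n ^ p)%N%:R : R) `^ a = n%:R `^ (p%:R * a).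
Proof. by rewrite natrX -powR_mulrn// -powRrM. Qed.

(** The ratio is [(1 + 1/(j+1))^p], at most [exp (p/(j+1))], which tends to 1. *)
Lemma block_ratio (eta : R) (p : nat) : 0 < eta ->
  \forall j \near \oo, ((j.+2 ^ p)%N%:R : R) <= (1 + eta) * (j.+1 ^ p)%N%:R.
Proof.
move=> eta0; have l0 : 0 < ln (1 + eta) by rewrite ln_gt0// ltrDl.
exists (Num.bound (p%:R / ln (1 + eta))) => // j /= Hj.
have j0 : 0 < j.+1%:R :> R by rewrite ltr0n.
have H : p%:R / j.+1%:R <= ln (1 + eta).
  rewrite ler_pdivrMr// mulrC -ler_pdivrMr//.
  apply: le_trans (ltW (archi_boundP _)) _; first by rewrite divr_ge0// ltW.
  by rewrite ler_nat; exact: leq_trans Hj _.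
rewrite !natrX -ler_pdivrMr ?exprn_gt0// -expr_div_n.
apply: (@le_trans _ _ (expR (p%:R / j.+1%:R))); last first.
  by rewrite -[leRHS](@lnK R) ?posrE ?addr_gt0// ler_expR.
rewrite -[p%:R / _]/(p%:R * _) expRM_natl lerXn2r ?nnegrE ?expR_ge0//.
apply: le_trans (expR_ge1Dx _); rewrite -natr1 mulrDl divff ?gt_eqF// mul1r//.
Qed.

(* Cover the range of [n] by the blocks [(j+1)^p, (j+2)^p).  Inside a block the
   indices with a common value of [k] are all dominated by the one with the
   largest radius, so only [n^(a/2)] events per block are needed although [r]
   is not assumed monotone. *)
Lemma block_borel_cantelli (om : nat -> R -> Omega -> nat)
  (om_mono : forall n m r s w, (n <= m)%N -> r <= s -> (om n r w <= om m s w)%N)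
  (r : nat -> R) (k : nat -> nat) (a eta : R) :
  0 < a -> 0 < eta ->
  (\forall n \near \oo, (k n)%:R <= n%:R `^ (a / 2)) ->
  (\forall n \near \oo, exists2 E, measurable E &
     (forall w m, m%:R <= (1 + eta) * n%:R -> (k n <= om m (r n) w)%N -> E w) /\
     (P E <= (n%:R `^ (- a))%:E)%E) ->
  {ae P, forall w, \forall n \near \oo, (om n (r n) w < k n)%N}.
Proof.
move=> a0 eta0 [N1 _ Hk] [N2 _ HE].
(* Block [j] involves of order [(j+1) ^ (p a / 2)] values of [k], each costing at most
   [(j+1) ^ (- p a)]; with [p a >= 4] the product is of order at most [(j+1) ^ -2]. *)
pose p := (Num.bound (4 / a)).
have p0 : (0 < p)%N by rewrite -(ltr0n R); apply: lt_trans (archi_boundP _); rewrite ?divr_gt0// ?divr_ge0// ltW.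
have pa : 4 <= p%:R * a.
  by rewrite -ler_pdivrMr//; apply/ltW/archi_boundP; rewrite divr_ge0// ltW.
pose q := p%:R * (a / 2).
have q2 : 2 <= q by rewrite /q; lra.
have [N3 _ Hr] := block_ratio p eta0.
pose S j : set Omega := [set w | exists n, [/\ (j.+1 ^ p <= n)%N, (n < j.+2 ^ p)%N & (k n <= om n (r n) w)%N]].
have : {ae P, forall w, \forall j \near \oo, ~ S j w}.
  apply: (@borel_cantelli_cover S (2 `^ q + 1)).
  exists (N1 + N2 + N3)%N => // j /= Hj.
  have jN3 : (N3 <= j)%N by apply: leq_trans Hj; exact: leq_addl.
  have jN12 : (N1 + N2 <= j)%N by apply: leq_trans Hj; exact: leq_addr.
  have jN1 : (N1 <= j)%N by apply: leq_trans jN12; exact: leq_addr.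
  have jN2 : (N2 <= j)%N by apply: leq_trans jN12; exact: leq_addl.
  have jp n : (j.+1 ^ p <= n)%N -> (j < n)%N.
    by apply: leq_trans; rewrite -{1}[j.+1]expn1 leq_pexp2l.
  pose B := (j.+2 ^ p)%N.
  have jq : (j.+2%:R : R) `^ q <= 2 `^ q * j.+1%:R `^ q.
    rewrite -powRM//; apply: ge0_ler_powR; rewrite ?nnegrE//.
    - by apply: le_trans q2.
    by rewrite -natrM ler_nat; lia.
  pose T := Num.trunc ((2 : R) `^ q * j.+1%:R `^ q).
  have T0 : 0 <= (2 : R) `^ q * j.+1%:R `^ q by rewrite mulr_ge0 ?powR_ge0.
  pose cond (x : nat) (n : 'I_B) := (j.+1 ^ p <= n)%N && (k n == x).
  have /choice[E HEx] : forall x : 'I_T.+1, exists E, [/\ measurable E,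
      forall w (n : 'I_B), cond x n -> (k n <= om n (r n) w)%N -> E w &
      (P E <= (j.+1%:R `^ (- (p%:R * a)))%:E)%E].
    move=> x; have [/existsP[n0 c0]|none] := boolP [exists n, cond x n]; last first.
      exists set0; split => //; last by rewrite measure0 lee_fin powR_ge0.
      by move=> w n cn _; move/existsP : none; apply; exists n.
    pose ns := [arg max_(n > n0 | cond x n) r n]%O.
    have [cs Hs] : cond x ns /\ forall n, cond x n -> r n <= r ns.
      by rewrite /ns; case: arg_maxP => //.
    have /andP[ns1 /eqP nsk] := cs.
    have [|E mE [EF PE]] := HE ns.
      exact: leq_trans jN2 (ltnW (jp _ ns1)).
    exists E; split => //.
      move=> w n /[dup] cn /andP[n1 /eqP nk] kn; apply: (EF w n).
        apply: le_trans (_ : (B%:R <= _)); first by rewrite ler_nat ltnW.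
        apply: le_trans (Hr j jN3) _.
        by apply: ler_wpM2l; [rewrite addr_ge0// ltW|rewrite ler_nat].
      rewrite nsk -nk; apply: leq_trans kn _; apply: om_mono => //; exact: Hs.
    apply: le_trans PE _; rewrite lee_fin -mulrN -powR_natX.
    rewrite !powRN lef_pV2 ?posrE ?powR_gt0 ?ltr0n ?expn_gt0//; last by apply: leq_trans ns1; rewrite expn_gt0.
    by apply: ge0_ler_powR; rewrite ?nnegrE ?ler_nat//; exact: ltW.
  have mE x : measurable (E x) by case: (HEx x).
  exists (\big[setU/set0]_x E x); first exact: bigsetU_measurable.
  split.
    move=> w [n [n1 n2 kn]].
    have kT : (k n < T.+1)%N.
      rewrite ltnS -(ler_nat R).
      have : (k n)%:R <= (2 : R) `^ q * j.+1%:R `^ q.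
        apply: le_trans jq; apply: le_trans (Hk n _) _.
          exact: leq_trans jN1 (ltnW (jp _ n1)).
        rewrite /q -powR_natX; apply: ge0_ler_powR; rewrite ?nnegrE//.
          by rewrite divr_ge0// ltW.
        by rewrite ler_nat ltnW.
      by rewrite ler_nat -(truncn_ge_nat _ T0).
    rewrite (bigD1 (Ordinal kT))//=; left.
    by have [_ EF _] := HEx (Ordinal kT); apply: (EF w (Ordinal n2)) => //; rewrite /cond n1 eqxx.
  apply: le_trans (measure_bigsetU_le P mE) _.
  apply: le_trans (_ : (\sum_(x : 'I_T.+1) (j.+1%:R `^ (- (p%:R * a)))%:E <= _)%E).
    by apply: lee_sum => x _; case: (HEx x).
  rewrite sumEFin lee_fin sumr_const card_ord -[_ *+ T.+1]mulr_natl.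
  have j1 : 1 <= j.+1%:R :> R by rewrite ler1n.
  have jq1 : 1 <= (j.+1%:R : R) `^ q by have := ler_powR j1 (le_trans (ler0n R 2) q2); rewrite powRr0.
  have TE : T.+1%:R <= (2 `^ q + 1) * (j.+1%:R : R) `^ q.
    rewrite -natr1 mulrDl mul1r; apply: lerD => //; by rewrite /T truncn_le.
  apply: le_trans (ler_wpM2r (powR_ge0 _ _) TE) _.
  rewrite -mulrA; apply: ler_wpM2l; first by rewrite addr_ge0// powR_ge0.
  rewrite -powRD; last by apply/implyP => _; rewrite pnatr_eq0.
  rewrite -powR_mulrn// -powRN; apply: ler_powR => //.
  by rewrite /q; lra.
move=> [A [mA PA AH]]; exists A; split => // w nw; apply: AH => /= -[J _ HJ]; apply: nw => /=.
exists (J.+1 ^ p)%N => // n /= Jn; rewrite ltnNge; apply/negP => kn.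
have [j [j1 j2]] : exists j, (j.+1 ^ p <= n)%N /\ (n < j.+2 ^ p)%N.
  have ex : exists j, (j.+1 ^ p <= n)%N by exists 0%N; apply: leq_trans Jn; rewrite exp1n expn_gt0.
  have bd j : (j.+1 ^ p <= n)%N -> (j <= n)%N.
    by move=> H; apply: ltnW; apply: leq_trans H; rewrite -{1}[j.+1]expn1 leq_pexp2l.
  case: (ex_maxnP ex bd) => j Hj Hmax; exists j; split => //.
  by rewrite ltnNge; apply/negP => /Hmax; rewrite ltnn.
apply: (HJ j); last by exists n.
rewrite /= leqNgt; apply/negP => jJ.
have jJp : (j.+2 ^ p <= J.+1 ^ p)%N by rewrite leq_exp2r.
by have := leq_trans j2 (leq_trans jJp Jn); rewrite ltnn.
Qed.

End BorelCantelli.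

(** * The entropy function and f_omega *)

Section EntropyFunction.
Variable R : realType.

Lemma Hfun1 : Hfun 1 = 0 :> R.
Proof. by rewrite /Hfun ln1 mulr0 sub0r addNr. Qed.

Lemma ln_ge_1V (x : R) : 0 < x -> 1 - x^-1 <= ln x.
Proof.
move=> x0; rewrite -[x in ln x]invrK lnV ?posrE ?invr_gt0//.
have := @le_ln1Dx R (x^-1 - 1); rewrite addrCA subrr addr0 => H.
by rewrite lerNr opprB H// ltrBrDr addrC subrr invr_gt0.
Qed.

Lemma ln_gt_1V (x : R) : 1 < x -> 1 - x^-1 < ln x.
Proof.
move=> x1; have x0 : 0 < x by apply: lt_trans x1.
have H : ln (x^-1) != 0.
  by rewrite lt_eqF// ln_lt0// invr_gt0 x0 invf_lt1.
have := expR_gt1Dx H; rewrite lnK ?posrE ?invr_gt0// lnV ?posrE//; lra.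
Qed.

(** The increment splits as [(y - x) ln x] plus [y ln (y/x) - (y - x)]; the first is nonnegative for
    [x >= 1], the second is positive because [ln u > 1 - 1/u] for [u > 1]. *)
Lemma Hfun_lt (x y : R) : 1 <= x -> x < y -> Hfun x < Hfun y.
Proof.
move=> x1 xy; have x0 : 0 < x by apply: lt_le_trans x1.
have y0 : 0 < y := lt_trans x0 xy.
rewrite -subr_gt0.
have -> : Hfun y - Hfun x = (y - x) * ln x + (y * ln (y / x) - (y - x)).
  by rewrite /Hfun ln_div ?posrE//; ring.
apply: ltr_wpDl; first by rewrite mulr_ge0 ?ln_ge0// subr_ge0 ltW.
rewrite subr_gt0.
have yx : 1 < y / x by rewrite ltr_pdivlMr// mul1r.
apply: le_lt_trans (_ : y * (1 - (y / x)^-1) < _); last by rewrite ltr_pM2l// ln_gt_1V.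
by rewrite invf_div mulrBr mulr1 mulrCA divff ?mulr1 ?gt_eqF.
Qed.

Lemma Hfun_lt_inv (x y : R) : 1 <= y -> Hfun x < Hfun y -> x < y.
Proof.
move=> y1 H; rewrite ltNge le_eqVlt; apply/negP => /orP[/eqP E|yx].
  by rewrite E ltxx in H.
by have := lt_trans H (Hfun_lt y1 yx); rewrite ltxx.
Qed.

Lemma Hfun_ge0 (x : R) : 1 <= x -> 0 <= Hfun x.
Proof.
rewrite le_eqVlt => /orP[/eqP <-|x1]; first by rewrite Hfun1.
by rewrite -Hfun1 ltW// Hfun_lt.
Qed.

Lemma Hfun_surj (y : R) : 0 <= y -> exists2 x : R, 1 <= x & Hfun x = y.
Proof.
move=> y0.
(* Then [ln b >= 2], so [Hfun b >= b + 1], which exceeds [y]. *)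
pose b := expR 2 + y.
have b1 : 1 <= b by rewrite /b -[1]addr0 lerD// -[1]expR0 ler_expR.
have Hb : y <= Hfun b.
  have b0 : 0 < b by apply: lt_le_trans b1.
  have lb : 2 <= ln b.
    by rewrite -[2 in X in X <= _](@expRK R) ler_ln ?posrE ?expR_gt0// lerDl.
  have : b * 2 <= b * ln b by rewrite ler_pM2l.
  have : y <= b by rewrite lerDr expR_ge0.
  by rewrite /Hfun; lra.
have cH : {within `[1, b], continuous (@Hfun R)}.
  apply: continuous_in_subspaceT => x; rewrite inE /= in_itv /= => /andP[x1 _].
  have x0 : 0 < x by apply: lt_le_trans x1.
  apply: cvgD; last exact: cvg_cst.
  apply: cvgB; last exact: cvg_id.
  by apply: cvgM; [exact: cvg_id|exact: continuous_ln].
have [|c] := IVT b1 cH (v := y).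
  by rewrite Hfun1 ge_min y0/= le_max Hb orbT.
by rewrite in_itv /= => /andP[c1 _] cE; exists c.
Qed.

Variables (d : nat) (v : R).
Hypothesis v_gt0 : 0 < v.

Let c := 2 ^+ d / v.
Let c0 : 0 < c. Proof. by rewrite divr_gt0// exprn_gt0. Qed.

(** The argument of [Hfun] in the equation for [f_omega]. It satisfies [Hfun (xof t) = c / t] with
    [xof t >= 1], and the properties of [f_omega] are read off from the monotonicity of [Hfun]
    beyond 1. *)
Let xof (t : R) := f_omega d v t * 2 ^+ d / v.

Lemma f_omega_exists t : 0 < t -> exists fv, f_omega_pred d v t fv.
Proof.
move=> t0; have [|x x1 xE] := @Hfun_surj (2 ^+ d / (t * v)).
  by rewrite divr_ge0 ?exprn_ge0// mulr_ge0// ltW.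
exists (x * (v / 2 ^+ d)); split.
  by rewrite ler_peMl// divr_ge0 ?exprn_ge0// ltW.
by rewrite -xE; congr Hfun; field; rewrite !gt_eqF// exprn_gt0.
Qed.

Lemma f_omegaP t : 0 < t -> f_omega_pred d v t (f_omega d v t).
Proof. by move=> t0; apply: xgetPex; exact: f_omega_exists. Qed.

Lemma ratio_ge1 fv : v / 2 ^+ d <= fv -> 1 <= fv * 2 ^+ d / v.
Proof. by move=> H; rewrite ler_pdivlMr// mul1r -ler_pdivrMr ?exprn_gt0. Qed.

Lemma xof_ge1 t : 0 < t -> 1 <= xof t.
Proof. by move=> /f_omegaP[H _]; exact: ratio_ge1. Qed.

Lemma Hfun_xof t : 0 < t -> Hfun (xof t) = c / t.
Proof. by move=> t0; have [_ ->] := f_omegaP t0; rewrite /c; field; rewrite !gt_eqF. Qed.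

Lemma f_omega_xof t : f_omega d v t = xof t / c.
Proof. by rewrite /xof /c; field; rewrite !gt_eqF// exprn_gt0. Qed.

Lemma f_omega_uniqueness t : 0 < t -> exists! fv, f_omega_pred d v t fv.
Proof.
move=> t0; exists (f_omega d v t); split; first exact: f_omegaP.
move=> g [g1 g2]; have [f1 f2] := f_omegaP t0.
have g1' := ratio_ge1 g1; have f1' := ratio_ge1 f1.
have E : f_omega d v t * 2 ^+ d / v = g * 2 ^+ d / v.
  apply/eqP; rewrite eq_le !leNgt; apply/andP; split; apply/negP => H.
    by have := Hfun_lt g1' H; rewrite g2 f2 ltxx.
  by have := Hfun_lt f1' H; rewrite g2 f2 ltxx.
have Z : 2 ^+ d / v != 0 by rewrite gt_eqF.
by apply: (mulIf Z); rewrite !mulrA.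
Qed.

Lemma xof_lt s t : 0 < s -> 0 < t -> s < t -> xof t < xof s.
Proof.
move=> s0 t0 st; apply: Hfun_lt_inv; first exact: xof_ge1.
by rewrite !Hfun_xof// ltr_pM2l// ltf_pV2.
Qed.

Lemma f_omega_decreasing : {in `]0, +oo[ &, forall s t, s < t -> f_omega d v t < f_omega d v s}.
Proof.
move=> s t; rewrite !in_itv /= !andbT => s0 t0 st.
by rewrite !f_omega_xof ltr_pM2r ?invr_gt0// xof_lt.
Qed.

Lemma f_omega_gt t : 0 < t -> v / 2 ^+ d < f_omega d v t.
Proof.
move=> t0; rewrite f_omega_xof (_ : v / 2 ^+ d = 1 / c); last by rewrite /c div1r invf_div.
rewrite ltr_pM2r ?invr_gt0//; apply: Hfun_lt_inv; first exact: xof_ge1.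
by rewrite Hfun1 Hfun_xof// divr_gt0.
Qed.

Lemma f_omega_continuous : {in `]0, +oo[, continuous (f_omega d v)}.
Proof.
move=> t; rewrite in_itv /= andbT => t0.
apply/cvgrPdist_lt => e e0.
have ec0 : 0 < e * c by rewrite mulr_gt0.
have x1 := xof_ge1 t0.
have xgt1 : 1 < xof t.
  apply: Hfun_lt_inv => //; by rewrite Hfun1 Hfun_xof// divr_gt0.
(* The maximum with 1 keeps [lo] in the range where [Hfun] is known to be increasing. *)
pose lo := Num.max 1 (xof t - e * c); pose hi := xof t + e * c.
have lo1 : 1 <= lo by rewrite le_max lexx.
have loH : Hfun lo < c / t.
  by rewrite -Hfun_xof//; apply: Hfun_lt => //; rewrite gt_max xgt1 ltrBlDr ltrDl.
have hiH : c / t < Hfun hi by rewrite -Hfun_xof//; apply: Hfun_lt => //; rewrite ltrDl.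
have cv : (c / s) @[s --> t] --> c / t.
  by apply: cvgM; [exact: cvg_cst|apply: cvgV; [exact: lt0r_neq0|exact: cvg_id]].
near=> s.
have s0 : 0 < s by near: s; exact: lt_nbhsr.
have s1 : Hfun lo < c / s by near: s; exact: (cvgr_gt _ cv).
have s2 : c / s < Hfun hi by near: s; exact: (cvgr_lt _ cv).
rewrite -Hfun_xof// in s1 s2.
have s1' : lo < xof s by apply: Hfun_lt_inv s1; exact: xof_ge1.
have s2' : xof s < hi.
  by apply: Hfun_lt_inv s2; apply: le_trans x1 _; rewrite lerDl ltW.
have {s1'} s1' : xof t - e * c < xof s by apply: le_lt_trans s1'; rewrite le_max lexx orbT.
rewrite !f_omega_xof -mulrBl normrM [`|c^-1|]gtr0_norm ?invr_gt0// ltr_pdivrMr//.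
by rewrite /hi in s2'; rewrite ltr_norml; lra.
Unshelve. all: by end_near.
Qed.

Lemma f_omega_cvg_infty : f_omega d v t @[t --> +oo] --> v / 2 ^+ d.
Proof.
have vE : v / 2 ^+ d = 1 / c by rewrite /c div1r invf_div.
rewrite vE; apply/cvgrPdist_lt => e e0.
have ec0 : 0 < e * c by rewrite mulr_gt0.
have H0 : 0 < Hfun (1 + e * c) by rewrite -Hfun1 Hfun_lt// ltrDl.
near=> t.
have t0 : 0 < t by near: t; exact: nbhs_pinfty_gt.
have t1 : c / t < Hfun (1 + e * c).
  rewrite ltr_pdivrMr// mulrC -ltr_pdivrMr//.
  by near: t; apply: nbhs_pinfty_gt; exact: num_real.
rewrite -Hfun_xof// in t1.
have t1' : xof t < 1 + e * c by apply: Hfun_lt_inv t1; rewrite lerDl ltW.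
have := xof_ge1 t0 => t2.
rewrite !f_omega_xof -mulrBl normrM [`|c^-1|]gtr0_norm ?invr_gt0// ltr_pdivrMr//.
by rewrite ltr_norml; lra.
Unshelve. all: by end_near.
Qed.

Lemma f_omega_cvg0 : f_omega d v t @[t --> 0^'+] --> +oo.
Proof.
apply/cvgryPgt => A.
pose B := Num.max 1 (A * c).
have B1 : 1 <= B by rewrite le_max lexx.
have HB := Hfun_ge0 B1.
have Hp : 0 < Hfun B + 1 by rewrite ltr_wpDl.
near=> t.
have t0 : 0 < t by near: t; exact: nbhs_right_gt.
have t1 : t < c / (Hfun B + 1) by near: t; apply: nbhs_right_lt; rewrite divr_gt0.
have : Hfun B < Hfun (xof t).
  rewrite Hfun_xof//; apply: lt_trans (_ : Hfun B + 1 < _); first by rewrite ltrDl.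
  by rewrite ltr_pdivlMr// mulrC -ltr_pdivlMr.
move=> /(Hfun_lt_inv (xof_ge1 t0)) H.
rewrite f_omega_xof ltr_pdivlMr//; apply: le_lt_trans H.
by rewrite le_max lexx orbT.
Unshelve. all: by end_near.
Qed.

End EntropyFunction.

(** * Asymptotics in the four regimes *)

Section LogarithmicEstimates.
Variable R : realType.

Lemma near_ln_ge (C : R) : \forall n \near \oo, C <= ln (n%:R : R).
Proof.
exists (Num.bound (expR C)) => // n /= Hn.
have H : expR C <= n%:R.
  by apply: le_trans (ltW (archi_boundP (expR_ge0 C))) _; rewrite ler_nat.
by rewrite -[C](@expRK R) ler_ln ?posrE ?expR_gt0// (lt_le_trans (expR_gt0 C)).
Qed.

Lemma eqz_or_succ (a b : nat) : (b <= a)%N -> (a <= b.+1)%N ->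
  (a%:Z == b%:Z) || (a%:Z == b%:Z + 1).
Proof. by lia. Qed.

Lemma ln_natS_le (n : nat) : (0 < n)%N -> 1 <= ln n%:R :> R ->
  ln n.+1%:R <= 2 * ln n%:R :> R.
Proof.
move=> n0 l1; apply: le_trans (_ : ln (2 * n%:R) <= _).
  by rewrite ler_ln ?posrE ?mulr_gt0 ?ltr0n// -natrM ler_nat; lia.
rewrite lnM ?posrE ?ltr0n//.
have : ln (1 + 1 : R) <= 1 by apply: le_ln1Dx; lra.
by rewrite (_ : 1 + 1 = 2 :> R)//; lra.
Qed.

Lemma near_nat_gt0 : \forall n \near \oo, (0 < n)%N.
Proof. by exists 1%N. Qed.

(** The tangent of [ln] at [1 / k]; a small [k] makes [ln y] negligible against [y]. *)
Lemma ln_le_linear (k y : R) : 0 < k -> 0 < y -> ln y <= k * y - 1 - ln k.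
Proof.
move=> k0 y0; have : ln (k * y) <= k * y - 1.
  have := @le_ln1Dx R (k * y - 1); rewrite addrCA subrr addr0; apply.
  by rewrite ltrBrDr addrC subrr mulr_gt0.
by rewrite lnM ?posrE//; lra.
Qed.

Lemma expR_ge_sqr (x : R) : 0 <= x -> x ^+ 2 / 4 <= expR x.
Proof.
move=> x0; rewrite (_ : x = x / 2 + x / 2) ?expRD -?expr2; last by field.
rewrite (_ : _ / 4 = (x / 2) ^+ 2); last by field.
rewrite lerXn2r ?nnegrE ?expR_ge0 ?divr_ge0//.
by apply: le_trans (expR_ge1Dx _); rewrite lerDr.
Qed.

(** [k * (1 + ln (z / k))] is the Stirling exponent of [z ^ k / k!], which decreases in [k] beyond
    [z]. It lets a real threshold replace its integer part. *)
Lemma entropy_decreasing (z k y : R) : 0 < z -> z <= k -> k <= y ->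
  y * (1 + ln (z / y)) <= k * (1 + ln (z / k)).
Proof.
move=> z0 zk ky; have k0 := lt_le_trans z0 zk; have y0 := lt_le_trans k0 ky.
have H1 : (y - k) * ln (z / k) <= 0.
  by rewrite mulr_ge0_le0 ?subr_ge0// ln_le0// ler_pdivrMr// mul1r.
have H2 : 1 - (y / k)^-1 <= ln (y / k) by apply: ln_ge_1V; exact: divr_gt0.
have := ler_wpM2l (ltW y0) H2.
rewrite invf_div mulrBr mulr1 mulrCA divff ?gt_eqF// mulr1.
by move: H1; rewrite !ln_div ?posrE//; lra.
Qed.

(** Arithmetic of the dense lower tail, with [G = g * s n], [H = Hfun x], [l = ln n] and [p] the
    mean count of a cell: the error [e] uses up half of [H], the other half yields [-4 l]. *)
Lemma chernoff_exponent (G H x e p l : R) :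
  (1 - e) * G * (1 - x) <= p * (1 - x) -> G * (e * (1 - x)) <= G * (H / 2) ->
  4 * l <= G * (H / 2) -> - (p * (1 - x)) - G * (H + (x - 1)) <= - (2 * (2 * l)).
Proof. by lra. Qed.

End LogarithmicEstimates.

(** * Almost sure asymptotics in the four regimes *)

Section CliqueAsymptotics.
Context {R : realType} {d0 : measure_display} {Omega : measurableType d0}.
Variables (P : probability Omega R) (d : nat) (X : nat -> Omega -> 'rV[R]_d).
Variables (N : 'rV[R]_d -> R) (f : 'rV[R]_d -> R) (M : R).
Hypothesis d_gt0 : (0 < d)%N.
Hypothesis HN : is_norm N.
Hypothesis f_ge0 : forall x, 0 <= f x.
Hypothesis f_leM : forall x, f x <= M.
Hypothesis f_meas : forall B : set R, measurable B -> borelRd (f @^-1` B).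
Hypothesis X_meas : forall i A, borelRd A -> measurable (X i @^-1` A).
Hypothesis X_law : forall i, has_density P (X i) f.
Hypothesis X_indep : mutually_independent P X.
Variable r : nat -> R.
Hypothesis r_gt0 : forall n, 0 < r n.
Hypothesis r_to0 : r @ \oo --> (0 : R).

Let X_ident i A : borelRd A -> P (X i @^-1` A) = P (X 0%N @^-1` A).
Proof. by move=> mA; rewrite !(X_law _ mA). Qed.

(** [s n] is [n r^d], and [g * s n] with the next constant is the Poisson mean [mu]. *)
Let s n : R := n%:R * r n ^+ d.
Let g : R := ess_sigma f * vB N / 2 ^+ d.
Let om n w := clique_number n N X (r n) w.

Let sigma0 : 0 < ess_sigma f := sigma_gt0 f_ge0 f_leM f_meas X_law.

Let v0 : 0 < vB N.
Proof. by have [mu Hmu] := iint_represented R d; exact: (vB_gt0 HN Hmu). Qed.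

Let g0 : 0 < g. Proof. by rewrite divr_gt0 ?mulr_gt0 ?exprn_gt0. Qed.

Let s_gt0 n : (0 < n)%N -> 0 < s n.
Proof. by move=> n0; rewrite mulr_gt0 ?ltr0n// exprn_gt0. Qed.

Let ln_s n : (0 < n)%N -> ln (s n) = ln n%:R + ln (r n ^+ d).
Proof. by move=> n0; rewrite lnM ?posrE ?ltr0n ?exprn_gt0. Qed.

Lemma radius_lt (e : R) : 0 < e -> \forall n \near \oo, r n < e.
Proof. by move=> e0; exact: (cvgr_lt _ r_to0). Qed.

(** The last hypothesis is the logarithm of the clique bound, required to be at most [n^-a]:
    [ln n - ln (s n)] comes from the prefactor [1 / r^d], and [C] absorbs constants. One factor
    [1 + eps] comes from the probability of a cell, the other from the length of a block. The bound
    [n ^ (a / 2)] limits the number of thresholds in a block. *)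
Lemma clique_le_near (a eps : R) (b y : nat -> R) : 0 < a -> 0 < eps ->
  (\forall n \near \oo, 0 <= y n /\ 1 + y n <= n%:R `^ (a / 2)) ->
  (\forall n \near \oo, 1 < b n) ->
  (forall C, \forall n \near \oo,
     C + (1 + a) * ln n%:R - ln (s n) + (1 + eps) ^+ 2 * g * s n * (b n - 1)
       <= y n * ln (b n)) ->
  {ae P, forall w, \forall n \near \oo, (om n w)%:R <= y n}.
Proof.
move=> a0 eps0 Hy Hb HC.
have [C C0 bound] := clique_upper_bound d_gt0 HN f_ge0 f_leM f_meas X_meas X_law X_indep eps0.
(* The 1 ensures [b ^ k >= 2], so that [b ^ k - 1] is at least half of [expR Y]. *)
pose C1 := Num.max 1 (ln (2 * C / ((1 + eps) * g))).
have eps1 : 0 < 1 + eps by rewrite addr_gt0.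
have : {ae P, forall w, \forall n \near \oo, (clique_number n N X (r n) w < (Num.trunc (y n)).+1)%N}.
  apply: (@block_borel_cantelli _ _ _ P (fun n rho w => clique_number n N X rho w) _ r _ a eps a0 eps0).
  - by move=> n m rho rho' w nm rr; exact: clique_number_mono.
  - near=> n; have [y0 y1] : 0 <= y n /\ 1 + y n <= n%:R `^ (a / 2) by near: n.
    by apply: le_trans y1; rewrite -natr1 addrC lerD2l truncn_le.
  near=> n.
  have n0 : (0 < n)%N by near: n; exact: near_nat_gt0.
  have [y0 _] : 0 <= y n /\ 1 + y n <= n%:R `^ (a / 2) by near: n.
  have b1 : 1 < b n by near: n.
  have b0 : 0 < b n by apply: lt_trans b1.
  have r1 : r n < 1 by near: n; exact: radius_lt.
  have Hn : C1 + (1 + a) * ln n%:R - ln (s n) + (1 + eps) ^+ 2 * g * s n * (b n - 1)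
       <= y n * ln (b n) by near: n.
  have rd0 : 0 < r n ^+ d by rewrite exprn_gt0.
  have lrd : ln (r n ^+ d) <= 0 by rewrite ln_le0// exprn_ile1// ltW.
  have lb : 0 < ln (b n) by rewrite ln_gt0.
  have ln0 : 0 <= ln n%:R :> R by rewrite ln_ge0// ler1n.
  pose k := (Num.trunc (y n)).+1.
  have yk : y n <= k%:R by rewrite ltW// truncnS_gt.
  pose m0 := Num.trunc ((1 + eps) * n%:R).
  have en0 : 0 <= (1 + eps) * n%:R by rewrite mulr_ge0// ltW.
  have [|E mE [EF PE]] := bound (r n) m0 k (b n) (r_gt0 n) (ltn0Sn _) (ltW b1).
    by rewrite exprn_egt1.
  exists E => //; split.
    move=> w m Hm km; apply: EF; apply: leq_trans km _.
    by apply: clique_number_mono => //; rewrite truncn_ge_nat.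
  apply: le_trans PE _; rewrite lee_fin.
  set pm := (1 + eps) * ess_sigma f * vB N * (r n / 2) ^+ d.
  have pmE : pm = (1 + eps) * g * r n ^+ d.
    by rewrite /pm /g expr_div_n; ring.
  pose Q := (1 + eps) ^+ 2 * g * s n * (b n - 1).
  have Q0 : 0 <= Q by rewrite !mulr_ge0 ?subr_ge0 ?exprn_ge0// ?(ltW b1)// ?(ltW g0)// ltW.
  have HQ : m0%:R * (pm * (b n - 1)) <= Q.
    apply: le_trans (_ : (1 + eps) * n%:R * (pm * (b n - 1)) <= _).
      apply: ler_wpM2r; last by rewrite truncn_le.
      by rewrite pmE !mulr_ge0 ?subr_ge0 ?(ltW b1)// ltW.
    by rewrite le_eqVlt; apply/orP; left; apply/eqP; rewrite pmE /Q /s; ring.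
  pose Y := y n * ln (b n).
  have bk : expR Y <= b n ^+ k.
    rewrite -[b n ^+ k](@lnK R) ?posrE ?exprn_gt0// ler_expR lnXn// -mulr_natl.
    by apply: ler_wpM2r; first exact: ltW.
  have C11 : 1 <= C1 by rewrite le_max lexx.
  rewrite ln_s// in Hn.
  have an0 : 0 <= a * ln n%:R by rewrite mulr_ge0// ltW.
  have Y1 : 1 <= Y by move: Hn Q0; rewrite /Q /Y; lra.
  have Y2 : 2 <= expR Y.
    by apply: le_trans (expR_ge1Dx _); lra.
  have ebk : expR Y / 2 <= b n ^+ k - 1 by lra.
  have eY0 : 0 < expR Y / 2 by rewrite divr_gt0 ?expR_gt0.
  have bk0 : 0 < b n ^+ k - 1 by apply: lt_le_trans ebk.
  rewrite /powR gt_eqF ?ltr0n//.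
  have pm0 : 0 < pm by rewrite pmE !mulr_gt0.
  apply: le_trans (_ : C / pm * expR Q / (expR Y / 2) <= _).
    apply: ler_pM; rewrite ?mulr_ge0 ?expR_ge0 ?invr_ge0//; try exact: ltW.
      by apply: ler_wpM2l; [rewrite divr_ge0// ltW|rewrite ler_expR].
    by rewrite lef_pV2.
  have -> : C / pm * expR Q / (expR Y / 2) = expR (ln (2 * C / ((1 + eps) * g)) - ln (r n ^+ d) + Q - Y).
    rewrite !expRD !expRN !lnK ?posrE ?divr_gt0 ?mulr_gt0// pmE.
    by field; rewrite !gt_eqF ?expR_gt0.
  rewrite ler_expR.
  have C12 : ln (2 * C / ((1 + eps) * g)) <= C1 by rewrite le_max lexx orbT.
  by move: Hn C12; rewrite /Q /Y; lra.
apply: filterS => w; apply: filterS2 Hy => n [y0 _]; rewrite ltnS => H.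
by apply: le_trans (_ : (Num.trunc (y n))%:R <= _); rewrite ?ler_nat ?truncn_le.
Unshelve. all: by end_near.
Qed.

Let cnt_le_om n w (A : set 'rV[R]_d) : (forall x y, A x -> A y -> N (x - y) <= r n) ->
  (cnt X n A w <= om n w)%N.
Proof.
move=> HA; rewrite /cnt.
pose S := finset.finset (fun l : 'I_n => X l w \in A).
apply: leq_trans (_ : #|S| <= _)%N; last first.
  apply: clique_number_ge => i j; rewrite !finset.inE => /set_mem Ai /set_mem Aj _.
  exact: HA.
rewrite -sum1_card [leqRHS]big_mkcond /=; apply: leq_sum => l _.
by rewrite finset.inE; case: (_ \in A).
Qed.

(** The last hypothesis says, after Stirling, that the expected number of cells with [k] Poisson
    points is at least [n^delta], the number of cells contributing [ln n - ln (s n)]. The other one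
    keeps [k] above the mean, where [entropy_decreasing] applies. For [y n < 1] the integer part is
    0 and the claim is void. *)
Lemma clique_ge_near (eps delta : R) (y : nat -> R) : 0 < eps < 1 -> 0 < delta ->
  (\forall n \near \oo, 1 <= y n -> (1 - eps) * g * s n <= Num.max 1 (y n - 1)) ->
  (forall C, \forall n \near \oo, 1 <= y n ->
     ln (s n) + (1 + eps) * g * s n + ln (y n) + C
       <= (1 - delta) * ln n%:R + y n * (1 + ln ((1 - eps) * g * s n / y n))) ->
  {ae P, forall w, \forall n \near \oo, (Num.trunc (y n) <= om n w)%N}.
Proof.
move=> eps01 delta0 H1 H2.
have [c [r0 [c0 r00 cells]]] := clique_cells d_gt0 HN f_ge0 f_leM f_meas X_meas X_law eps01.
have /andP[eps0 eps1] := eps01.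
suff : {ae P, forall w, \forall n \near \oo, ~ [set w | (om n w < Num.trunc (y n))%N] w}.
  by apply: filterS => w; apply: filterS => n /= /negP; rewrite -leqNgt.
apply: (@borel_cantelli_cover _ _ _ _ _ (expR 1)); near=> n.
have n0 : (0 < n)%N by near: n; exact: near_nat_gt0.
have [y1|y1] := ltP (y n) 1.
  exists set0 => //; split; last by rewrite measure0 lee_fin divr_ge0 ?expR_ge0 ?exprn_ge0.
  move=> w /=; suff -> : Num.trunc (y n) = 0%N by [].
  by apply/eqP; rewrite -leqn0 leqNgt truncn_gt0 -ltNge.
have z1 : (1 - eps) * g * s n <= Num.max 1 (y n - 1) by move: y1; near: n.
have H2n : ln (s n) + (1 + eps) * g * s n + ln (y n) + (1 - ln c)
       <= (1 - delta) * ln n%:R + y n * (1 + ln ((1 - eps) * g * s n / y n)).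
  by move: y1; near: n; exact: H2.
have rn : r n < r0 by near: n; exact: radius_lt.
have [m [W [mc bW dW HW pW]]] := cells (r n) (r_gt0 n) rn.
set k := Num.trunc (y n).
have [E mE [EF PE]] := all_cells_sparse X_meas X_indep X_ident k n0 bW dW.
exists E => //; split.
  move=> w /= omk; apply: EF => i; apply: leq_ltn_trans omk.
  by apply: cnt_le_om => u v; exact: HW.
apply: le_trans PE _; rewrite lee_fin.
have sn0 := s_gt0 n0.
set z := (1 - eps) * g * s n in z1 H2n.
have z0 : 0 < z by do 2 apply: mulr_gt0 => //; rewrite subr_gt0.
have y0 : 0 < y n by apply: lt_le_trans y1.
have k0 : (0 < k)%N by rewrite truncn_gt0.
have ky : k%:R <= y n by rewrite truncn_le ltW.
have zk : z <= k%:R.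
  apply: le_trans z1 _; rewrite ge_max ler1n k0/= lerBlDr natr1 ltW//.
  exact: truncnS_gt.
have k0' : 0 < k%:R :> R by rewrite ltr0n.
have ent := entropy_decreasing z0 zk ky.
have rd0 : 0 < r n ^+ d by rewrite exprn_gt0.
have muE : n%:R * (ess_sigma f * vB N * (r n / 2) ^+ d) = g * s n.
  by rewrite /g /s expr_div_n; ring.
set T := \sum_i _.
(* Far less than the available [n^delta]: it beats the factor [e * n] and leaves [(n+1)^-2]. *)
have HT : 3 * ln n.+1%:R <= T.
  have u1 : 24 / delta ^+ 2 <= ln n%:R :> R by near: n; exact: near_ln_ge.
  have u2 : 1 <= ln n%:R :> R by near: n; exact: near_ln_ge.
  set u := ln n%:R in u1 u2 H2n.
  have Lu : ln n.+1%:R <= 2 * u by exact: ln_natS_le.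
  have Hu : 6 * u <= expR (delta * u).
    have u0 : 0 <= u by lra.
    apply: le_trans (expR_ge_sqr _); last by rewrite mulr_ge0// ltW.
    move: u1; rewrite ler_pdivrMr ?exprn_gt0// => u1.
    have := ler_wpM2l u0 u1; rewrite exprMn; lra.
  apply: le_trans (_ : expR (delta * u) <= _); first by lra.
  apply: le_trans (_ : \sum_(i < m) (expR (- ((1 + eps) * g * s n)) * (z ^+ k / k`!%:R)) <= _); last first.
    apply: ler_sum => i _; have /andP[p1 p2] := pW i.
    have pz : z <= n%:R * prob P X (W i).
      have := ler_wpM2l (ler0n R n) p1.
      by rewrite mulrCA muE mulrA.
    apply: ler_pM; rewrite ?expR_ge0 ?divr_ge0 ?exprn_ge0//; first exact: ltW.
      rewrite ler_expR lerN2; have := ler_wpM2l (ler0n R n) p2.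
      by rewrite mulrCA muE mulrA.
    apply: ler_wpM2r; first by rewrite invr_ge0.
    by apply: lerXn2r => //; rewrite nnegrE; [exact: ltW|exact: mulr_ge0 (ler0n R n) (prob_ge0 P X _)].
  rewrite sumr_const card_ord -[_ *+ m]mulr_natl.
  apply: le_trans (_ : c / r n ^+ d * (expR (- ((1 + eps) * g * s n)) * (z ^+ k / (expR 1 * k%:R * (k%:R / expR 1) ^+ k))) <= _); last first.
    have F0 : 0 < expR 1 * k%:R * (k%:R / expR 1) ^+ k :> R.
      by rewrite !mulr_gt0 ?exprn_gt0 ?divr_gt0 ?expR_gt0.
    have zk0 : 0 <= z ^+ k by apply: exprn_ge0; exact: ltW.
    apply: ler_pM => //; first by apply: divr_ge0; exact: ltW.
      by apply: mulr_ge0; [exact: expR_ge0|apply: divr_ge0 => //; exact: ltW].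
    apply: ler_wpM2l; first exact: expR_ge0.
    apply: ler_wpM2l => //.
    by rewrite lef_pV2 ?posrE ?ltr0n ?fact_gt0//; exact: fact_le_expR.
  have -> : c / r n ^+ d * (expR (- ((1 + eps) * g * s n)) * (z ^+ k / (expR 1 * k%:R * (k%:R / expR 1) ^+ k)))
    = expR (ln c - ln (r n ^+ d) - (1 + eps) * g * s n - 1 - ln k%:R + k%:R * (1 + ln (z / k%:R))).
    rewrite ln_div ?posrE// (_ : k%:R * _ = k%:R + (k%:R * ln z - k%:R * ln k%:R)); last by ring.
    rewrite !expRD !expRN !expRM_natl !lnK ?posrE// expr_div_n.
    have -> : expR (k%:R : R) = expR 1 ^+ k by rewrite -{1}[k%:R]mulr1 expRM_natl.
    by field; rewrite !gt_eqF ?exprn_gt0 ?expR_gt0.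
  rewrite ler_expR.
  have lk : ln k%:R <= ln (y n) by rewrite ler_ln ?posrE.
  by move: H2n ent lk; rewrite ln_s// -/u; lra.
have N1 : 0 < n.+1%:R :> R by rewrite ltr0n.
apply: le_trans (_ : expR 1 * n.+1%:R * expR (- (3 * ln n.+1%:R)) <= _).
  apply: ler_pM; rewrite ?expR_ge0 ?mulr_ge0 ?expR_ge0//.
    by apply: ler_wpM2l; [exact: expR_ge0|rewrite ler_nat].
  by rewrite ler_expR lerN2.
rewrite expRN expRM_natl lnK ?posrE// le_eqVlt; apply/orP; left; apply/eqP.
by field; rewrite gt_eqF.
Unshelve. all: by end_near.
Qed.


Lemma near_ln_ln (k : R) : 0 < k -> \forall n \near \oo, ln (ln n%:R) <= k * ln (n%:R : R).
Proof.
move=> k0; near=> n.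
have l1 : 1 <= ln n%:R :> R by near: n; exact: near_ln_ge.
have l2 : - ln (k / 2) * 2 / k <= ln n%:R by near: n; exact: near_ln_ge.
have := @ln_le_linear R (k / 2) (ln n%:R) (divr_gt0 k0 (ltr0n _ 2)) (lt_le_trans ltr01 l1).
by move: l2; rewrite ler_pdivrMr//; lra.
Unshelve. all: by end_near.
Qed.

Lemma near_ln_powR (a c : R) : 0 < a -> 0 <= c ->
  \forall n \near \oo, 1 + c * ln (n%:R : R) <= n%:R `^ a.
Proof.
move=> a0 c0; near=> n.
have n0 : (0 < n)%N by near: n; exact: near_nat_gt0.
have l1 : 1 <= ln n%:R :> R by near: n; exact: near_ln_ge.
have l2 : 4 * (1 + c) / a ^+ 2 <= ln n%:R by near: n; exact: near_ln_ge.
rewrite /powR gt_eqF ?ltr0n//.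
have l0 : 0 <= ln n%:R :> R by lra.
apply: le_trans (expR_ge_sqr _); last by rewrite mulr_ge0// ltW.
move: l2; rewrite ler_pdivrMr ?exprn_gt0// => l2.
have := ler_wpM2r l0 l2; have := ler_wpM2l c0 l1; rewrite exprMn; nra.
Unshelve. all: by end_near.
Qed.

(** Countably many tolerances [e j] are used, so that the exceptional null sets can be joined. [l0]
    accommodates lower bounds valid only above some level, and the denominator [j.+2] keeps
    [l - e j] above it. *)
Lemma ae_cvg_sandwich (u : nat -> Omega -> R) (l l0 : R) : l0 < l ->
  (forall c, l < c -> {ae P, forall w, \forall n \near \oo, u n w <= c}) ->
  (forall c, l0 < c -> c < l -> {ae P, forall w, \forall n \near \oo, c <= u n w}) ->
  {ae P, forall w, u ^~ w @ \oo --> l}.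
Proof.
move=> ll0 U L.
pose e j : R := (l - l0) / j.+2%:R.
have e0 j : 0 < e j by rewrite divr_gt0 ?subr_gt0.
have ej j : e j < l - l0.
  by rewrite ltr_pdivrMr// ltr_pMr ?subr_gt0// ltr1n.
have U' : {ae P, forall w, forall j, \forall n \near \oo, u n w <= l + e j}.
  by apply: ae_foralln => j; apply: U; rewrite ltrDl.
have L' : {ae P, forall w, forall j, \forall n \near \oo, l - e j <= u n w}.
  apply: ae_foralln => j; apply: L; last by rewrite ltrBlDr ltrDl.
  by have := ej j; lra.
apply: filterS2 U' L' => w Uw Lw; apply/cvgrPdist_le => x x0.
pose j := Num.bound ((l - l0) / x).
have ejx : e j <= x.
  rewrite ler_pdivrMr// mulrC -ler_pdivrMr//; apply: le_trans (ltW (archi_boundP _)) _.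
    by rewrite divr_ge0 ?subr_ge0// ltW.
  by rewrite ler_nat -/j; lia.
move: (Uw j) (Lw j); apply: filterS2 => n h1 h2.
by rewrite ler_norml; lra.
Qed.

(** With about [1 / r^d = n / s n] places, cliques of size [y] are at the balance when
    [y = ln n / L n + 1]. The bounds are taken half a unit above and below; since
    [L n >= alpha * ln n], half a unit is worth a power of [n], and just two integers remain. *)
Lemma sparse_regime (alpha : R) : 0 < alpha ->
  (\forall n \near \oo, s n <= n%:R `^ (- alpha)) ->
  {ae P, forall w, \forall n \near \oo,
     let k := Num.floor (ln n%:R / ln (s n)^-1 + 2^-1) in
     ((om n w)%:Z == k) || ((om n w)%:Z == k + 1)}.
Proof.
move=> a0 Hs.
pose L n : R := - ln (s n).
have HL : \forall n \near \oo, alpha * ln n%:R <= L n.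
  near=> n; have n0 : (0 < n)%N by near: n; exact: near_nat_gt0.
  have : s n <= n%:R `^ (- alpha) by near: n.
  rewrite /powR gt_eqF ?ltr0n// -ler_ln ?posrE ?expR_gt0//; last exact: s_gt0.
  by rewrite expRK /L; lra.
pose K0 := alpha^-1 + 2^-1.
have K00 : 0 < K0 by rewrite addr_gt0 ?invr_gt0.
have HK : \forall n \near \oo, [/\ (0 < n)%N, 1 <= ln n%:R :> R, alpha * ln n%:R <= L n, 0 < L n &
    0 <= ln n%:R / L n <= alpha^-1].
  near=> n; have n0 : (0 < n)%N by near: n; exact: near_nat_gt0.
  have l1 : 1 <= ln n%:R :> R by near: n; exact: near_ln_ge.
  have Ln : alpha * ln n%:R <= L n by near: n.
  have al0 : 0 < alpha * ln n%:R by rewrite mulr_gt0// (lt_le_trans ltr01).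
  have L0 := lt_le_trans al0 Ln.
  split => //; apply/andP; split; first by rewrite divr_ge0 ?ltW// (lt_le_trans ltr01).
  by rewrite ler_pdivrMr// mulrC ler_pdivlMr// mulrC.
have U : {ae P, forall w, \forall n \near \oo, (om n w)%:R <= ln n%:R / L n + 3 / 2}.
  (* [b - 1 = 1 / s n] keeps the moment term constant, equal to [4 * g], while [ln b] is at least
     [L n]. The spare [L n / 2] covers [alpha / 4 * ln n] and the constants. *)
  apply: (@clique_le_near (alpha / 4) 1 (fun n => 1 + (s n)^-1)) => //; first by rewrite divr_gt0.
  - near=> n.
    have [n0 l1 Ln L0 /andP[q0 q1]] : [/\ (0 < n)%N, 1 <= ln n%:R :> R, alpha * ln n%:R <= L n, 0 < L n &
      0 <= ln n%:R / L n <= alpha^-1] by near: n.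
    split; first by lra.
    apply: le_trans (_ : 1 + 1 * ln n%:R <= _); last first.
      by near: n; apply: near_ln_powR => //; rewrite !divr_gt0.
    have : alpha^-1 + 3 / 2 <= ln n%:R by near: n; exact: near_ln_ge.
    by lra.
  - near=> n; have n0 : (0 < n)%N by near: n; exact: near_nat_gt0.
    by rewrite ltrDl invr_gt0 s_gt0.
  move=> C; near=> n.
  have [n0 l1 Ln L0 /andP[q0 q1]] : [/\ (0 < n)%N, 1 <= ln n%:R :> R, alpha * ln n%:R <= L n, 0 < L n &
      0 <= ln n%:R / L n <= alpha^-1] by near: n.
  have lC : (C + 4 * g) * 4 / alpha <= ln n%:R by near: n; exact: near_ln_ge.
  have sn0 := s_gt0 n0.
  have -> : (1 + 1) ^+ 2 * g * s n * (1 + (s n)^-1 - 1) = 4 * g.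
    by field; rewrite gt_eqF.
  have lb : L n <= ln (1 + (s n)^-1).
    by rewrite /L -lnV ?posrE// ler_ln ?posrE ?addr_gt0 ?invr_gt0// lerDr.
  apply: le_trans (_ : (ln n%:R / L n + 3 / 2) * L n <= _); last first.
    by apply: ler_wpM2l => //; lra.
  rewrite [leRHS]mulrDl divfK ?gt_eqF//.
  move: lC; rewrite ler_pdivrMr// /L in Ln L0 *; lra.
have D : {ae P, forall w, \forall n \near \oo, (Num.trunc (ln n%:R / L n + 2^-1)%R <= om n w)%N}.
  (* A crude [eps] suffices, because [y] and [s n] are bounded and [eps] changes the exponent by a
     bounded amount only. *)
  apply: (@clique_ge_near 2^-1 (alpha / 4)) => //; first by lra.
  - by rewrite divr_gt0.
  - near=> n => _.
    have [n0 l1 Ln L0 _] : [/\ (0 < n)%N, 1 <= ln n%:R :> R, alpha * ln n%:R <= L n, 0 < L n &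
      0 <= ln n%:R / L n <= alpha^-1] by near: n.
    have lg : ln g / alpha <= ln n%:R by near: n; exact: near_ln_ge.
    rewrite le_max; apply/orP; left.
    have : s n <= g^-1.
      rewrite -ler_ln ?posrE ?s_gt0 ?invr_gt0// lnV ?posrE//.
      by move: lg; rewrite ler_pdivrMr// /L in Ln *; lra.
    rewrite -(ler_pM2l g0) divff ?gt_eqF//; lra.
  move=> C; near=> n => y1.
  have [n0 l1 Ln L0 /andP[q0 q1]] : [/\ (0 < n)%N, 1 <= ln n%:R :> R, alpha * ln n%:R <= L n, 0 < L n &
      0 <= ln n%:R / L n <= alpha^-1] by near: n.
  set y := ln n%:R / L n + 2^-1 in y1 *.
  have yK : y <= K0 by rewrite /y /K0; lra.
  have sn0 := s_gt0 n0.
  have y0 : 0 < y by lra.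
  have s1 : s n <= 1.
    by rewrite -ler_ln ?posrE// ln1; move: L0; rewrite /L; lra.
  have lC : (3 / 2 * g + K0 + C + K0 * `|ln (g / 2)| + K0 ^+ 2) * 4 / alpha <= ln n%:R.
    by near: n; exact: near_ln_ge.
  have -> : ln ((1 - 2^-1) * g * s n / y) = ln (g / 2) - L n - ln y.
    rewrite (_ : _ / y = g / 2 * (s n / y)); last by field; rewrite gt_eqF.
    have lsy : ln (s n / y) = ln (s n) - ln y by rewrite ln_div ?posrE.
    by rewrite lnM ?posrE; [rewrite lsy /L; ring|exact: divr_gt0|exact: divr_gt0].
  have yL : y * L n = ln n%:R + L n / 2 by rewrite /y mulrDl divfK ?gt_eqF//; ring.
  have ly : ln y <= y.
    by have := @ln_le_linear R 1 y ltr01 y0; rewrite ln1; lra.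
  have ly0 : 0 <= ln y by rewrite ln_ge0.
  have yly : y * ln y <= K0 ^+ 2.
    by rewrite expr2; apply: ler_pM => //; [exact: ltW|apply: le_trans ly _].
  have yg : - (K0 * `|ln (g / 2)|) <= y * ln (g / 2).
    rewrite lerNl -mulrN; apply: le_trans (_ : y * `|ln (g / 2)| <= _).
      apply: ler_wpM2l; first exact: ltW.
      by rewrite -normrN ler_norm.
    by apply: ler_wpM2r.
  have gs : g * s n <= g by rewrite ger_pMr.
  have yE : y * (1 + (ln (g / 2) - L n - ln y)) = y + y * ln (g / 2) - y * L n - y * ln y by ring.
  rewrite yE yL; move: lC; rewrite ler_pdivrMr// => lC.
  have -> : ln (s n) = - L n by rewrite /L opprK.
  by lra.
apply: filterS2 U D => w Uw Dw.
near=> n.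
have [n0 l1 Ln L0 /andP[q0 q1]] : [/\ (0 < n)%N, 1 <= ln n%:R :> R, alpha * ln n%:R <= L n, 0 < L n &
      0 <= ln n%:R / L n <= alpha^-1] by near: n.
have u : (om n w)%:R <= ln n%:R / L n + 3 / 2 by near: n.
have l : (Num.trunc (ln n%:R / L n + 2^-1)%R <= om n w)%N by near: n.
rewrite lnV ?posrE ?s_gt0// -/(L n).
set y := ln n%:R / L n + 2^-1 in l *.
have y0 : 0 <= y by rewrite /y; lra.
have tE : Num.floor y = (Num.trunc y)%:Z.
  apply/eqP; rewrite floor_eq.
  have := truncn_itv y0; rewrite -natr1 => /andP[t1 t2].
  by rewrite t1/= intrD.
rewrite /= tE.
have u' : (om n w <= (Num.trunc y).+1)%N.
  rewrite -ltnS -(ltr_nat R); apply: le_lt_trans u _.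
  have := truncnS_gt y; rewrite -[X in _ -> _ < X]natr1 /y; lra.
exact: eqz_or_succ.
Unshelve. all: by end_near.
Qed.



(** Here [la n] tends to infinity but is negligible against [ln n], as is [- ln (s n)]. A clique of
    size [y] costs [y * la n] in the exponent up to lower order, and the number of places supplies
    [ln n]. *)
Lemma intermediate_regime :
  (forall eps : R, 0 < eps -> (fun n : nat => n%:R `^ (- eps) / s n) @ \oo --> (0 : R)) ->
  (fun n : nat => s n / ln n%:R) @ \oo --> (0 : R) ->
  {ae P, forall w, (fun n : nat => (om n w)%:R / (ln n%:R / ln (ln n%:R / s n))) @ \oo --> (1 : R)}.
Proof.
move=> Hlow Hup.
pose la n : R := ln (ln n%:R / s n).
have F1 A : \forall n \near \oo, [/\ (0 < n)%N, 1 <= ln n%:R :> R & A <= la n].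
  near=> n; have n0 : (0 < n)%N by near: n; exact: near_nat_gt0.
  have l1 : 1 <= ln n%:R :> R by near: n; exact: near_ln_ge.
  have l0 : 0 < ln n%:R :> R := lt_le_trans ltr01 l1.
  have sl : s n / ln n%:R < expR (- A) by near: n; apply: (cvgr_lt _ Hup); exact: expR_gt0.
  split => //; rewrite /la -[A](@expRK R) ler_ln ?posrE ?expR_gt0 ?divr_gt0 ?s_gt0//.
  move: sl; rewrite expRN => /ltW.
  rewrite -[X in _ -> X <= _]invrK -lef_pV2 ?posrE ?invr_gt0 ?divr_gt0 ?s_gt0 ?expR_gt0//.
  by rewrite !invrK invf_div.
have F2 k : 0 < k -> \forall n \near \oo, - ln (s n) <= k * ln n%:R.
  move=> k0; near=> n; have n0 : (0 < n)%N by near: n; exact: near_nat_gt0.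
  have : n%:R `^ (- k) / s n < 1 by near: n; exact: (cvgr_lt _ (Hlow k k0)).
  rewrite ltr_pdivrMr ?s_gt0// mul1r => /ltW.
  rewrite /powR gt_eqF ?ltr0n// -ler_ln ?posrE ?expR_gt0 ?s_gt0//.
  by rewrite expRK; lra.
have F3 k : 0 < k -> \forall n \near \oo, la n <= k * ln n%:R.
  move=> k0; near=> n.
  have [n0 l1 _] : [/\ (0 < n)%N, 1 <= ln n%:R :> R & 0 <= la n] by near: n.
  have h1 : - ln (s n) <= k / 2 * ln n%:R by near: n; apply: F2; rewrite divr_gt0.
  have h2 : ln (ln n%:R) <= k / 2 * ln n%:R by near: n; apply: near_ln_ln; rewrite divr_gt0.
  rewrite /la ln_div ?posrE ?s_gt0//; last exact: lt_le_trans l1.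
  by lra.
apply: (@ae_cvg_sandwich _ 1 0) => // c.
- move=> c1; pose e := (c - 1) / 8.
  have e0 : 0 < e by rewrite divr_gt0// subr_gt0.
  have c0 : 0 < c by lra.
  (* With [b = dl * (ln n / s n)] the moment term is at most [4 * g * s n * b = e * ln n], while
     [ln b] is still [la n] up to a constant. *)
  pose dl := e / (4 * g).
  have dl0 : 0 < dl by rewrite divr_gt0// mulr_gt0.
  have : {ae P, forall w, \forall n \near \oo, (om n w)%:R <= c * (ln n%:R / la n)}.
    apply: (@clique_le_near e 1 (fun n => dl * (ln n%:R / s n))) => //.
    + near=> n.
      have [n0 l1 L1] : [/\ (0 < n)%N, 1 <= ln n%:R :> R & 1 <= la n] by near: n.
      have l0 : 0 <= ln n%:R :> R by lra.
      have L0 : 0 <= (la n)^-1 by rewrite invr_ge0; lra.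
      split; first by rewrite !mulr_ge0// ltW.
      apply: le_trans (_ : 1 + c * ln n%:R <= _).
        rewrite lerD2l; apply: ler_wpM2l; first exact: ltW.
        by rewrite ler_piMr// invf_le1//; lra.
      by near: n; apply: near_ln_powR; [rewrite divr_gt0|exact: ltW].
    + near=> n.
      have [n0 l1 L1] : [/\ (0 < n)%N, 1 <= ln n%:R :> R & 1 - ln dl <= la n] by near: n.
      have q0 : 0 < ln n%:R / s n by rewrite divr_gt0 ?s_gt0//; lra.
      have q1 : 0 < dl * (ln n%:R / s n) by exact: mulr_gt0.
      rewrite -[X in _ < X](@lnK R) ?posrE//.
      by rewrite -[X in X < _](@expR0 R) ltr_expR lnM ?posrE// -/(la n); lra.
    move=> C; near=> n.
    have [n0 l1 L1] : [/\ (0 < n)%N, 1 <= ln n%:R :> R & Num.max 1 (c * `|ln dl| / e) <= la n] by near: n.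
    have h2 : - ln (s n) <= e * ln n%:R by near: n; exact: F2.
    have l2 : (C + 0) / e <= ln n%:R by near: n; exact: near_ln_ge.
    move: L1; rewrite ge_max ler_pdivrMr// => /andP[L1 L2].
    have sn0 := s_gt0 n0.
    have l0 : 0 < ln n%:R :> R by lra.
    have L0 : 0 < la n by lra.
    have q0 : 0 < ln n%:R / s n by rewrite divr_gt0.
    rewrite lnM ?posrE// -/(la n).
    have -> : c * (ln n%:R / la n) * (ln dl + la n) = c * ln n%:R + ln n%:R * (c * ln dl / la n).
      by field; rewrite gt_eqF.
    have dE : (1 + 1) ^+ 2 * g * s n * (dl * (ln n%:R / s n) - 1) = e * ln n%:R - 4 * (g * s n).
      by rewrite /dl; field; rewrite !gt_eqF.
    rewrite dE.
    have gs : 0 <= g * s n by rewrite mulr_ge0// ltW.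
    have H3 : - e <= c * ln dl / la n.
      rewrite ler_pdivlMr// mulNr lerNl -mulrN; apply: le_trans (_ : c * `|ln dl| <= _).
        by rewrite ler_pM2l// -normrN ler_norm.
      by rewrite [leRHS]mulrC.
    have H4 := ler_wpM2l (ltW l0) H3.
    move: l2; rewrite addr0 ler_pdivrMr// => l2.
    have cl : c * ln n%:R = (1 + 8 * e) * ln n%:R by congr (_ * _); rewrite /e; field.
    have el : 0 <= e * ln n%:R by apply: mulr_ge0; exact: ltW.
    rewrite cl; move: H4 h2 l2 gs el.
    set Z := ln n%:R * (_ / _).
    lra.
  apply: filterS => w Hw; near=> n.
  have [n0 l1 L1] : [/\ (0 < n)%N, 1 <= ln n%:R :> R & 1 <= la n] by near: n.
  have l0 : 0 < ln n%:R :> R by lra.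
  have L0 : 0 < la n by lra.
  by rewrite ler_pdivrMr; [near: n|exact: divr_gt0].
move=> c0 c1; pose e := (1 - c) / 2.
have e0 : 0 < e by rewrite divr_gt0// subr_gt0.
(* The added 1 pays for the truncation, so that [c * (ln n / la n)] itself is reached. *)
have : {ae P, forall w, \forall n \near \oo, (Num.trunc (c * (ln n%:R / la n) + 1)%R <= om n w)%N}.
  apply: (@clique_ge_near 2^-1 (e / 8)); first by lra.
  - by rewrite divr_gt0.
  - near=> n => _.
    have [n0 l1 L1] : [/\ (0 < n)%N, 1 <= ln n%:R :> R & Num.max 1 (2 * g / c) <= la n] by near: n.
    move: L1; rewrite ge_max ler_pdivrMr// => /andP[L1 L2].
    rewrite le_max; apply/orP; right; rewrite addrK.
    have sn0 := s_gt0 n0; have l0 : 0 < ln n%:R :> R by lra.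
    have L0 : 0 < la n by lra.
    have sE : s n = ln n%:R / expR (la n).
      by rewrite /la lnK ?posrE ?divr_gt0// invf_div mulrCA divff ?mulr1 ?gt_eqF.
    rewrite sE (_ : _ * g * _ = ln n%:R * (g / 2 / expR (la n))); last by field; rewrite gt_eqF ?expR_gt0.
    rewrite [leRHS]mulrCA ler_pM2l// ler_pdivrMr ?expR_gt0// [leRHS]mulrAC ler_pdivlMr//.
    have := expR_ge_sqr (ltW L0); rewrite expr2 => H.
    have := ler_wpM2l (ltW c0) H.
    have := ler_wpM2r (ltW L0) L2; lra.
  move=> C; near=> n => y1.
  set y := c * _ + 1 in y1 *.
  pose G := `|ln (g / 2)| + 1.
  have [n0 l1 L1] : [/\ (0 < n)%N, 1 <= ln n%:R :> R & Num.max 1 (Num.max (G * 8 / e) (ln (12 * g / e))) <= la n] by near: n.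
  move: L1; rewrite !ge_max ler_pdivrMr// => /and3P[L1 L2 L3].
  have l0 : 0 < ln n%:R :> R by lra.
  have L0 : 0 < la n by lra.
  have sn0 := s_gt0 n0.
  have h1 : la n <= e / 2 * ln n%:R by near: n; apply: F3; rewrite divr_gt0.
  have h2 : ln (ln n%:R) <= e / 16 * ln n%:R by near: n; apply: near_ln_ln; rewrite divr_gt0.
  have h3 : C * 8 / e <= ln n%:R by near: n; exact: near_ln_ge.
  pose T := ln n%:R / la n.
  have yT : y <= (1 - e) * T.
    have T2 : 1 <= e * T by rewrite /T mulrA ler_pdivlMr//; nra.
    by rewrite /y -/T /e in T2 *; lra.
  have T0 : 0 < T by rewrite divr_gt0.
  have e1 : e < 1 by rewrite /e; lra.
  have yT1 : y <= T by apply: le_trans yT _; rewrite mulrBl mul1r gerBl mulr_ge0// ltW.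
  have y0 : 0 < y by lra.
  have gs : 3 / 2 * (g * s n) <= e / 8 * ln n%:R.
    have sE : s n = ln n%:R / expR (la n).
      by rewrite /la lnK ?posrE ?divr_gt0// invf_div mulrCA divff ?mulr1 ?gt_eqF.
    have : 12 * g / e <= expR (la n).
      by rewrite -[leLHS](@lnK R) ?ler_expR// posrE divr_gt0// mulr_gt0.
    rewrite sE ler_pdivrMr// => H.
    have -> : 3 / 2 * (g * (ln n%:R / expR (la n))) = ln n%:R * (12 * g) / 8 / expR (la n).
      by field; rewrite gt_eqF ?expR_gt0.
    rewrite ler_pdivrMr ?expR_gt0//.
    have := ler_wpM2l (ltW l0) H; lra.
  have ls : ln (s n) = ln (ln n%:R) - la n by rewrite /la ln_div ?posrE//; ring.
  have ly : ln y <= ln (ln n%:R).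
    rewrite ler_ln ?posrE//; apply: le_trans yT1 _.
    by rewrite ler_pdivrMr// ler_peMr// ltW.
  have lyE : ln ((1 - 2^-1) * g * s n / y) = ln (g / 2) + ln (s n) - ln y.
    rewrite (_ : _ / y = g / 2 * (s n / y)); last by field; rewrite gt_eqF.
    have lsy : ln (s n / y) = ln (s n) - ln y by rewrite ln_div ?posrE.
    by rewrite lnM ?posrE; [rewrite lsy; ring|exact: divr_gt0|exact: divr_gt0].
  have Hg : - G <= ln (g / 2).
    rewrite lerNl; apply: le_trans (ler_norm _) _.
    by rewrite normrN /G lerDl.
  have Hy : - (y * (la n + G)) <= y * (1 + (ln (g / 2) + ln (s n) - ln y)).
    rewrite -mulrN; apply: ler_wpM2l; first exact: ltW.
    by rewrite ls; lra.
  have G0 : 0 <= G by rewrite /G addr_ge0.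
  have HyT : y * (la n + G) <= (1 - e) * ln n%:R + ln n%:R * (e / 8).
    have TL : T * la n = ln n%:R by rewrite /T divfK ?gt_eqF.
    apply: le_trans (_ : (1 - e) * T * (la n + G) <= _).
      by apply: ler_wpM2r => //; rewrite addr_ge0// ltW.
    have : T * G <= ln n%:R * (e / 8).
      rewrite -TL -mulrA; apply: ler_wpM2l; first exact: ltW.
      by move: L2; lra.
    have -> : (1 - e) * T * (la n + G) = (1 - e) * (T * la n) + (T * G - e * (T * G)) by ring.
    rewrite TL => H; rewrite lerD2l; apply: le_trans H.
    by rewrite gerBl; apply: mulr_ge0; [exact: ltW|apply: mulr_ge0 => //; exact: ltW].
  rewrite lyE; move: h3; rewrite ler_pdivrMr// => h3.
  rewrite ls in Hy *; lra.
apply: filterS => w Hw; near=> n.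
have [n0 l1 L1] : [/\ (0 < n)%N, 1 <= ln n%:R :> R & 1 <= la n] by near: n.
have l0 : 0 < ln n%:R :> R by lra.
have L0 : 0 < la n by lra.
have T0 : 0 < ln n%:R / la n by exact: divr_gt0.
rewrite ler_pdivlMr//.
have : (Num.trunc (c * (ln n%:R / la n) + 1)%R <= om n w)%N by near: n.
rewrite -(ler_nat R); apply: le_trans.
have := truncnS_gt (c * (ln n%:R / la n) + 1); rewrite -[X in _ < X -> _]natr1 ltrD2r.
by move=> /ltW.
Unshelve. all: by end_near.
Qed.


(** The tilt [b = x] optimises the Chernoff bound and leaves [g * s n * (x * ln x - (x - 1))], which
    is [g * s n * Hfun x]. It serves both the critical and the dense regime. *)
Lemma supercritical_upper (a x : R) : 0 < a -> 1 < x ->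
  (\forall n \near \oo, [/\ 1 <= s n, 1 + g * x * s n <= n%:R `^ (a / 2) &
      (1 + 2 * a) * ln n%:R <= g * s n * Hfun x]) ->
  {ae P, forall w, \forall n \near \oo, (om n w)%:R <= g * x * s n}.
Proof.
move=> a0 x1 H.
have H0 : 0 < Hfun x by rewrite -Hfun1; exact: Hfun_lt.
have x10 : 0 < x - 1 by rewrite subr_gt0.
have a20 : 0 < 1 + 2 * a by rewrite addr_gt0// mulr_gt0.
(* The factors [1 + eps] may use the fraction [(a / 2) / (1 + 2 a)] of [g * s n * Hfun x], so that
   [(1 + 3/2 a) * ln n] remains. *)
pose q := Hfun x * (a / 2) / (1 + 2 * a) / (x - 1).
have q0 : 0 < q by rewrite !divr_gt0// mulr_gt0// divr_gt0.
pose eps := Num.min 1 (q / 3).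
have eps0 : 0 < eps by rewrite lt_min ltr01 divr_gt0.
have eps1 : eps <= 1 by rewrite ge_min lexx.
have epsq : eps <= q / 3 by rewrite ge_min lexx orbT.
have qE : (1 + eps) ^+ 2 - 1 <= q by rewrite expr2; nra.
apply: (@clique_le_near a eps (fun=> x)) => //.
- near=> n; have [s1 s2 _] : [/\ 1 <= s n, 1 + g * x * s n <= n%:R `^ (a / 2) &
      (1 + 2 * a) * ln n%:R <= g * s n * Hfun x] by near: n.
  have x0 : 0 <= x by lra.
  have s0 : 0 <= s n by lra.
  by split => //; do 2 apply: mulr_ge0 => //; exact: ltW.
- by near=> n.
move=> C; near=> n.
have [s1 _ Hn] : [/\ 1 <= s n, 1 + g * x * s n <= n%:R `^ (a / 2) &
      (1 + 2 * a) * ln n%:R <= g * s n * Hfun x] by near: n.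
have lC : C * 2 / a <= ln n%:R by near: n; exact: near_ln_ge.
move: lC; rewrite ler_pdivrMr// => lC.
have ls : 0 <= ln (s n) by exact: ln_ge0.
set G := g * s n in Hn.
have G0 : 0 <= G by rewrite mulr_ge0 ?ltW//; lra.
have xl : x * ln x = Hfun x + (x - 1) by rewrite /Hfun; ring.
have -> : g * x * s n * ln x = G * (Hfun x + (x - 1)) by rewrite -xl /G; ring.
have H1 : ((1 + eps) ^+ 2 - 1) * (G * (x - 1)) <= (1 + 2 * a)^-1 * (a / 2) * (G * Hfun x).
  apply: le_trans (_ : q * (G * (x - 1)) <= _).
    by apply: ler_wpM2r => //; rewrite mulr_ge0// ltW.
  by rewrite le_eqVlt; apply/orP; left; apply/eqP; rewrite /q; field; rewrite !gt_eqF.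
have H2 : (1 + 3 / 2 * a) * ln n%:R <= (1 - (1 + 2 * a)^-1 * (a / 2)) * (G * Hfun x).
  rewrite (_ : 1 - _ = (1 + 3 / 2 * a) * (1 + 2 * a)^-1); last by field; rewrite gt_eqF.
  rewrite -[leRHS]mulrA; apply: ler_wpM2l; first by lra.
  by rewrite ler_pdivlMl.
have -> : (1 + eps) ^+ 2 * g * s n * (x - 1) = ((1 + eps) ^+ 2 - 1) * (G * (x - 1)) + G * (x - 1).
  by rewrite /G; ring.
move: H1 H2 lC ls; lra.
Unshelve. all: by end_near.
Qed.

(** At [y = g * x * s n] a cell succeeds with probability about [exp (- g * s n * Hfun x)], at least
    [n^-(1 - delta)]. The bound [s n <= K * ln n] turns errors of order [eps * s n] into a small
    multiple of [ln n] and makes [ln (s n)] negligible. *)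
Lemma critical_lower (x delta K : R) : 1 < x -> 0 < delta -> 0 < K ->
  (forall A, \forall n \near \oo, A <= s n) ->
  (\forall n \near \oo, s n <= K * ln n%:R /\ g * s n * Hfun x <= (1 - delta) * ln n%:R) ->
  {ae P, forall w, \forall n \near \oo, (Num.trunc (g * x * s n)%R <= om n w)%N}.
Proof.
move=> x1 dl0 K0 Hs H.
have x0 : 0 < x by lra.
(* [eps] enters once through [(1 + eps) * g * s n], and with weight [2 x] through
   [ln (1 - eps) >= - 2 eps]; this keeps the total below [delta / 4 * ln n]. *)
pose q := delta / (4 * g * K * (1 + 2 * x)).
have q0 : 0 < q by rewrite divr_gt0// !mulr_gt0//; lra.
pose eps := Num.min 2^-1 q.
have eps0 : 0 < eps by rewrite lt_min q0 andbT invr_gt0.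
have eps2 : eps <= 2^-1 by rewrite ge_min lexx.
have epsq : eps <= q by rewrite ge_min lexx orbT.
apply: (@clique_ge_near eps (delta / 4)); first by apply/andP; split => //; lra.
- by rewrite divr_gt0.
- near=> n => _; rewrite le_max; apply/orP; right.
  have : (g * (x - 1))^-1 <= s n by near: n.
  have sn0 : 0 <= s n by rewrite mulr_ge0// exprn_ge0// ltW.
  have gx : 0 < g * (x - 1) by rewrite mulr_gt0// subr_gt0.
  rewrite -(ler_pM2l gx) divff ?gt_eqF// => h.
  have : 0 <= eps * (g * s n) by do 2 (apply: mulr_ge0; first exact: ltW).
  by move: h; lra.
move=> C; near=> n => _.
have [sK Hn] : s n <= K * ln n%:R /\ g * s n * Hfun x <= (1 - delta) * ln n%:R by near: n.
have s1 : 1 <= s n by near: n.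
have sn0 : 0 < s n by lra.
have gs0 : 0 <= g * s n by rewrite mulr_ge0// ltW.
pose k := delta / (8 * K).
have k0 : 0 < k by rewrite divr_gt0// mulr_gt0.
have ls : 2 * ln (s n) <= delta / 4 * ln n%:R - 2 - 2 * ln k.
  have := ln_le_linear k0 sn0.
  have : k * s n <= delta / 8 * ln n%:R.
    apply: le_trans (ler_wpM2l (ltW k0) sK) _.
    by rewrite le_eqVlt; apply/orP; left; apply/eqP; rewrite /k; field; rewrite gt_eqF.
  by lra.
have lC : (C + ln (g * x) - 2 - 2 * ln k) * 4 / delta <= ln n%:R by near: n; exact: near_ln_ge.
move: lC; rewrite ler_pdivrMr// => lC.
have -> : ln (g * x * s n) = ln (g * x) + ln (s n) by rewrite lnM ?posrE//; exact: mulr_gt0.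
have -> : (1 - eps) * g * s n / (g * x * s n) = (1 - eps) / x.
  by field; rewrite !gt_eqF.
have e1 : 0 < 1 - eps by lra.
have le : - (2 * eps) <= ln (1 - eps).
  apply: le_trans (ln_ge_1V e1); rewrite -subr_ge0.
  have -> : 1 - (1 - eps)^-1 - - (2 * eps) = eps * (1 - 2 * eps) / (1 - eps).
    by field; rewrite gt_eqF.
  by rewrite divr_ge0 ?mulr_ge0 ?(ltW eps0) ?(ltW e1)//; lra.
rewrite ln_div ?posrE//.
have xl : x * ln x = Hfun x + (x - 1) by rewrite /Hfun; ring.
have -> : g * x * s n * (1 + (ln (1 - eps) - ln x)) = g * s n * x * ln (1 - eps) + g * s n * (1 - Hfun x).
  by rewrite (_ : 1 - Hfun x = x - x * ln x); [ring|rewrite xl; ring].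
have H1 : - (2 * eps * (g * s n * x)) <= g * s n * x * ln (1 - eps).
  rewrite -mulNr mulrC; apply: ler_wpM2l => //.
  by rewrite mulr_ge0// ltW.
have H2 : eps * (1 + 2 * x) * (g * s n) <= delta / 4 * ln n%:R.
  apply: le_trans (_ : q * (1 + 2 * x) * (g * (K * ln n%:R)) <= _).
    apply: ler_pM => //.
    - by rewrite mulr_ge0 ?ltW//; lra.
    - by apply: ler_wpM2r => //; lra.
    - by apply: ler_wpM2l => //; exact: ltW.
  rewrite le_eqVlt; apply/orP; left; apply/eqP; rewrite /q.
  by field; rewrite !gt_eqF//; lra.
move: Hn ls lC H1 H2; set W := g * s n * x * _; set Z := ln n%:R; lra.
Unshelve. all: by end_near.
Qed.

(** With a mean far above [ln n] a single cell is enough: the lower tail with [b = x < 1] already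
    gives a failure probability of at most [n^-4]. *)
Lemma dense_lower (x : R) : 0 < x < 1 ->
  (fun n : nat => ln n%:R / s n) @ \oo --> (0 : R) ->
  {ae P, forall w, \forall n \near \oo, (Num.trunc (g * x * s n)%R <= om n w)%N}.
Proof.
move=> /andP[x0 x1] Hs.
(* Below 1 the monotonicity of [Hfun_lt] does not apply; positivity is [exp u > 1 + u] at
   [u = ln (1/x)], multiplied by [x]. *)
have H0 : 0 < Hfun x.
  have : 0 < x^-1 - 1 - ln x^-1.
    have l0 : ln x^-1 != 0 by rewrite gt_eqF// ln_gt0// invf_gt1.
    by have := expR_gt1Dx l0; rewrite lnK ?posrE ?invr_gt0//; lra.
  rewrite lnV ?posrE// -(pmulr_rgt0 _ x0) /Hfun !mulrBr divff ?gt_eqF//; lra.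
pose eps := Num.min 2^-1 (Hfun x / (2 * (1 - x))).
have x10 : 0 < 1 - x by rewrite subr_gt0.
have eps0 : 0 < eps by rewrite lt_min invr_gt0 ltr0n/= divr_gt0// mulr_gt0.
have eps2 : eps <= 2^-1 by rewrite ge_min lexx.
have epsH : eps * (1 - x) <= Hfun x / 2.
  apply: le_trans (_ : Hfun x / (2 * (1 - x)) * (1 - x) <= _).
    by apply: ler_wpM2r; [exact: ltW|rewrite ge_min lexx orbT].
  by rewrite le_eqVlt; apply/orP; left; apply/eqP; field; rewrite gt_eqF.
have eps01 : 0 < eps < 1 by apply/andP; split => //; lra.
have [c [r0 [c0 r00 cells]]] := clique_cells d_gt0 HN f_ge0 f_leM f_meas X_meas X_law eps01.
suff : {ae P, forall w, \forall n \near \oo, ~ [set w | (om n w < Num.trunc (g * x * s n)%R)%N] w}.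
  by apply: filterS => w; apply: filterS => n /= /negP; rewrite -leqNgt.
apply: (@borel_cantelli_cover _ _ _ _ _ 1); near=> n.
have n0 : (0 < n)%N by near: n; exact: near_nat_gt0.
have l1 : 1 <= ln n%:R :> R by near: n; exact: near_ln_ge.
have rn : r n < r0 by near: n; exact: radius_lt.
have [m [W [mc bW dW HW pW]]] := cells (r n) (r_gt0 n) rn.
have m0 : (0 < m)%N.
  by rewrite -(ltr0n R); apply: lt_le_trans mc; rewrite divr_gt0// exprn_gt0.
pose i0 := Ordinal m0; have /andP[p1 _] := pW i0.
set k := Num.trunc (g * x * s n).
have [|E mE [EF PE]] := lower_tail X_meas X_indep X_ident n k (bW i0) (_ : 0 < x <= 1).
  by rewrite x0 ltW.
exists E => //; split.
  by move=> w /= omk; apply: EF; apply: leq_ltn_trans omk; apply: cnt_le_om => u v; exact: HW.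
apply: le_trans PE _; rewrite lee_fin.
have sn0 := s_gt0 n0.
have muE : n%:R * (ess_sigma f * vB N * (r n / 2) ^+ d) = g * s n.
  by rewrite /g /s expr_div_n; ring.
set p := prob P X (W i0) in p1 *.
have np : (1 - eps) * (g * s n) <= n%:R * p.
  by have := ler_wpM2l (ler0n R n) p1; rewrite mulrCA muE.
have p_le1 : p <= 1.
  by rewrite -lee_fin -(probE X_meas X_ident 0 (bW i0)) probability_le1//; apply: X_meas.
have q0 : 0 <= 1 - p * (1 - x).
  by rewrite subr_ge0 mulr_ile1 ?prob_ge0// ?(ltW x10)//; lra.
have H1 : (1 - p * (1 - x)) ^+ n <= expR (- (n%:R * p * (1 - x))).
  rewrite (_ : - (n%:R * p * (1 - x)) = n%:R * - (p * (1 - x))); last by ring.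
  by rewrite expRM_natl lerXn2r ?nnegrE ?expR_ge0 ?expR_ge1Dx.
have ky : k%:R <= g * x * s n by rewrite truncn_le; do 2 (apply: mulr_ge0; last exact: ltW); exact: ltW.
have H2 : expR (g * x * s n * ln x) <= x ^+ k.
  rewrite -[x ^+ k](@lnK R) ?posrE ?exprn_gt0// ler_expR lnXn// -mulr_natl.
  by rewrite ler_wnM2r// ln_le0// ltW.
have gs : 4 * 2 * ln n%:R <= g * s n * Hfun x.
  have gH : 0 < g * Hfun x by rewrite mulr_gt0.
  have : ln n%:R / s n < g * Hfun x / (4 * 2).
    by near: n; apply: (cvgr_lt _ Hs); rewrite divr_gt0 ?mulr_gt0.
  rewrite ltr_pdivrMr// => /ltW; rewrite mulrAC ler_pdivlMr// => h.
  by rewrite mulrC [leRHS]mulrAC.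
apply: le_trans (_ : expR (- (2 * (2 * ln n%:R))) <= _).
  apply: le_trans (_ : expR (- (n%:R * p * (1 - x))) / expR (g * x * s n * ln x) <= _).
    apply: ler_pM; rewrite ?exprn_ge0 ?invr_ge0 ?exprn_ge0 ?(ltW x0)//.
    by rewrite lef_pV2 ?posrE ?expR_gt0 ?exprn_gt0.
  rewrite -expRN -expRD ler_expR.
  have h1 := ler_wpM2r (ltW x10) np.
  have h2 : g * s n * (eps * (1 - x)) <= g * s n * (Hfun x / 2).
    by apply: ler_wpM2l => //; rewrite mulr_ge0// ltW.
  have h3 : 4 * ln n%:R <= g * s n * (Hfun x / 2).
    by rewrite mulrA ler_pdivlMr// mulrAC.
  have xl : x * ln x = Hfun x + (x - 1) by rewrite /Hfun; ring.
  have -> : g * x * s n * ln x = g * s n * (Hfun x + (x - 1)) by rewrite -xl; ring.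
  exact: (chernoff_exponent h1 h2 h3).
have N1 : 0 < n.+1%:R :> R by rewrite ltr0n.
have lN := ln_natS_le n0 l1.
apply: le_trans (_ : expR (- (2 * ln n.+1%:R)) <= _).
  by rewrite ler_expR lerN2 ler_pM2l.
by rewrite expRN expRM_natl lnK ?posrE// div1r.
Unshelve. all: by end_near.
Qed.


(** A ratio [c] to [sigma n r^d] is a ratio [x = c 2^d / vol B] to the mean [g * s n], and [x] is
    the argument of [Hfun] in the equation for [f_omega]. *)
Let ratioE c n : g * (c * 2 ^+ d / vB N) * s n = c * (ess_sigma f * s n).
Proof. by rewrite /g; field; rewrite !gt_eqF// exprn_gt0. Qed.

Let ratio_gt1 c : vB N / 2 ^+ d < c -> 1 < c * 2 ^+ d / vB N.
Proof. by rewrite ltr_pdivrMr ?exprn_gt0// => H; rewrite ltr_pdivlMr// mul1r. Qed.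

Let upper_ratio c : (\forall n \near \oo, 1 <= s n) ->
  {ae P, forall w, \forall n \near \oo, (om n w)%:R <= g * (c * 2 ^+ d / vB N) * s n} ->
  {ae P, forall w, \forall n \near \oo, (om n w)%:R / (ess_sigma f * s n) <= c}.
Proof.
move=> Hs; apply: filterS => w; apply: filterS2 Hs => n s1 H.
by rewrite ler_pdivrMr -?ratioE// mulr_gt0//; lra.
Qed.

(** The gap between [c] and [c'] absorbs the truncation, as [s n] tends to infinity. *)
Let lower_ratio c c' : c < c' -> (forall A, \forall n \near \oo, A <= s n) ->
  {ae P, forall w, \forall n \near \oo, (Num.trunc (g * (c' * 2 ^+ d / vB N) * s n)%R <= om n w)%N} ->
  {ae P, forall w, \forall n \near \oo, c <= (om n w)%:R / (ess_sigma f * s n)}.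
Proof.
move=> cc' Hs; apply: filterS => w Hw; near=> n.
have s1 : 1 <= s n by near: n; exact: Hs.
have sn0 : 0 < s n by lra.
have s2 : (c' - c)^-1 / ess_sigma f <= s n by near: n; exact: Hs.
have H : (Num.trunc (g * (c' * 2 ^+ d / vB N) * s n)%R <= om n w)%N by near: n.
have ss0 : 0 < ess_sigma f * s n by exact: mulr_gt0.
rewrite ler_pdivlMr//.
apply: le_trans (_ : (Num.trunc (g * (c' * 2 ^+ d / vB N) * s n)%R)%:R <= _); last by rewrite ler_nat.
have := truncnS_gt (g * (c' * 2 ^+ d / vB N) * s n).
rewrite -[X in _ < X -> _]natr1 {1}ratioE.
move: s2; rewrite ler_pdivrMr// -[(c' - c)^-1]mul1r ler_pdivrMr ?subr_gt0// => s2 s3.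
by move: s2 s3; rewrite [s n * _]mulrC; set Z := ess_sigma f * s n; lra.
Unshelve. all: by end_near.
Qed.

(** Both bounds compare [g * s n * Hfun x] with [ln n], that is [t * (vol B / 2^d) * Hfun x] with 1;
    equality is the equation for [f_omega]. Lower bounds are sought only for [c > vol B / 2^d],
    where [x > 1]. *)
Lemma critical_regime (t : R) : 0 < t ->
  (fun n : nat => ess_sigma f * s n / ln n%:R) @ \oo --> t ->
  {ae P, forall w, (fun n : nat => (om n w)%:R / (ess_sigma f * s n)) @ \oo --> f_omega d (vB N) t}.
Proof.
move=> t0 Ht.
have F1 lo hi : lo < t -> t < hi -> \forall n \near \oo,
    [/\ (0 < n)%N, 1 <= ln n%:R :> R, lo * ln n%:R <= ess_sigma f * s n & ess_sigma f * s n <= hi * ln n%:R].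
  move=> lot thi; near=> n.
  have n0 : (0 < n)%N by near: n; exact: near_nat_gt0.
  have l1 : 1 <= ln n%:R :> R by near: n; exact: near_ln_ge.
  have l0 : 0 < ln n%:R :> R by lra.
  split => //.
    by rewrite -ler_pdivlMr//; apply: ltW; near: n; exact: (cvgr_gt _ Ht).
  by rewrite -ler_pdivrMr//; apply: ltW; near: n; exact: (cvgr_lt _ Ht).
have tt2 : t / 2 < t by lra.
have tt3 : t < 2 * t by lra.
have Hs A : \forall n \near \oo, A <= s n.
  near=> n.
  have [n0 l1 h1 _] : [/\ (0 < n)%N, 1 <= ln n%:R :> R, t / 2 * ln n%:R <= ess_sigma f * s n &
      ess_sigma f * s n <= 2 * t * ln n%:R] by near: n; exact: F1.
  have : A * ess_sigma f / (t / 2) <= ln n%:R by near: n; exact: near_ln_ge.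
  have t20 : 0 < t / 2 by lra.
  rewrite ler_pdivrMr// => h2.
  rewrite -(ler_pM2l sigma0); move: h1 h2; lra.
pose K := 2 * t / ess_sigma f.
have K0 : 0 < K by rewrite divr_gt0// mulr_gt0.
have HK : \forall n \near \oo, s n <= K * ln n%:R.
  near=> n.
  have [n0 l1 _ h1] : [/\ (0 < n)%N, 1 <= ln n%:R :> R, t / 2 * ln n%:R <= ess_sigma f * s n &
      ess_sigma f * s n <= 2 * t * ln n%:R] by near: n; exact: F1.
  have KE : ess_sigma f * (K * ln n%:R) = 2 * t * ln n%:R by rewrite /K; field; rewrite gt_eqF.
  by rewrite -(ler_pM2l sigma0) KE.
pose a0 := vB N / 2 ^+ d.
have a00 : 0 < a0 by rewrite divr_gt0// exprn_gt0.
have gE n : g * s n = a0 * (ess_sigma f * s n) by rewrite /g /a0; ring.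
have [fge fH] := f_omegaP d v0 t0.
have HH : 2 ^+ d / (t * vB N) = (a0 * t)^-1.
  by rewrite /a0; field; rewrite !gt_eqF// exprn_gt0.
rewrite HH in fH.
have at0 : 0 < a0 * t by exact: mulr_gt0.
have fgt := f_omega_gt d v0 t0.
apply: (@ae_cvg_sandwich _ _ (vB N / 2 ^+ d)) => // c.
- move=> cf; apply: upper_ratio => //.
  set x := c * 2 ^+ d / vB N.
  have x1 : 1 < x by apply: ratio_gt1; apply: lt_trans cf.
  have Hx : (a0 * t)^-1 < Hfun x.
    rewrite -fH; apply: Hfun_lt; first exact: ratio_ge1.
    by rewrite /x ltr_pM2r ?invr_gt0// ltr_pM2r// exprn_gt0.
  have Hx0 : 0 < Hfun x by apply: lt_trans Hx; rewrite invr_gt0.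
  have Hxt : 1 < t * (a0 * Hfun x).
    by move: Hx; rewrite -[(_ * t)^-1]mul1r ltr_pdivrMr// => Hx; move: Hx; lra.
  (* [1 + 2 * a] is the midpoint of 1 and [t * (a0 * Hfun x)]. *)
  pose a := (t * (a0 * Hfun x) - 1) / 4.
  have a_gt0 : 0 < a by rewrite divr_gt0// subr_gt0.
  have b0 : 0 < a0 * Hfun x by exact: mulr_gt0.
  have lot : (1 + 2 * a) / (a0 * Hfun x) < t.
    by rewrite ltr_pdivrMr// /a; lra.
  apply: (@supercritical_upper a) => //.
  near=> n; split; first by near: n; exact: Hs.
  + apply: le_trans (_ : 1 + g * x * K * ln n%:R <= _).
      rewrite lerD2l -[leRHS]mulrA; apply: ler_wpM2l; last by near: n.
      by rewrite mulr_ge0// ltW//; lra.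
    near: n; apply: near_ln_powR; first by rewrite divr_gt0.
    by do 2 (apply: mulr_ge0; last by first [exact: ltW|exact: ltW (lt_trans ltr01 x1)]); exact: ltW.
  have [n0 l1 h1 _] : [/\ (0 < n)%N, 1 <= ln n%:R :> R, (1 + 2 * a) / (a0 * Hfun x) * ln n%:R <= ess_sigma f * s n &
      ess_sigma f * s n <= 2 * t * ln n%:R] by near: n; exact: F1.
  move: h1; rewrite mulrAC ler_pdivrMr// gE => h1.
  apply: le_trans h1 _; rewrite le_eqVlt; apply/orP; left; apply/eqP; ring.
move=> c0 c1; pose c' := (c + f_omega d (vB N) t) / 2.
have cc' : c < c' by rewrite /c'; lra.
have c'1 : c' < f_omega d (vB N) t by rewrite /c'; lra.
apply: (lower_ratio cc') => //.
set x := c' * 2 ^+ d / vB N.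
have x1 : 1 < x by apply: ratio_gt1; apply: lt_trans cc'.
have Hx : Hfun x < (a0 * t)^-1.
  rewrite -fH; apply: Hfun_lt; first exact: ltW.
  by rewrite /x ltr_pM2r ?invr_gt0// ltr_pM2r// exprn_gt0.
have Hxt : t * (a0 * Hfun x) < 1.
  by move: Hx; rewrite -[(_ * t)^-1]mul1r ltr_pdivlMr// => Hx; move: Hx; lra.
have Hx0 : 0 < Hfun x by rewrite -Hfun1 Hfun_lt.
have b0 : 0 < a0 * Hfun x by exact: mulr_gt0.
pose dl := (1 - t * (a0 * Hfun x)) / 2.
have dl0 : 0 < dl by rewrite divr_gt0// subr_gt0.
have hit : t < (1 - dl) / (a0 * Hfun x).
  by rewrite ltr_pdivlMr// /dl; lra.
apply: (@critical_lower x dl K) => //.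
near=> n; split; first by near: n.
have [n0 l1 _ h1] : [/\ (0 < n)%N, 1 <= ln n%:R :> R, t / 2 * ln n%:R <= ess_sigma f * s n &
    ess_sigma f * s n <= (1 - dl) / (a0 * Hfun x) * ln n%:R] by near: n; exact: F1.
move: h1; rewrite mulrAC ler_pdivlMr// gE => h1.
apply: le_trans h1; rewrite le_eqVlt; apply/orP; left; apply/eqP; ring.
Unshelve. all: by end_near.
Qed.

(** Since [ln n] is negligible against [s n], every [x > 1] is excluded from above and every [x < 1]
    from below; the limit is the value at [x = 1]. *)
Lemma dense_regime :
  (fun n : nat => ln n%:R / s n) @ \oo --> (0 : R) ->
  {ae P, forall w, (fun n : nat => (om n w)%:R / (ess_sigma f * s n)) @ \oo --> vB N / 2 ^+ d}.
Proof.
move=> Hl.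
have F1 K : 0 < K -> \forall n \near \oo, K * ln n%:R <= s n.
  move=> K0; near=> n.
  have n0 : (0 < n)%N by near: n; exact: near_nat_gt0.
  have : ln n%:R / s n < K^-1 by near: n; apply: (cvgr_lt _ Hl); rewrite invr_gt0.
  by rewrite ltr_pdivrMr ?s_gt0// ltr_pdivlMl// => /ltW.
have Hs A : \forall n \near \oo, A <= s n.
  near=> n; apply: le_trans (_ : 1 * ln n%:R <= _); last by near: n; exact: F1.
  by rewrite mul1r; near: n; exact: near_ln_ge.
have a00 : 0 < vB N / 2 ^+ d by rewrite divr_gt0// exprn_gt0.
apply: (@ae_cvg_sandwich _ _ 0) => // c.
- move=> cf; apply: upper_ratio => //.
  set x := c * 2 ^+ d / vB N.
  have x1 : 1 < x by exact: ratio_gt1.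
  have Hx0 : 0 < Hfun x by rewrite -Hfun1 Hfun_lt.
  have gH : 0 < g * Hfun x by exact: mulr_gt0.
  (* [s n] is bounded only by [n], so the polynomial bound on clique sizes has to exceed [n];
     [a = 4] makes it [n ^ 2], and the larger multiple of [ln n] is still negligible against
     [s n]. *)
  apply: (@supercritical_upper 4) => //.
  near=> n; split; first by near: n; exact: Hs.
  + have n0 : (0 < n)%N by near: n; exact: near_nat_gt0.
    have r1 : r n < 1 by near: n; exact: radius_lt.
    rewrite (_ : 4 / 2 = 2%:R); last by field.
    rewrite powR_mulrn// expr2.
    have sn : s n <= n%:R by rewrite ler_piMr// exprn_ile1// ltW.
    have n1 : 1 <= n%:R :> R by rewrite ler1n.
    have nA : 1 + g * x <= n%:R.
      by near: n; exists (Num.bound (1 + g * x)) => // n /= Hn;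
        apply: le_trans (ltW (archi_boundP _)) _; rewrite ?ler_nat// addr_ge0// mulr_ge0 ?ltW//; lra.
    have gx : 0 <= g * x by rewrite mulr_ge0 ?ltW//; lra.
    have := ler_wpM2l gx sn; have := ler_wpM2r (ler0n R n) nA; lra.
  have : (1 + 2 * 4) / (g * Hfun x) * ln n%:R <= s n by near: n; apply: F1; apply: divr_gt0 => //; lra.
  rewrite mulrAC ler_pdivrMr// => h; apply: le_trans h _.
  by rewrite mulrCA mulrA.
move=> c0 c1; pose c' := (c + vB N / 2 ^+ d) / 2.
have cc' : c < c' by rewrite /c'; lra.
have c'1 : c' < vB N / 2 ^+ d by rewrite /c'; lra.
apply: (lower_ratio cc') => //; apply: dense_lower => //; apply/andP; split.
  by rewrite divr_gt0// mulr_gt0 ?exprn_gt0//; lra.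
by move: c'1; rewrite ltr_pdivlMr ?exprn_gt0// => H; rewrite ltr_pdivrMr// mul1r.
Unshelve. all: by end_near.
Qed.

End CliqueAsymptotics.

Theorem theorem1p2
  (R : realType) (d : nat) (d_gt0 : (0 < d)%N)
  (N : 'rV[R]_d -> R) (HN : is_norm N)
  (d0 : measure_display) (Omega : measurableType d0) (P : probability Omega R)
  (f : 'rV[R]_d -> R)
  (f_ge0 : forall x, 0 <= f x)
  (f_bounded : exists M : R, forall x, f x <= M)
  (f_meas : forall B : set R, measurable B -> borelRd (f @^-1` B))
  (X : nat -> Omega -> 'rV[R]_d)
  (X_meas : forall i A, borelRd A -> measurable (X i @^-1` A))
  (X_law : forall i, has_density P (X i) f)
  (X_indep : mutually_independent P X)
  (r : nat -> R) (r_gt0 : forall n, 0 < r n) (r_to0 : r @ \oo --> (0 : R)) :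
  let sigma := ess_sigma f in
  let vB := fine (vol (unit_ball N)) in
  let nrd := fun n : nat => n%:R * r n ^+ d in
  let omega := fun (n : nat) (w : Omega) =>
    clique_number n N X (r n) w in
  (* 1. sparse regime *)
  ((exists alpha : R, 0 < alpha /\
      \forall n \near \oo, nrd n <= n%:R `^ (- alpha)) ->
   {ae P, forall w, \forall n \near \oo,
      let k := Num.floor (ln n%:R / ln (nrd n)^-1 + 2^-1) in
      ((omega n w)%:Z == k) || ((omega n w)%:Z == k + 1)})
  /\
  (* 2. intermediate regime *)
  ((forall eps : R, 0 < eps ->
      (fun n : nat => n%:R `^ (- eps) / nrd n) @ \oo --> (0 : R)) ->
   (fun n : nat => nrd n / ln n%:R) @ \oo --> (0 : R) ->
   {ae P, forall w,
      (fun n : nat => (omega n w)%:R / (ln n%:R / ln (ln n%:R / nrd n)))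
        @ \oo --> (1 : R)})
  /\
  (* 3. critical regime *)
  (forall t : R, 0 < t ->
   (fun n : nat => sigma * nrd n / ln n%:R) @ \oo --> t ->
   {ae P, forall w,
      (fun n : nat => (omega n w)%:R / (sigma * nrd n)) @ \oo --> f_omega d vB t})
  /\
  (* properties of f_omega *)
  ((forall t : R, 0 < t -> exists! fv : R, f_omega_pred d vB t fv)
   /\ {in `]0, +oo[, continuous (f_omega d vB)}
   /\ {in `]0, +oo[ &, forall s t, s < t -> f_omega d vB t < f_omega d vB s}
   /\ f_omega d vB t @[t --> +oo] --> vB / 2 ^+ d
   /\ f_omega d vB t @[t --> 0^'+] --> +oo)
  /\
  (* 4. dense regime *)
  ((fun n : nat => ln n%:R / nrd n) @ \oo --> (0 : R) ->
   {ae P, forall w,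
      (fun n : nat => (omega n w)%:R / (sigma * nrd n)) @ \oo --> vB / 2 ^+ d}).
Proof.
have [M fM] := f_bounded.
have [mu Hmu] := iint_represented R d.
have v0 : 0 < fine (vol (unit_ball N)) := vB_gt0 HN Hmu.
split; first by move=> [alpha [a0 H]]; exact: (sparse_regime d_gt0 HN f_ge0 fM f_meas X_meas X_law X_indep r_gt0 r_to0 a0 H).
split; first exact: (intermediate_regime d_gt0 HN f_ge0 fM f_meas X_meas X_law X_indep r_gt0 r_to0).
split; first by move=> t; exact: (critical_regime d_gt0 HN f_ge0 fM f_meas X_meas X_law X_indep r_gt0 r_to0).
split; last exact: (dense_regime d_gt0 HN f_ge0 fM f_meas X_meas X_law X_indep r_gt0 r_to0).
split; first by move=> t; exact: f_omega_uniqueness.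
split; first exact: f_omega_continuous.
split; first exact: f_omega_decreasing.
by split; [exact: f_omega_cvg_infty|exact: f_omega_cvg0].
Qed.
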